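(* Let $M$ be a connected, complete, $C^\infty$ Riemannian manifold with Riemannian distance $\mathrm{d}$. Let $c:M\times M\to\mathbb{R}$ be a locally semi-concave function which is uniformly super-linear, uniformly bounded, and satisfies both the left and the right twist conditions. Let $\alpha[0]$ be the critical constant of $c$. Then there is a $C^{1,1}$ function $u_1:M\to\mathbb{R}$ which is an $\alpha[0]$-subsolution and such that for every $(x,y)\in M\times M$: if there exists an $\alpha[0]$-subsolution $u$ with $$u(y)-u(x)<c(x,y)+\alpha[0],$$ then also $$u_1(y)-u_1(x)<c(x,y)+\alpha[0].$$
   Context: Uniform super-linearity: for every $k\ge 0$ there is $C(k)\in\mathbb{R}$ with $c(x,y)\ge k\,\mathrm{d}(x,y)-C(k)$ for all $x,y\in M$. Uniform boundedness: for every $R\in\mathbb{R}$ there is $A(R)\in\mathbb{R}$ such that $\mathrm{d}(x,y)\le R$ implies $c(x,y)\le A(R)$. Locally semi-concave (with linear modulus): every point has a chart neighborhood in which the function is the sum of a smooth function and a concave function (equivalently, $f-K\|\cdot\|^2$ is concave in the chart for some constant $K$). For $\alpha\in\mathbb{R}$, a function $u:M\to\mathbb{R}$ is an $\alpha$-subsolution if $u(y)-u(x)\le c(x,y)+\alpha$ for all $(x,y)\in M\times M$. The critical constant $\alpha[0]$ is the smallest $\alpha$ for which $\alpha$-subsolutions exist. $\frac{\partial c}{\partial x}(x,y)\in T_x^*M$ denotes the differential at $x$ of $z\mapsto c(z,y)$, and $\frac{\partial c}{\partial y}(x,y)\in T_y^*M$ the differential at $y$ of $z\mapsto c(x,z)$,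 when these exist. Right twist condition: for every $x\in M$, the map $y\mapsto\frac{\partial c}{\partial x}(x,y)$ is injective on the set where it is defined. Left twist condition: for every $y\in M$, the map $x\mapsto\frac{\partial c}{\partial y}(x,y)$ is injective on the set where it is defined. A function is $C^{1,1}$ if it is $C^1$ with locally Lipschitz differential. *)

(* Defs.v *)
From HB Require Import structures.
From mathcomp Require Import all_boot all_order all_algebra.
From mathcomp Require Import all_classical all_reals all_analysis.

Set Implicit Arguments.
Unset Strict Implicit.
Unset Printing Implicit Defensive.

Import Order.TTheory GRing.Theory Num.Theory.
Import numFieldNormedType.Exports.

Local Open Scope classical_set_scope.
Local Open Scope ring_scope.

(* C^k on an open set U, through iterated directional derivatives. This is the
   usual notion when V is finite-dimensional, the only case used below. *)
Fixpoint Ck (R : realType) (V W : normedModType R) (k : nat)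
    (U : set V) (f : V -> W) : Prop :=
  (forall x, U x -> {for x, continuous f}) /\
  match k with
  | 0 => True
  | k'.+1 => forall v, (forall x, U x -> derivable f x v) /\ Ck k' U ('D_v f)
  end.

Definition smooth (R : realType) (V W : normedModType R)
    (U : set V) (f : V -> W) : Prop := forall k, Ck k U f.

(* A chart is a total map with a total inverse; only their values on cdom and
   on cimg are meaningful. *)
Record chart (T V : Type) := Chart {
  cdom : set T;
  cmap : T -> V;
  cinv : V -> T }.

Definition cimg (T V : Type) (p : chart T V) : set V := cmap p @` cdom p.

Definition is_chart (R : realType) (T : topologicalType) (V : normedModType R)
    (p : chart T V) : Prop :=
  [/\ open (cdom p), open (cimg p),
      forall x, cdom p x -> cinv p (cmap p x) = x,
      forall x, cdom p x -> {for x, continuous (cmap p)} &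
      forall w, cimg p w -> {for w, continuous (cinv p)}].

Definition transition (T V : Type) (p q : chart T V) : V -> V :=
  cmap q \o cinv p.

Definition compatible (R : realType) (T : Type) (V : normedModType R)
    (p q : chart T V) : Prop :=
  smooth (cmap p @` (cdom p `&` cdom q)) (transition p q) /\
  smooth (cmap q @` (cdom p `&` cdom q)) (transition q p).

(* A is a maximal C^oo atlas on T, modelled on V. *)
Record smooth_structure (R : realType) (T : topologicalType)
    (V : normedModType R) (A : set (chart T V)) : Prop := SmoothStructure {
  atlas_chart : forall p, A p -> is_chart p;
  atlas_cover : forall x, exists2 p, A p & cdom p x;
  atlas_compatible : forall p q, A p -> A q -> compatible p q;
  atlas_maximal : forall p, is_chart p ->
    (forall q, A q -> compatible p q) -> A p }.

Record smooth_manifold (R : realType) (n : nat) (M : topologicalType)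
    (A : set (chart M 'rV[R]_n)) : Prop := SmoothManifold {
  manifold_hausdorff : hausdorff_space M;
  manifold_second_countable : @second_countable M;
  manifold_structure : smooth_structure A }.

Definition prod_chart (T V : Type) (p q : chart T V) : chart (T * T) (V * V) :=
  Chart (cdom p `*` cdom q)
        (fun z => (cmap p z.1, cmap q z.2))
        (fun w => (cinv p w.1, cinv q w.2)).

(* The maximal atlas of the product manifold T * T. *)
Definition prod_atlas (R : realType) (T : topologicalType)
    (V : normedModType R) (A : set (chart T V)) :
    set (chart (T * T)%type (V * V)%type) :=
  [set r | is_chart r /\
     forall p q, A p -> A q -> compatible r (prod_chart p q)].

(* g p x u v is the inner product at x of the tangent vectors whose
   coordinates in the chart p are u and v. *)
Record riemannian_metric (R : realType) (T : topologicalType)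
    (V : normedModType R) (A : set (chart T V))
    (g : chart T V -> T -> V -> V -> R) : Prop := RiemannianMetric {
  metric_linear : forall p x u a v w, A p -> cdom p x ->
    g p x u (a *: v + w) = a * g p x u v + g p x u w;
  metric_sym : forall p x u v, A p -> cdom p x -> g p x u v = g p x v u;
  metric_pos : forall p x u, A p -> cdom p x -> u != 0 -> 0 < g p x u u;
  metric_smooth : forall p u v, A p ->
    smooth (cimg p) (fun w => g p (cinv p w) u v : R^o);
  metric_transition : forall p q x u v, A p -> A q -> cdom p x -> cdom q x ->
    g p x u v = g q x ('D_u (transition p q) (cmap p x))
                      ('D_v (transition p q) (cmap p x)) }.

(* A C^1 curve on [0, 1] always extends to a C^1 curve on an open interval, and
   then, after reparametrization away from [0, 1], to the whole line. *)
Definition C1_curve (R : realType) (T : topologicalType) (V : normedModType R)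
    (A : set (chart T V)) (gam : R -> T) : Prop :=
  continuous gam /\
  forall p, A p -> Ck 1 (gam @^-1` cdom p : set R^o) (cmap p \o gam).

Definition has_speed (R : realType) (T : topologicalType)
    (V : normedModType R) (A : set (chart T V))
    (g : chart T V -> T -> V -> V -> R) (gam : R -> T) (s : R -> R) : Prop :=
  forall t p, A p -> cdom p (gam t) ->
    let v := derive1 (cmap p \o gam) t in s t = Num.sqrt (g p (gam t) v v).

(* C^1 curves may have vanishing velocity, so that the infimum is the same as
   over piecewise C^1 curves. *)
Definition rdist (R : realType) (T : topologicalType) (V : normedModType R)
    (A : set (chart T V)) (g : chart T V -> T -> V -> V -> R) (x y : T) : R :=
  inf [set l | exists gam s,
         [/\ C1_curve A gam, gam 0 = x, gam 1 = y, has_speed A g gam s &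
             l = \int[lebesgue_measure]_(t in `[0, 1]) s t]].

Definition complete_dist (R : realType) (T : Type) (d : T -> T -> R) : Prop :=
  forall u : nat -> T,
    (forall e, 0 < e -> exists N, forall i j,
       (N <= i)%N -> (N <= j)%N -> d (u i) (u j) < e) ->
    exists l, forall e, 0 < e -> exists N, forall i, (N <= i)%N -> d (u i) l < e.

Definition locally_semiconcave (R : realType) (T : Type) (V : normedModType R)
    (A : set (chart T V)) (f : T -> R) : Prop :=
  forall z, exists p,
    [/\ A p, cdom p z, convex_set (cimg p) &
        exists h k : V -> R,
          [/\ smooth (cimg p) (h : V -> R^o),
              convex_function (cimg p) (fun w => - k w) &
              forall w, cimg p w -> f (cinv p w) = h w + k w]].

Definition charts_at (R : realType) (T : Type) (V : normedModType R)
    (A : set (chart T V)) (x : T) : Type := {p : chart T V | A p /\ cdom p x}.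

Definition in_chart (R : realType) (T V : Type) (f : T -> R) (p : chart T V) :
    V -> R^o := f \o cinv p.

Definition mdifferentiable (R : realType) (T : Type) (V : normedModType R)
    (A : set (chart T V)) (f : T -> R) (x : T) : Prop :=
  forall p, A p -> cdom p x -> differentiable (in_chart f p) (cmap p x).

(* A covector at x is represented by the family of its expressions in all the
   charts around x. *)
Definition mdiff (R : realType) (T : Type) (V : normedModType R)
    (A : set (chart T V)) (f : T -> R) (x : T) : charts_at A x -> V -> R :=
  fun p => 'd (in_chart f (sval p)) (cmap (sval p) x).

Definition right_twist (R : realType) (T : Type) (V : normedModType R)
    (A : set (chart T V)) (c : T * T -> R) : Prop :=
  forall x, set_inj [set y | mdifferentiable A (fun z => c (z, y)) x]
                    (fun y => mdiff (A := A) (fun z => c (z, y)) (x := x)).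

Definition left_twist (R : realType) (T : Type) (V : normedModType R)
    (A : set (chart T V)) (c : T * T -> R) : Prop :=
  forall y, set_inj [set x | mdifferentiable A (fun z => c (x, z)) y]
                    (fun x => mdiff (A := A) (fun z => c (x, z)) (x := y)).

Definition C11 (R : realType) (T : Type) (V : normedModType R)
    (A : set (chart T V)) (f : T -> R) : Prop :=
  forall p, A p ->
    Ck 1 (cimg p) (in_chart f p) /\
    forall w, cimg p w -> exists K e : R, 0 < e /\
      forall a b v, ball w e a -> ball w e b ->
        `|'d (in_chart f p) a v - 'd (in_chart f p) b v|
          <= K * `|a - b| * `|v|.

Definition uniformly_superlinear (R : realType) (T : Type) (d : T -> T -> R)
    (c : T * T -> R) : Prop :=
  forall k, 0 <= k -> exists C, forall x y, k * d x y - C <= c (x, y).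

Definition uniformly_bounded (R : realType) (T : Type) (d : T -> T -> R)
    (c : T * T -> R) : Prop :=
  forall r, exists a, forall x y, d x y <= r -> c (x, y) <= a.

Definition subsolution (R : realType) (T : Type) (c : T * T -> R) (alpha : R)
    (u : T -> R) : Prop :=
  forall x y, u y - u x <= c (x, y) + alpha.

(* The least alpha admitting a subsolution (0 if there is no least one). *)
Definition critical_constant (R : realType) (T : Type) (c : T * T -> R) : R :=
  let S := [set alpha | exists u, subsolution c alpha u] in
  xget 0 [set alpha | S alpha /\ lbound S alpha].

(* Main.v *)
(** Write [k = c + alpha[0]]. Cycles give a subsolution at the critical constant.
    The Lax-Oleinik operators [lax k u y = inf_x (u x + k x y)] and
    [lax_plus k u x = sup_y (u y - k x y)] send subsolutions to subsolutions
    which are semi-concave, respectively semi-convex: bounded sets are relatively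
    compact by Hopf-Rinow, so super-linearity confines the infimum to a compact
    set, on which [c] is uniformly semi-concave.

    By second countability, a dyadic average [u0] of countably many continuous
    subsolutions is strict on every pair where some subsolution is. Put
    [f = lax_plus k u0]. If [f] is calibrated on [(x, y)], then so is every
    subsolution: calibration at [y] continues to some [z], hence [y] is preceded
    by some [x'] on which all subsolutions are calibrated; up to constants, the
    semi-convex [f] touches at [y], from below, both semi-concave functions
    [c (x, .)] and [c (x', .)], which therefore have the same differential there,
    and the left twist gives [x = x'].

    Every [v] with [f <= v <= lax k f], and [v < lax k f] wherever [f < lax k f],
    is a subsolution with the same strict pairs as [u0]. A [C^{1,1}] such [v] is
    inserted between the semi-convex and the semi-concave function by Ilmanen's
    lemma: in a chart, take the largest convex function below the upper one after
    adding a quadratic form, then patch with cutoffs. Being [C^{1,1}] amounts to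
    two-sided bounds on second differences. *)
Require Import Defs.
From HB Require Import structures.
From mathcomp Require Import all_boot all_order all_algebra.
From mathcomp Require Import all_classical all_reals all_analysis.
From mathcomp Require Import ring lra.
Import Order.TTheory GRing.Theory Num.Theory.
Import numFieldNormedType.Exports.
Local Open Scope classical_set_scope.
Local Open Scope ring_scope.
Set Implicit Arguments.
Unset Strict Implicit.
Unset Printing Implicit Defensive.

(** Regularity is carried by second differences alone: locally, an upper bound of
    [f (x + h) + f (x - h) - 2 f x] by a multiple of the squared norm, together with boundedness.
    Such bounds survive sums, products with nonnegative cutoffs, changes of charts, and infima over
    a compact set of parameters, so that one notion serves the cost, the Lax-Oleinik images, the
    cutoffs and the result. Differentials reappear only where two opposite bounds make an increment
    additive up to a quadratic error: the doubling limit of such an increment is linear, and it is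
    the differential.

    Continuity of the subsolutions serves twice. It makes strictness an open condition on pairs, so
    that countably many subsolutions suffice; and it makes the infima and suprema in the Lax-Oleinik
    operators attained, which supplies the neighbours of [y] in the calibration argument. The order
    of the two operators matters too: in [f <= lax k f] the lower function is semi-convex and the
    upper one semi-concave, the order in which a C^{1,1} function fits in between. *)

Lemma natmul_bounded_eq0 (R : realType) (x B : R) :
  (forall m : nat, m%:R * `|x| <= B) -> x = 0.
Proof.
move=> h; apply/eqP; rewrite -normr_eq0; apply/negPn/negP => x0.
have xp : 0 < `|x| by rewrite lt_def x0 normr_ge0.
have := h (Num.bound (B / `|x|)).
have B0 : 0 <= B by have := h 0; rewrite mul0r.
have /archi_boundP : 0 <= B / `|x| by rewrite divr_ge0.
by rewrite ltr_pdivrMr// => h1 /(lt_le_trans h1); rewrite ltxx.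
Qed.

Lemma le_exp2_eq0 (R : realType) (x C : R) (k0 : nat) :
  (forall k, (k0 <= k)%N -> `|x| <= C * (2 ^+ k)^-1) -> x = 0.
Proof.
move=> h; apply: (@natmul_bounded_eq0 _ _ C) => m.
have := h (m + k0)%N (leq_addl _ _).
have p2 : 0 < 2 ^+ (m + k0) :> R by rewrite exprn_gt0.
rewrite ler_pdivlMr// => /(le_trans _); apply; rewrite mulrC ler_wpM2l//.
rewrite -natrX ler_nat; apply: ltnW; apply: leq_ltn_trans (ltn_expl _ _) => //.
exact: leq_addr.
Qed.

Lemma exists_exp2_lt (R : realType) (x e : R) : 0 < e -> exists k, x < 2 ^+ k * e.
Proof.
move=> e0; exists (Num.bound (`|x| / e)).
have /archi_boundP : 0 <= `|x| / e by rewrite divr_ge0// ltW.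
rewrite ltr_pdivrMr// => h; apply: le_lt_trans (ler_norm _) _.
apply: lt_le_trans h _; rewrite ler_wpM2r ?(ltW e0)//.
by rewrite -natrX ler_nat ltnW// ltn_expl.
Qed.

(** A single integer serves both as the constant of an estimate and, through its inverse, as the
    radius on which it holds; compactness arguments then have only one number to make uniform. *)
Lemma exists_nat_small (R : realType) (C e : R) : 0 <= C -> 0 < e ->
  exists2 N : nat, C <= N%:R & forall t, t * N.+1%:R <= 1 -> t < e.
Proof.
move=> C0 e0; exists (Num.bound (C + e^-1)); set N := Num.bound _.
all: have Nb : C + e^-1 < N%:R by apply: archi_boundP; rewrite addr_ge0// invr_ge0 ltW.
  by apply: le_trans (ltW Nb); rewrite lerDl invr_ge0 ltW.
move=> t; have N0 : 0 < N.+1%:R :> R by rewrite ltr0n.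
rewrite -ler_pdivlMr// mul1r => /le_lt_trans; apply.
rewrite invf_plt ?posrE//; apply: lt_trans (_ : N%:R < _); last by rewrite ltr_nat.
by apply: le_lt_trans Nb; rewrite lerDr.
Qed.

(** * Almost additive functions and differentiability *)

Section ApproxLinear.
Context {R : realType} {V : normedModType R}.
Implicit Types (v w : V).

(** For fixed [v] the defect of homogeneity is additive in the scalar and vanishes at [1 / m], so it
    is periodic. Bounded on one period, it is bounded everywhere, and a bounded additive function is
    zero. *)
Lemma additive_bounded_homogeneous (L : V -> R) (e B : R) : 0 < e ->
  {morph L : v w / v + w} -> (forall v, `|v| < e -> `|L v| <= B) ->
  forall t v, L (t *: v) = t * L v.
Proof.
move=> e0 LD LB t v; apply/eqP; rewrite -subr_eq0; apply/eqP.
pose D (s : R) := L (s *: v) - s * L v.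
have DD s s' : D (s + s') = D s + D s' by rewrite /D scalerDl LD mulrDl; ring.
have D0 : D 0 = 0 by have := DD 0 0; rewrite addr0 => h; lra.
have DN s : D (- s) = - D s.
  by have := DD s (- s); rewrite subrr D0 => h; lra.
have Dn s (m : nat) : D (s *+ m) = m%:R * D s.
  elim: m => [|m IH]; first by rewrite mulr0n D0 mul0r.
  by rewrite mulrSr DD IH -natr1 mulrDl mul1r.
(* [m] is so large that [s *: v] stays in the ball where [L] is bounded, for [s] in one period
   [[0, 1 / m]]. *)
have [m [m0 hm]] : exists m : nat, (0 < m)%N /\ `|v| < m%:R * e.
  have /archi_boundP : 0 <= `|v| / e by rewrite divr_ge0// ltW.
  move=> h; exists (Num.bound (`|v| / e)).+1; split=> //.
  move: h; rewrite ltr_pdivrMr// => /lt_le_trans; apply.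
  by rewrite ler_wpM2r ?(ltW e0)// ler_nat.
have mp : (0 : R) < m%:R by rewrite ltr0n.
have Dm : D m%:R^-1 = 0.
  have := Dn m%:R^-1 m; rewrite -[_ *+ m]mulr_natr mulVf ?gt_eqF//.
  have -> : D 1 = 0 by rewrite /D scale1r mul1r subrr.
  by move=> /esym/eqP; rewrite mulf_eq0 gt_eqF//= => /eqP.
have Dz (z : int) : D (z%:~R * m%:R^-1) = 0.
  case: z => z.
    by rewrite -[Posz z]/(z%:Z) -pmulrn mulr_natl Dn Dm mulr0.
  by rewrite NegzE mulrNz mulNr DN -pmulrn mulr_natl Dn Dm mulr0 oppr0.
apply: (@natmul_bounded_eq0 _ _ (B + `|L v|)) => k.
rewrite -[X in _ * `|X|]/(D t) -[k%:R]normr_nat -normrM -Dn.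
pose z := Num.floor (t *+ k * m%:R).
pose s := t *+ k - z%:~R * m%:R^-1.
have -> : D (t *+ k) = D s.
  by rewrite -[t *+ k](subrK (z%:~R * m%:R^-1)) DD Dz addr0.
have [s0 s1] : 0 <= s /\ s <= m%:R^-1.
  have := floor_le (t *+ k * m%:R); have := floorD1_gt (t *+ k * m%:R).
  rewrite -/z intrD => h1 h2; rewrite /s; split.
    by rewrite subr_ge0 ler_pdivrMr.
  rewrite lerBlDr -{1}[m%:R^-1]mul1r -mulrDl ler_pdivlMr//; apply: ltW.
  by rewrite addrC.
have sm : `|s| <= m%:R^-1 by rewrite ger0_norm.
have m1 : m%:R^-1 <= 1 :> R by rewrite invf_le1// ler1n.
apply: le_trans (ler_normB _ _) _; apply: lerD.
  apply: LB; rewrite normrZ.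
  apply: le_lt_trans (_ : m%:R^-1 * `|v| < _); first by rewrite ler_wpM2r.
  by rewrite mulrC ltr_pdivrMr// mulrC.
rewrite normrM -[leRHS]mul1r ler_wpM2r//; exact: le_trans sm m1.
Qed.

(* [L v] is the limit of [2^k A (v / 2^k)], written as a supremum since
   [2^k A (v / 2^k) - C |v|^2 / 2^k] is nondecreasing in [k]. *)
Lemma approx_linear (A : V -> R) (C e B : R) : 0 < e -> 0 <= C ->
  (forall v w, `|v| < e -> `|w| < e ->
     `|A (v + w) - A v - A w| <= C * (`|v| ^+ 2 + `|w| ^+ 2)) ->
  (forall v, `|v| < e -> `|A v| <= B) ->
  exists L : V -> R, [/\ {morph L : v w / v + w},
    forall t v, L (t *: v) = t * L v &
    forall v, `|v| < e -> `|A v - L v| <= C * `|v| ^+ 2].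
Proof.
move=> e0 C0 AD AB.
pose p k : R := 2 ^+ k.
have p0 k : 0 < p k by rewrite exprn_gt0.
have pn0 k : p k != 0 by rewrite gt_eqF.
have pS k : p k.+1 = 2 * p k by rewrite /p exprS.
pose a k v := p k * A ((p k)^-1 *: v).
pose good k v := `|v| < p k * e.
have goodE k v : good k v -> `|(p k)^-1 *: v| < e.
  rewrite /good => h; rewrite normrZ ger0_norm ?invr_ge0 ?(ltW (p0 k))//.
  by rewrite mulrC ltr_pdivrMr// mulrC.
have goodS k v : good k v -> good k.+1 v.
  rewrite /good pS => /lt_le_trans; apply.
  by rewrite -mulrA ler_peMl ?ler1n// mulr_ge0// ltW.
have good_le k k' v : (k <= k')%N -> good k v -> good k' v.
  by move=> /subnKC <- gk; elim: (k' - k)%N => [|m IH]; rewrite ?addn0// addnS goodS.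
have step k v : good k v ->
    `|a k v - a k.+1 v| <= C * `|v| ^+ 2 * (p k.+1)^-1.
  move=> gk; have ge := goodE _ _ (goodS _ _ gk).
  set u := (p k.+1)^-1 *: v in ge *.
  have -> : a k v - a k.+1 v = p k * (A (u + u) - A u - A u).
    rewrite /a -/u pS; have -> : (p k)^-1 *: v = u + u.
      rewrite -mulr2n -scaler_nat scalerA pS invfM mulrA mulfV ?mul1r//.
    ring.
  rewrite normrM gtr0_norm//.
  apply: le_trans (ler_wpM2l (ltW (p0 k)) (AD _ _ ge ge)) _.
  rewrite /u normrZ gtr0_norm ?invr_gt0// exprMn pS.
  by rewrite le_eqVlt; apply/orP; left; apply/eqP; field.
pose b k v := a k v - C * `|v| ^+ 2 * (p k)^-1.
pose c k v := a k v + C * `|v| ^+ 2 * (p k)^-1.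
(* The tolerance halves at each step, and the step error is at most the new tolerance; hence [b]
   increases and [c] decreases. *)
have half k v : C * `|v| ^+ 2 * (p k)^-1 = 2 * (C * `|v| ^+ 2 * (p k.+1)^-1).
  by rewrite pS; field.
have bS k v : good k v -> b k v <= b k.+1 v.
  move=> /step; rewrite /b (half k) ler_norml; set X := (C * _ * _); lra.
have cS k v : good k v -> c k.+1 v <= c k v.
  move=> /step; rewrite /c (half k) ler_norml; set X := (C * _ * _); lra.
have b_le k k' v : (k <= k')%N -> good k v -> b k v <= b k' v.
  move=> kk' gk; rewrite -(subnKC kk'); elim: (k' - k)%N => [|m IH].
    by rewrite addn0.
  rewrite addnS; apply: le_trans IH (bS _ _ _).
  by apply: good_le gk; rewrite leq_addr.
have c_le k k' v : (k <= k')%N -> good k v -> c k' v <= c k v.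
  move=> kk' gk; rewrite -(subnKC kk'); elim: (k' - k)%N => [|m IH].
    by rewrite addn0.
  rewrite addnS; apply: le_trans (cS _ _ _) IH.
  by apply: good_le gk; rewrite leq_addr.
have bc k v : b k v <= c k v.
  rewrite /b /c; have : 0 <= C * `|v| ^+ 2 * (p k)^-1.
    by rewrite !mulr_ge0 ?invr_ge0 ?exprn_ge0 ?(ltW (p0 _)).
  lra.
have bcjk j k v : good j v -> good k v -> b j v <= c k v.
  move=> gj gk; have [jk|/ltnW kj] := leqP j k.
    exact: le_trans (b_le _ _ _ jk gj) (bc _ _).
  exact: le_trans (bc _ _) (c_le _ _ _ kj gk).
pose E v := [set b k v | k in [set k | good k v]].
pose L v := sup (E v).
have E0 v : E v !=set0.
  by have [k hk] := exists_exp2_lt `|v| e0; exists (b k v); exists k.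
have key k v : good k v -> `|a k v - L v| <= C * `|v| ^+ 2 * (p k)^-1.
  move=> gk; have h1 : L v <= c k v.
    by apply: ge_sup => // _ [j gj <-]; exact: bcjk.
  have h2 : b k v <= L v.
    apply: ub_le_sup; last by exists k.
    by exists (c k v) => _ [j gj <-]; exact: bcjk.
  by move: h1 h2; rewrite /b /c ler_norml; set X := (C * _ * _); lra.
have Lapprox v : `|v| < e -> `|A v - L v| <= C * `|v| ^+ 2.
  move=> ve; have g0 : good 0 v by rewrite /good /p expr0 mul1r.
  by have := key 0%N v g0; rewrite /a /p expr0 invr1 scale1r mulr1 mul1r.
have LD : {morph L : v w / v + w}.
  move=> v w; apply/eqP; rewrite -subr_eq0; apply/eqP.
  have [kv gv] := exists_exp2_lt `|v| e0; have [kw gw] := exists_exp2_lt `|w| e0.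
  have [ku gu] := exists_exp2_lt `|v + w| e0.
  pose k0 := (kv + kw + ku)%N.
  (* Four errors, three of approximation and one of additivity of [A] at scale [1 / 2^k], are all
     [O(1 / 2^k)]. *)
  apply: (@le_exp2_eq0 _ _ (C * `|v + w| ^+ 2 + C * `|v| ^+ 2 + C * `|w| ^+ 2 +
     C * (`|v| ^+ 2 + `|w| ^+ 2)) k0) => k k0k.
  have {}gv : good k v.
    by apply: good_le gv; apply: leq_trans k0k; rewrite /k0 -addnA leq_addr.
  have {}gw : good k w.
    by apply: good_le gw; apply: leq_trans k0k; rewrite /k0 addnAC leq_addl.
  have {}gu : good k (v + w).
    by apply: good_le gu; apply: leq_trans k0k; rewrite /k0 leq_addl.
  have kv' := key _ _ gv; have kw' := key _ _ gw; have ku' := key _ _ gu.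
  have : `|a k (v + w) - a k v - a k w| <= C * (`|v| ^+ 2 + `|w| ^+ 2) * (p k)^-1.
    rewrite /a scalerDr -!mulrBr normrM gtr0_norm//.
    apply: le_trans (ler_wpM2l (ltW (p0 k)) (AD _ _ (goodE _ _ gv) (goodE _ _ gw))) _.
    rewrite !normrZ gtr0_norm ?invr_gt0// !exprMn.
    by rewrite le_eqVlt; apply/orP; left; apply/eqP; field.
  rewrite -/(p k); move: kv' kw' ku'; rewrite !ler_norml !mulrDl.
  set X1 := C * `|v| ^+ 2 * _; set X2 := C * `|w| ^+ 2 * _.
  set X3 := C * `|v + w| ^+ 2 * _; set X4 := C * _ * _; lra.
exists L; split => //.
apply: (@additive_bounded_homogeneous _ e (B + C * e ^+ 2)) => // v ve.
have := Lapprox _ ve; have := AB _ ve.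
have : C * `|v| ^+ 2 <= C * e ^+ 2.
  by rewrite ler_wpM2l// lerXn2r ?nnegrE// ltW.
rewrite !ler_norml; lra.
Qed.

(** A quadratic remainder is [o(v)]; boundedness of [L] on a ball makes it continuous, as a
    differential must be. *)
Lemma differentiable_approx (f : V -> R^o) (x : V) (L : V -> R) (C e B : R) :
  0 < e -> {morph L : v w / v + w} -> (forall t v, L (t *: v) = t * L v) ->
  (forall v, `|v| < e -> `|L v| <= B) ->
  (forall v, `|v| < e -> `|f (x + v) - f x - L v| <= C * `|v| ^+ 2) ->
  differentiable f x /\ forall v, 'd f x v = L v.
Proof.
move=> e0 LD LZ LB fL.
have Llin : linear (L : V -> R^o) by move=> t v w; rewrite LD LZ.
pose L' : {linear V -> R^o} := HB.pack (L : V -> R^o)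
  (GRing.isLinear.Build _ _ _ _ (L : V -> R^o) Llin).
have cL : continuous (L' : V -> R^o).
  apply: bounded_linear_continuous.
  rewrite /bounded_near; near=> M; apply/nbhs_normP; exists e => //= v /=.
  rewrite sub0r normrN => ve; apply: le_trans (LB v ve) _.
  by near: M; apply: nbhs_pinfty_ge; rewrite num_real.
have eqo : f \o shift x = cst (f x) + L' +o_ 0 id.
  apply/eqaddoP => /= d d0; apply/nbhs_normP.
  pose K := `|C| + 1; have K0 : 0 < K by rewrite ltr_pwDr.
  exists (Num.min e (d / K)) => /=; first by rewrite lt_min e0 divr_gt0.
  move=> v /=; rewrite sub0r normrN lt_min => /andP[ve vd].
  rewrite -[X in `|X|]/(f (v + x) - (f x + L v)) opprD addrA addrC [v + x]addrC.
  rewrite addrC; apply: le_trans (fL v ve) _; rewrite expr2 mulrA ler_wpM2r//.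
  apply: le_trans (_ : K * `|v| <= _).
    by rewrite ler_wpM2r// (le_trans (ler_norm _))// lerDl.
  by move: vd; rewrite ltr_pdivlMr// mulrC => /ltW.
have dE : 'd f x = L' :> (V -> R^o) by exact: diff_unique.
split; last by move=> v; rewrite dE.
by apply/diff_locallyP; rewrite dE.
Unshelve. all: by end_near. Qed.

End ApproxLinear.

(** * Local semi-concavity by second differences, and its calculus *)

Section Semiconcave.
Context {R : realType}.
Implicit Types (V W : normedModType R).

(** Semi-concavity with linear modulus, in midpoint form and with one constant for all bounds, so
    that two functions are put on common data by a maximum and a minimum. By [sccI] the Lipschitz
    bound follows from the other two on a smaller ball; it is recorded because products and
    compositions use it. *)
Record scc_at V (C e : R) (f : V -> R) (w : V) : Prop := SccAt {
  scc_const : 0 <= C;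
  scc_rad : 0 < e;
  scc_bound : forall x, `|x - w| < e -> `|f x| <= C;
  scc_lip : forall x y, `|x - w| < e -> `|y - w| < e ->
    `|f x - f y| <= C * `|x - y|;
  scc_sd : forall x h, `|x + h - w| < e -> `|x - h - w| < e ->
    f (x + h) + f (x - h) - 2 * f x <= C * `|h| ^+ 2 }.

Definition scc V (f : V -> R) (w : V) := exists C e, scc_at C e f w.

Lemma scc_at_le V (C e C' e' : R) (f : V -> R) w :
  scc_at C e f w -> C <= C' -> 0 < e' -> e' <= e -> scc_at C' e' f w.
Proof.
case=> C0 e0 fb fl fs CC' e'0 ee'; split=> //.
- exact: le_trans CC'.
- by move=> x /lt_le_trans/(_ ee')/fb/le_trans; apply.
- move=> x y /lt_le_trans/(_ ee') xw /lt_le_trans/(_ ee') yw.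
  by apply: le_trans (fl _ _ xw yw) _; rewrite ler_wpM2r.
- move=> x h /lt_le_trans/(_ ee') xw /lt_le_trans/(_ ee') yw.
  by apply: le_trans (fs _ _ xw yw) _; rewrite ler_wpM2r// exprn_ge0.
Qed.

Lemma midpoint_norm V (x h w : V) (e : R) :
  `|x + h - w| < e -> `|x - h - w| < e -> `|x - w| < e.
Proof.
move=> h1 h2.
have -> : x - w = 2^-1 *: ((x + h - w) + (x - h - w)).
  rewrite addrACA [x + h + _]addrACA subrr addr0 -!mulr2n -mulrnDl -[(x - w) *+ 2]scaler_nat.
  by rewrite scalerA mulVf ?scale1r// pnatr_eq0.
rewrite normrZ ger0_norm ?invr_ge0//.
have := ler_normD (x + h - w) (x - h - w); lra.
Qed.

(* A semi-concave function that oscillates by [2B] on a scale [e] cannot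
   decrease faster than [B / e]: doubling the increment [v] until it has
   size [e] at least doubles a decrease, up to the second-order error. *)
Lemma sccI V (C e : R) (f : V -> R) w : 0 < e ->
  (forall x, `|x - w| < e -> `|f x| <= C) ->
  (forall x h, `|x + h - w| < e -> `|x - h - w| < e ->
    f (x + h) + f (x - h) - 2 * f x <= C * `|h| ^+ 2) -> scc f w.
Proof.
move=> e0 fb fs.
have C0 : 0 <= C by apply: le_trans (fb w _); rewrite // subrr normr0.
pose e4 := e / 4; have e40 : 0 < e4 by rewrite divr_gt0.
(* [2 * C / e4] accounts for the oscillation of [f] over an increment of size at least [e4], and
   [C * (2 * e4)] for the accumulated second-order error; the leading [C] makes [K] dominate [C]. *)
pose K := C + 2 * C / e4 + C * (2 * e4).
have low x y : `|x - w| < e4 -> `|y - w| < e4 -> - (K * `|x - y|) <= f y - f x.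
  move=> xw yw; pose h := y - x.
  have [->|xy] := eqVneq x y; first by rewrite !subrr normr0 mulr0 oppr0.
  have h0 : 0 < `|h| by rewrite normr_gt0 subr_eq0 eq_sym.
  rewrite distrC -/h.
  have h2 : `|h| < 2 * e4.
    rewrite /h (_ : y - x = (y - w) - (x - w)); last by rewrite opprB addrA subrK.
    apply: le_lt_trans (ler_normB _ _) _; lra.
  pose A v := f (x + v) - f x.
  have dbl v : `|v + v| < 2 * e4 -> A (v + v) <= 2 * A v + C * `|v| ^+ 2.
    move=> vv.
    have h1 : `|x + v + v - w| < e.
      rewrite -[x + v + v]addrA addrAC; apply: le_lt_trans (ler_normD _ _) _.
      by move: vv xw; rewrite /e4; lra.
    have h2' : `|x + v - v - w| < e by rewrite addrK; move: xw e0; rewrite /e4; lra.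
    by have := fs _ _ h1 h2'; rewrite addrK -[x + v + v]addrA /A; lra.
  pose p k : R := 2 ^+ k.
  have p0 k : 0 < p k by rewrite exprn_gt0.
  have pS k : p k.+1 = 2 * p k by rewrite /p exprS.
  (* The error coefficient closes up: one doubling turns [X ^+ 2] into [2 X ^+ 2 + X ^+ 2], within
     the allowed [(2 X) ^+ 2]. *)
  have it k : p k * `|h| < 2 * e4 ->
      A (p k *: h) <= p k * A h + C * (p k * `|h|) ^+ 2.
    elim: k => [|k IH].
      by rewrite /p expr0 scale1r !mul1r => _; rewrite lerDl mulr_ge0// exprn_ge0.
    move=> hk; have hk' : p k * `|h| < 2 * e4.
      apply: le_lt_trans hk; rewrite pS -mulrA ler_peMl ?ler1n//.
      by rewrite mulr_ge0// ltW.
    have e2 : p k.+1 *: h = p k *: h + p k *: h.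
      by rewrite pS mulr_natl mulr2n scalerDl.
    have := dbl (p k *: h); rewrite -e2 normrZ gtr0_norm// => /(_ hk) hd.
    apply: le_trans hd _; rewrite normrZ gtr0_norm// pS.
    have := IH hk'; set X := p k * `|h|.
    have -> : 2 * p k * `|h| = 2 * X by rewrite /X mulrA.
    have : 0 <= C * X ^+ 2 by rewrite mulr_ge0// exprn_ge0// mulr_ge0// ltW.
    have -> : C * (2 * X) ^+ 2 = 4 * (C * X ^+ 2) by ring.
    rewrite -[2 * p k * A h]mulrA; lra.
  have [k [k1 k2]] : exists k, p k * `|h| < 2 * e4 /\ 2 * e4 <= p k.+1 * `|h|.
    have [n0 Hn0] := exists_exp2_lt (2 * e4) h0.
    have [|j Hj] := @ex_minnP (fun n => 2 * e4 < p n * `|h|).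
      by exists n0.
    have [j' jE] : exists j', j = j'.+1.
      case: j Hj => [|j' _]; last by exists j'.
      by rewrite /p expr0 mul1r => /ltW; rewrite leNgt h2.
    move=> Hmin.
    have [j0|j0] := ltrP (p j' * `|h|) (2 * e4).
      by exists j'; split => //; rewrite -jE ltW.
    (* In the boundary case the size is exactly [2 * e4], and one doubling less gives the size [e4],
       which is admissible. *)
    have {}j0 : p j' * `|h| = 2 * e4.
      apply/eqP; rewrite eq_le j0 andbT leNgt; apply/negP => /Hmin.
      by rewrite jE ltnn.
    case: j' jE j0 => [_|j'' jE j0].
      by rewrite /p expr0 mul1r => h3; move: h2; rewrite h3 ltxx.
    exists j''; split; last by rewrite j0.
    by rewrite -j0 pS -mulrA ltr_pMl ?mulr_gt0// ltr1n.
  have := it k k1.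
  have xk : `|x + p k *: h - w| < e.
    rewrite addrAC; apply: le_lt_trans (ler_normD _ _) _.
    by rewrite normrZ gtr0_norm//; move: xw k1 e0; rewrite /e4; lra.
  have xe : `|x - w| < e by move: xw e0; rewrite /e4; lra.
  have AB : - (2 * C) <= A (p k *: h).
    by have := fb _ xk; have := fb _ xe; rewrite /A !ler_norml; lra.
  have -> : f y - f x = A h by rewrite /A /h [x + _]addrC subrK.
  set a := A h in AB *; set X := `|h| in k1 k2 h0 *; move=> itk.
  have : - (2 * C) - C * (p k * X) ^+ 2 <= p k * a by lra.
  have q1 : (p k * X) ^+ 2 <= p k * X * (2 * e4).
    by rewrite expr2 ler_wpM2l ?(ltW k1)// mulr_ge0// ltW.
  have q2 : 2 * C <= p k * (2 * C / e4 * X).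
    have : e4 <= p k * X by move: k2; rewrite pS; lra.
    move=> h1; rewrite mulrCA -[leLHS](divfK (lt0r_neq0 e40)).
    by rewrite ler_wpM2l// divr_ge0 ?mulr_ge0// ltW.
  have q3 : C * (p k * X) ^+ 2 <= p k * (C * (2 * e4) * X).
    have -> : p k * (C * (2 * e4) * X) = C * (p k * X * (2 * e4)) by ring.
    by rewrite ler_wpM2l.
  move=> h3; rewrite -(ler_pM2l (p0 k)).
  have -> : p k * - (K * X) = - (p k * (2 * C / e4 * X)) -
     p k * (C * (2 * e4) * X) - p k * (C * X) by rewrite /K; ring.
  have : 0 <= p k * (C * X) by rewrite mulr_ge0 ?mulr_ge0 ?(ltW h0) ?(ltW (p0 k)).
  lra.
have CK : C <= K.
  by rewrite /K -addrA lerDl addr_ge0// ?mulr_ge0// ?invr_ge0 ltW.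
have ee4 : e4 <= e by rewrite /e4; lra.
exists K, e4; split=> //; first exact: le_trans CK.
- by move=> x /lt_le_trans/(_ ee4)/fb/le_trans; apply.
- move=> x y xw yw; have := low _ _ xw yw; have := low _ _ yw xw.
  by rewrite [`|y - x|]distrC ler_norml; lra.
- move=> x h /lt_le_trans/(_ ee4) xw /lt_le_trans/(_ ee4) yw.
  by apply: le_trans (fs _ _ xw yw) _; rewrite ler_wpM2r// exprn_ge0.
Qed.

Lemma scc_common V (f g : V -> R) w : scc f w -> scc g w ->
  exists C e, scc_at C e f w /\ scc_at C e g w.
Proof.
move=> [C [e h]] [C' [e' h']]; exists (Num.max C C'), (Num.min e e').
have := scc_rad h; have := scc_rad h' => ? ?.
split; [apply: scc_at_le h _ _ _|apply: scc_at_le h' _ _ _];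
  by rewrite ?le_max ?ge_min ?lt_min ?lexx ?orbT//; apply/andP.
Qed.

Definition near_eq V (f g : V -> R) w :=
  exists2 e : R, 0 < e & forall x, `|x - w| < e -> f x = g x.

Lemma scc_near V (f g : V -> R) w : near_eq f g w -> scc g w -> scc f w.
Proof.
move=> [d d0 fg] [C [e h]]; have e0 := scc_rad h.
exists C, (Num.min d e).
have [] : scc_at C (Num.min d e) g w.
  by apply: scc_at_le h _ _ _; rewrite ?lexx ?lt_min ?d0// ge_min lexx orbT.
move=> C0 me gb gl gs.
have fg' x : `|x - w| < Num.min d e -> f x = g x.
  by rewrite lt_min => /andP[/fg].
split=> //.
- by move=> x xw; rewrite fg' ?gb.
- by move=> x y xw yw; rewrite !fg' ?gl.
- by move=> x h' xw yw; rewrite !fg' ?gs//; exact: midpoint_norm xw yw.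
Qed.

Lemma scc_continuous V (f : V -> R) w : scc f w -> {for w, continuous (f : V -> R^o)}.
Proof.
move=> [C [e [C0 e0 _ fl _]]]; apply/cvgrPdist_lt => d d0.
apply/nbhs_normP; exists (Num.min e (d / (C + 1))).
  by rewrite /= lt_min e0 divr_gt0// ltr_wpDl.
move=> x /=; rewrite lt_min => /andP[xe xd].
apply: le_lt_trans (fl _ _ _ _) _; rewrite ?subrr ?normr0//; first by rewrite distrC.
move: xd; rewrite ltr_pdivlMr ?ltr_wpDl//; apply: le_lt_trans.
by rewrite mulrC ler_wpM2l// lerDl.
Qed.

Lemma scc_cst V (a : R) (w : V) : scc (fun=> a) w.
Proof.
exists `|a|, 1; split=> //.
- by move=> x y _ _; rewrite subrr normr0 mulr_ge0.
- move=> x h _ _; rewrite (_ : a + a - 2 * a = 0); last by ring.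
  by rewrite mulr_ge0// exprn_ge0.
Qed.

Lemma scc_add V (f g : V -> R) w : scc f w -> scc g w ->
  scc (fun x => f x + g x) w.
Proof.
move=> hf hg; have [C [e [[C0 e0 fb fl fs] [_ _ gb gl gs]]]] := scc_common hf hg.
exists (C + C), e; split=> //; first by rewrite addr_ge0.
- by move=> x xw; apply: le_trans (ler_normD _ _) _; rewrite lerD ?fb ?gb.
- move=> x y xw yw; rewrite opprD addrACA mulrDl.
  by apply: le_trans (ler_normD _ _) _; rewrite lerD ?fl ?gl.
- by move=> x h xw yw; rewrite mulrDl; have := fs _ _ xw yw; have := gs _ _ xw yw; lra.
Qed.

Lemma scc_sum V (F : nat -> V -> R) m w : (forall i, (i < m)%N -> scc (F i) w) ->
  scc (fun x => \sum_(i < m) F i x) w.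
Proof.
elim: m => [|m IH] h.
  apply: scc_near (scc_cst 0 w); exists 1 => // x _; exact: big_ord0.
apply: (@scc_near _ _ (fun x => \sum_(i < m) F i x + F m x)).
  by exists 1 => // x _; rewrite big_ord_recr.
by apply: scc_add; [apply: IH => i im; apply: h; exact: ltnW|exact: h].
Qed.

(** The second difference of [f] is bounded on one side only, so its factor [t] must be nonnegative;
    that of [t] is multiplied by [f], whose sign is free, so it must be bounded on both sides. *)
Lemma scc_mul V (t f : V -> R) w : (forall x, 0 <= t x) ->
  scc t w -> scc (fun x => - t x) w -> scc f w -> scc (fun x => t x * f x) w.
Proof.
move=> t0 ht hnt hf.
have [C1 [e1 [h1 h1']]] := scc_common ht hnt.
have [C [e [[C0 e0 tb tl ts] ff]]] := scc_common ht hf.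
have e10 := scc_rad h1; have C10 := scc_const h1.
pose D := Num.max C C1; pose d := Num.min e e1.
have d0 : 0 < d by rewrite lt_min e0 e10.
have D0 : 0 <= D by rewrite le_max C0.
have {ff}[_ _ fb fl fs] : scc_at D d f w.
  by apply: scc_at_le ff _ _ _; rewrite ?le_max ?ge_min ?lexx// orbT.
have {h1}[_ _ {}tb {}tl {}ts] : scc_at D d t w.
  by apply: scc_at_le h1 _ _ _; rewrite ?le_max ?ge_min ?lexx ?orbT.
have {h1'}[_ _ _ _ nts] : scc_at D d (fun x => - t x) w.
  by apply: scc_at_le h1' _ _ _; rewrite ?le_max ?ge_min ?lexx ?orbT.
apply: (@sccI _ (4 * D ^+ 2) d) => //.
  move=> x xw; rewrite normrM; apply: le_trans (_ : D * D <= _).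
    by rewrite ler_pM// ?tb ?fb.
  by rewrite expr2 ler_peMl ?mulr_ge0// ler1n.
move=> x h xp xm; have x0 := midpoint_norm xp xm.
set f0 := f x; set fp := f (x + h); set fm := f (x - h).
set u0 := t x; set up := t (x + h); set um := t (x - h); set H := `|h|.
have H0 : 0 <= H by exact: normr_ge0.
have e1' : `|x + h - x| = H by rewrite addrAC subrr add0r.
have e2' : `|x - h - x| = H by rewrite addrAC subrr add0r normrN.
have q1 : u0 * (fp + fm - 2 * f0) <= D * (D * H ^+ 2).
  apply: le_trans (ler_wpM2l (t0 x) (fs _ _ xp xm)) _.
  rewrite ler_wpM2r ?mulr_ge0 ?exprn_ge0//.
  exact: le_trans (ler_norm _) (tb _ x0).
have q2 : f0 * (up + um - 2 * u0) <= D * (D * H ^+ 2).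
  apply: le_trans (ler_norm _) _; rewrite normrM ler_pM// ?fb//.
  by have := ts _ _ xp xm; have := nts _ _ xp xm;
     rewrite /= -/up -/um -/u0 -/H ler_norml; lra.
have q3 : (up - u0) * (fp - f0) <= (D * H) * (D * H).
  apply: le_trans (ler_norm _) _; rewrite normrM ler_pM// -e1' ?tl ?fl//.
have q4 : (um - u0) * (fm - f0) <= (D * H) * (D * H).
  apply: le_trans (ler_norm _) _; rewrite normrM ler_pM// -e2' ?tl ?fl//.
(* Discrete Leibniz rule; the two products of first differences are of second order by the Lipschitz
   bounds. *)
have -> : up * fp + um * fm - 2 * (u0 * f0) = u0 * (fp + fm - 2 * f0) +
  f0 * (up + um - 2 * u0) + (up - u0) * (fp - f0) + (um - u0) * (fm - f0) by ring.
have -> : 4 * D ^+ 2 * H ^+ 2 = D * (D * H ^+ 2) + D * (D * H ^+ 2) +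
  D * H * (D * H) + D * H * (D * H) by ring.
by rewrite !lerD.
Qed.

Lemma scc_scale V (a : R) (f : V -> R) w : 0 <= a -> scc f w ->
  scc (fun x => a * f x) w.
Proof. by move=> a0 hf; apply: scc_mul => //; exact: scc_cst. Qed.

(** C^{1,1} maps between normed spaces, in the form in which changes of charts are used. *)
Record nice_at V W (C e : R) (psi : V -> W) (w : V) : Prop := NiceAt {
  nice_const : 0 <= C;
  nice_rad : 0 < e;
  nice_lip : forall x y, `|x - w| < e -> `|y - w| < e ->
    `|psi x - psi y| <= C * `|x - y|;
  nice_sd : forall x h, `|x + h - w| < e -> `|x - h - w| < e ->
    `|psi (x + h) + psi (x - h) - 2 *: psi x| <= C * `|h| ^+ 2 }.

Definition nice V W (psi : V -> W) w := exists C e, nice_at C e psi w.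

(** [psi (x + h)] and [psi (x - h)] are symmetric about their midpoint [m], where the second
    difference of [f] applies. The point [m] is within a second-order amount of [psi x], which the
    Lipschitz bound of [f] absorbs. *)
Lemma scc_comp V W (psi : V -> W) (f : W -> R) w :
  nice psi w -> scc f (psi w) -> scc (f \o psi) w.
Proof.
move=> [C [e [C0 e0 pl ps]]] [D [d [D0 d0 fb fl fs]]].
pose r := Num.min e (d / (C + 1)).
have r0 : 0 < r by rewrite lt_min e0 divr_gt0// ltr_wpDl.
have re x : `|x - w| < r -> `|x - w| < e by rewrite lt_min => /andP[].
have rd x : `|x - w| < r -> `|psi x - psi w| < d.
  move=> xr; apply: le_lt_trans (pl _ _ (re _ xr) _) _.
    by rewrite subrr normr0.
  move: xr; rewrite lt_min ltr_pdivlMr ?ltr_wpDl// => /andP[_].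
  by apply: le_lt_trans; rewrite mulrC ler_wpM2l// lerDl.
apply: (@sccI _ (D + D * C ^+ 2 + D * C) r) => //.
  move=> x /rd/fb/le_trans; apply; rewrite -addrA lerDl.
  by rewrite addr_ge0 ?mulr_ge0 ?exprn_ge0.
move=> x h xp xm; have x0 := midpoint_norm xp xm; rewrite /=.
set yp := psi (x + h); set ym := psi (x - h); set y := psi x.
pose m := 2^-1 *: (yp + ym); pose k := 2^-1 *: (yp - ym).
have two (z : W) : 2^-1 *: z + 2^-1 *: z = z.
  by rewrite -scalerDl -[2^-1]mul1r -splitr scale1r.
have mk : m + k = yp.
  by rewrite /m /k -scalerDr addrACA subrr addr0 scalerDr two.
have mk' : m - k = ym.
  by rewrite /m /k -scalerBr opprB [ym - yp]addrC addrACA subrr add0r scalerDr two.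
have s1 : f yp + f ym - 2 * f m <= D * `|k| ^+ 2.
  by have := fs m k; rewrite mk mk'; apply; exact: rd.
have s2 : `|k| <= C * `|h|.
  rewrite /k normrZ ger0_norm ?invr_ge0// ler_pdivrMl//.
  apply: le_trans (pl _ _ (re _ xp) (re _ xm)) _.
  rewrite opprB [h - x]addrC addrACA subrr add0r -mulr2n normrMn.
  by have -> : C * (`|h| *+ 2) = 2 * (C * `|h|) by ring.
have s3 : 2 * `|m - y| <= C * `|h| ^+ 2.
  apply: le_trans (ps _ _ (re _ xp) (re _ xm)).
  rewrite -[X in X * _]ger0_norm// -normrZ scalerBr /m scalerA mulfV ?pnatr_eq0//.
  by rewrite scale1r.
have s4 : f m - f y <= D * `|m - y|.
  apply: le_trans (ler_norm _) _; apply: fl; last exact: rd.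
  by apply: midpoint_norm (_ : `|m + k - _| < _) _; rewrite ?mk ?mk'; exact: rd.
have s5 : D * `|k| ^+ 2 <= D * (C * `|h|) ^+ 2.
  by rewrite ler_wpM2l// lerXn2r ?nnegrE// mulr_ge0.
have s6 : D * (2 * `|m - y|) <= D * (C * `|h| ^+ 2) by rewrite ler_wpM2l.
have -> : (D + D * C ^+ 2 + D * C) * `|h| ^+ 2 =
  D * `|h| ^+ 2 + D * (C * `|h|) ^+ 2 + D * (C * `|h| ^+ 2) by ring.
have : 0 <= D * `|h| ^+ 2 by rewrite mulr_ge0// exprn_ge0.
lra.
Qed.

Lemma nice_scc V (f : V -> R) w : nice (f : V -> R^o) w ->
  scc f w /\ scc (fun x => - f x) w.
Proof.
move=> [C [e [C0 e0 fl fs]]].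
pose D := C + `|f w| + C * e.
have CD : C <= D by rewrite /D -addrA lerDl addr_ge0// mulr_ge0// ltW.
have fb x : `|x - w| < e -> `|f x| <= D.
  move=> xw; have := fl x w xw; rewrite subrr normr0 => /(_ e0) h.
  have : C * `|x - w| <= C * e by rewrite ler_wpM2l// ltW.
  by have := ler_normD (f x - f w) (f w); rewrite subrK /D; lra.
split; apply: (@sccI _ D e) => //.
- move=> x h xp xm; apply: le_trans (ler_norm _) _.
  by apply: le_trans (fs _ _ xp xm) _; rewrite ler_wpM2r// exprn_ge0.
- by move=> x /fb; rewrite normrN.
- move=> x h xp xm; have -> : - f (x + h) - f (x - h) - 2 * - f x =
    - (f (x + h) + f (x - h) - 2 * f x) by ring.
  apply: le_trans (ler_norm _) _; rewrite normrN.
  by apply: le_trans (fs _ _ xp xm) _; rewrite ler_wpM2r// exprn_ge0.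
Qed.

End Semiconcave.

(** * Differentiability from two-sided bounds or from touching *)

Section SemiconcaveDiff.
Context {R : realType} {V : normedModType R}.
Implicit Types (f g : V -> R) (u v w : V).

Lemma half_double v : 2^-1 *: v + 2^-1 *: v = v.
Proof. by rewrite -scalerDl -[2^-1]mul1r -splitr scale1r. Qed.

Lemma half_addB u v : 2^-1 *: (v + u) + 2^-1 *: (v - u) = v.
Proof. by rewrite -scalerDr addrACA subrr addr0 scalerDr half_double. Qed.

Lemma half_subB u v : 2^-1 *: (v + u) - 2^-1 *: (v - u) = u.
Proof.
by rewrite -scalerBr opprB [u - v]addrC addrACA subrr add0r scalerDr half_double.
Qed.

Lemma half_norm_sq u v :
  `|2^-1 *: (v + u)| ^+ 2 <= 2^-1 * (`|v| ^+ 2 + `|u| ^+ 2).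
Proof.
rewrite normrZ ger0_norm ?invr_ge0//.
apply: le_trans (_ : (2^-1 * (`|v| + `|u|)) ^+ 2 <= _).
  by rewrite lerXn2r ?nnegrE ?mulr_ge0 ?addr_ge0 ?invr_ge0// ler_wpM2l ?invr_ge0// ler_normD.
rewrite -subr_ge0 (_ : _ - _ = (2^-1 * (`|v| - `|u|)) ^+ 2); last by field.
exact: sqr_ge0.
Qed.

(** The four points are the vertices of a parallelogram whose diagonals share the midpoint [m]; the
    mixed difference is thus a difference of two second differences at [m]. *)
Lemma sd_parallelogram f C e w a u v :
  scc_at C e f w -> scc_at C e (fun x => - f x) w ->
  `|a - w| < e / 4 -> `|u| < e / 4 -> `|v| < e / 4 ->
  `|f (a + (v + u)) - f (a + v) - f (a + u) + f a| <= C * (`|v| ^+ 2 + `|u| ^+ 2).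
Proof.
move=> hf hnf aw ue ve; have e0 := scc_rad hf; have C0 := scc_const hf.
pose m := a + 2^-1 *: (v + u); pose h := 2^-1 *: (v + u); pose k := 2^-1 *: (v - u).
have E1 : m + h = a + (v + u) by rewrite /m /h -addrA half_double.
have E2 : m - h = a by rewrite /m /h addrK.
have E3 : m + k = a + v by rewrite /m /k -addrA half_addB.
have E4 : m - k = a + u by rewrite /m /k -addrA half_subB.
have nr x : `|x| < e / 2 -> `|a + x - w| < e.
  move=> xe; rewrite addrAC; apply: le_lt_trans (ler_normD _ _) _; lra.
have n1 : `|a + (v + u) - w| < e.
  by apply: nr; apply: le_lt_trans (ler_normD _ _) _; lra.
have n2 : `|a - w| < e by move: aw; lra.
have n3 : `|a + v - w| < e by apply: nr; lra.
have n4 : `|a + u - w| < e by apply: nr; lra.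
have := scc_sd hf (x := m) (h := h); rewrite E1 E2 => /(_ n1 n2) p1.
have := scc_sd hf (x := m) (h := k); rewrite E3 E4 => /(_ n3 n4) p2.
have := scc_sd hnf (x := m) (h := h); rewrite E1 E2 => /(_ n1 n2) p3.
have := scc_sd hnf (x := m) (h := k); rewrite E3 E4 => /(_ n3 n4) p4.
have q1 : C * `|h| ^+ 2 <= C * (2^-1 * (`|v| ^+ 2 + `|u| ^+ 2)).
  by rewrite ler_wpM2l// half_norm_sq.
have q2 : C * `|k| ^+ 2 <= C * (2^-1 * (`|v| ^+ 2 + `|u| ^+ 2)).
  by rewrite ler_wpM2l// /k; apply: le_trans (half_norm_sq _ _) _; rewrite normrN.
by rewrite ler_norml; lra.
Qed.

Lemma scc_two_sided_approx f C e w a :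
  scc_at C e f w -> scc_at C e (fun x => - f x) w -> `|a - w| < e / 4 ->
  exists L : V -> R, [/\ {morph L : v w / v + w},
    forall t v, L (t *: v) = t * L v,
    (forall v, `|v| < e / 4 -> `|L v| <= 2 * C + C * e ^+ 2) &
    forall v, `|v| < e / 4 -> `|f (a + v) - f a - L v| <= C * `|v| ^+ 2].
Proof.
move=> hf hnf aw; have e0 := scc_rad hf; have C0 := scc_const hf.
have e40 : 0 < e / 4 by rewrite divr_gt0.
pose A v := f (a + v) - f a.
have Ab v : `|v| < e / 4 -> `|A v| <= 2 * C.
  move=> ve; have n1 : `|a + v - w| < e.
    rewrite addrAC; apply: le_lt_trans (ler_normD _ _) _; lra.
  have n2 : `|a - w| < e by lra.
  by have := scc_bound hf n1; have := scc_bound hf n2; rewrite /A !ler_norml; lra.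
have add v u : `|v| < e / 4 -> `|u| < e / 4 ->
    `|A (v + u) - A v - A u| <= C * (`|v| ^+ 2 + `|u| ^+ 2).
  move=> ve ue; have := sd_parallelogram hf hnf aw ue ve; rewrite /A.
  by congr (`| _ | <= _); ring.
have [L [LD LZ LA]] := approx_linear e40 C0 add Ab.
exists L; split => // v ve; have := LA v ve; have := Ab v ve.
have : C * `|v| ^+ 2 <= C * e ^+ 2.
  by rewrite ler_wpM2l// lerXn2r ?nnegrE// ?(ltW e0)//; lra.
by rewrite !ler_norml; lra.
Qed.

(** By the parallelogram estimate the differentials at [a] and [b] differ by [O(|b - a| ^+ 2)] on
    vectors of length [|b - a|]; homogeneity turns this into a Lipschitz bound. *)
Lemma scc_two_sided_c11 f w : scc f w -> scc (fun x => - f x) w ->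
  exists K e, [/\ 0 < e, forall a, `|a - w| < e -> differentiable (f : V -> R^o) a &
   forall a b v, `|a - w| < e -> `|b - w| < e ->
    `|'d (f : V -> R^o) a v - 'd (f : V -> R^o) b v| <= K * `|a - b| * `|v|].
Proof.
move=> sf snf; have [C [e [hf hnf]]] := scc_common sf snf.
have e0 := scc_rad hf; have C0 := scc_const hf.
have e40 : 0 < e / 4 by rewrite divr_gt0.
exists (6 * C), (e / 8); split; first by rewrite divr_gt0.
  move=> a aw; have aw' : `|a - w| < e / 4 by lra.
  have [L [LD LZ Lb LA]] := scc_two_sided_approx hf hnf aw'.
  by have [] := @differentiable_approx _ _ f a L C _ _ e40 LD LZ Lb LA.
move=> a b v aw bw; have aw' : `|a - w| < e / 4 by lra.
have [->|ab] := eqVneq a b; first by rewrite !subrr !normr0 mulr0 mul0r.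
have bw' : `|b - w| < e / 4 by lra.
have [L [LD LZ Lb LA]] := scc_two_sided_approx hf hnf aw'.
have [L' [LD' LZ' Lb' LA']] := scc_two_sided_approx hf hnf bw'.
have [_ ->] := @differentiable_approx _ _ f a L C _ _ e40 LD LZ Lb LA.
have [_ ->] := @differentiable_approx _ _ f b L' C _ _ e40 LD' LZ' Lb' LA'.
have [->|v0] := eqVneq v 0.
  have := LZ 0 0; have := LZ' 0 0; rewrite scale0r !mul0r => -> ->.
  by rewrite subrr !normr0 mulr0.
pose u := b - a.
have bE : b = a + u by rewrite /u [a + _]addrC subrK.
have ue : `|u| < e / 4.
  rewrite /u (_ : b - a = (b - w) - (a - w)); last by rewrite opprB addrA subrK.
  by apply: le_lt_trans (ler_normB _ _) _; lra.
have near x : `|x| < e / 4 -> `|L x - L' x| <= 3 * C * (`|x| ^+ 2 + `|u| ^+ 2).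
  move=> xe; have := LA x xe; have := LA' x xe; rewrite bE.
  have := sd_parallelogram hf hnf aw' ue xe.
  have -> : a + (x + u) = a + u + x by rewrite [x + u]addrC addrA.
  have : 0 <= C * `|x| ^+ 2 by rewrite mulr_ge0// exprn_ge0.
  have : 0 <= C * `|u| ^+ 2 by rewrite mulr_ge0// exprn_ge0.
  by rewrite !ler_norml; lra.
have vp : 0 < `|v| by rewrite normr_gt0.
have up : 0 < `|u| by rewrite normr_gt0 subr_eq0 eq_sym.
pose s := `|u| / `|v|; have s0 : 0 < s by rewrite divr_gt0.
have sv : `|s *: v| = `|u|.
  by rewrite normrZ gtr0_norm// /s divfK// gt_eqF.
have := near (s *: v); rewrite sv => /(_ ue).
rewrite LZ LZ' -mulrBr normrM gtr0_norm// [`|a - b|]distrC -/u.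
rewrite /s -ler_pdivlMl ?divr_gt0// => /le_trans; apply.
by rewrite le_eqVlt; apply/orP; left; apply/eqP; field; rewrite !gt_eqF.
Qed.

(** The increments [A] of [f] are almost odd: semi-concavity of [f] bounds [A v + A (- v)] from
    above, and that of [g], through [A >= - B], from below. Semi-concavity then gives almost
    superadditivity, and oddness converts it into almost additivity. *)
Lemma scc_touch_approx f g C e w :
  scc_at C e f w -> scc_at C e g w ->
  (forall x, `|x - w| < e -> f w + g w <= f x + g x) ->
  exists L : V -> R, [/\ {morph L : v w / v + w},
    forall t v, L (t *: v) = t * L v,
    (forall v, `|v| < e / 2 -> `|L v| <= 2 * C + 20 * C * e ^+ 2) &
    forall v, `|v| < e / 2 -> `|f (w + v) - f w - L v| <= 20 * C * `|v| ^+ 2].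
Proof.
move=> hf hg fg; have e0 := scc_rad hf; have C0 := scc_const hf.
have e20 : 0 < e / 2 by rewrite divr_gt0.
have C200 : 0 <= 20 * C by rewrite mulr_ge0.
pose A v := f (w + v) - f w; pose B v := g (w + v) - g w.
have wv v : `|w + v - w| = `|v| by rewrite addrAC subrr add0r.
have A0 : A 0 = 0 by rewrite /A addr0 subrr.
have AB v : `|v| < e -> 0 <= A v + B v.
  by move=> ve; have := fg (w + v); rewrite wv /A /B => /(_ ve); lra.
have conc k m : `|m + k| < e -> `|m - k| < e ->
    A (m + k) + A (m - k) <= 2 * A m + C * `|k| ^+ 2.
  move=> h1 h2; have := scc_sd hf (x := w + m) (h := k).
  have -> : w + m + k - w = m + k by rewrite -[w + m + k]addrA addrAC subrr add0r.
  have -> : w + m - k - w = m - k by rewrite -[w + m - k]addrA addrAC subrr add0r.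
  by move=> /(_ h1 h2); rewrite /A -!addrA; lra.
have opp v : `|v| < e -> `|A v + A (- v)| <= C * `|v| ^+ 2.
  move=> ve; have ve' : `|- v| < e by rewrite normrN.
  have := conc v 0; rewrite add0r sub0r => /(_ ve ve'); rewrite A0.
  have := scc_sd hg (x := w) (h := v); rewrite !wv => /(_ ve ve').
  have := AB _ ve; have := AB _ ve'; rewrite /A /B ler_norml; lra.
have super v u : `|v| < e / 2 -> `|u| < e / 2 ->
    A v + A u <= A (v + u) + 8 * C * (`|v| ^+ 2 + `|u| ^+ 2).
  move=> ve ue; pose m := 2^-1 *: (v + u); pose k := 2^-1 *: (v - u).
  have c1 := conc k m; rewrite half_addB half_subB in c1.
  have {}c1 : A v + A u <= 2 * A m + C * `|k| ^+ 2 by apply: c1; lra.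
  have vu : `|v + u| < e by apply: le_lt_trans (ler_normD _ _) _; lra.
  have vu' : `|- (v + u)| < e by rewrite normrN.
  (* This compares [A (- (v + u))] with [2 * A (- m)]; oddness turns it into the missing bound of
     [2 * A m] by [A (v + u)]. *)
  have c2 := conc (- m) (- m); rewrite subrr normr0 A0 addr0 -opprD in c2.
  rewrite half_double normrN in c2.
  have {}c2 : A (- (v + u)) <= 2 * A (- m) + C * `|m| ^+ 2.
    by rewrite -[`|m|]normrN; apply: c2.
  have me : `|m| < e.
    rewrite /m normrZ ger0_norm ?invr_ge0//; have := normr_ge0 (v + u); lra.
  have := opp _ vu; have := opp _ me; rewrite !ler_norml.
  have -> : `|v + u| ^+ 2 = 4 * `|m| ^+ 2.
    by rewrite /m normrZ ger0_norm ?invr_ge0// exprMn; field.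
  have q1 : C * `|m| ^+ 2 <= C * (2^-1 * (`|v| ^+ 2 + `|u| ^+ 2)).
    by rewrite ler_wpM2l// half_norm_sq.
  have q2 : C * `|k| ^+ 2 <= C * (2^-1 * (`|v| ^+ 2 + `|u| ^+ 2)).
    by rewrite ler_wpM2l// /k; apply: le_trans (half_norm_sq _ _) _; rewrite normrN.
  have : 0 <= C * `|v| ^+ 2 by rewrite mulr_ge0// exprn_ge0.
  have : 0 <= C * `|u| ^+ 2 by rewrite mulr_ge0// exprn_ge0.
  by lra.
have add v u : `|v| < e / 2 -> `|u| < e / 2 ->
    `|A (v + u) - A v - A u| <= 20 * C * (`|v| ^+ 2 + `|u| ^+ 2).
  move=> ve ue; have s1 := super _ _ ve ue.
  have := super (- v) (- u); rewrite !normrN => /(_ ve ue); rewrite -opprD => s2.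
  have vu : `|v + u| < e by apply: le_lt_trans (ler_normD _ _) _; lra.
  have ve' : `|v| < e by lra.
  have ue' : `|u| < e by lra.
  have := opp _ vu; have := opp _ ve'; have := opp _ ue'; rewrite !ler_norml.
  have q1 : C * `|v + u| ^+ 2 <= 2 * (C * `|v| ^+ 2 + C * `|u| ^+ 2).
    rewrite -mulrDr [leRHS]mulrCA ler_wpM2l//.
    have := half_norm_sq u v; rewrite normrZ ger0_norm ?invr_ge0// exprMn.
    have -> : (2^-1 : R) ^+ 2 = 4^-1 by field.
    lra.
  have : 0 <= C * `|v| ^+ 2 by rewrite mulr_ge0// exprn_ge0.
  have : 0 <= C * `|u| ^+ 2 by rewrite mulr_ge0// exprn_ge0.
  by lra.
have Ab v : `|v| < e / 2 -> `|A v| <= 2 * C.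
  move=> ve; have n1 : `|w + v - w| < e by rewrite wv; lra.
  have n2 : `|w - w| < e by rewrite subrr normr0.
  by have := scc_bound hf n1; have := scc_bound hf n2; rewrite /A !ler_norml; lra.
have [L [LD LZ LA]] := approx_linear e20 C200 add Ab.
exists L; split => // v ve; have := LA v ve; have := Ab v ve.
have : 20 * C * `|v| ^+ 2 <= 20 * C * e ^+ 2.
  by rewrite ler_wpM2l// lerXn2r ?nnegrE// ?(ltW e0)//; lra.
by rewrite !ler_norml; lra.
Qed.

Lemma scc_touch f g w : scc f w -> scc g w ->
  (exists2 e : R, 0 < e & forall x, `|x - w| < e -> f w + g w <= f x + g x) ->
  [/\ differentiable (f : V -> R^o) w, differentiable (g : V -> R^o) w &
      forall v, 'd (g : V -> R^o) w v = - 'd (f : V -> R^o) w v].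
Proof.
move=> sf sg [d d0 fg]; have [C [e [hf hg]]] := scc_common sf sg.
have e0 := scc_rad hf; have C0 := scc_const hf.
pose r := Num.min d e; have r0 : 0 < r by rewrite lt_min d0.
have {}hf : scc_at C r f w by apply: scc_at_le hf _ _ _; rewrite // ge_min lexx orbT.
have {}hg : scc_at C r g w by apply: scc_at_le hg _ _ _; rewrite // ge_min lexx orbT.
have {}fg x : `|x - w| < r -> f w + g w <= f x + g x by rewrite lt_min => /andP[/fg].
have gf x : `|x - w| < r -> g w + f w <= g x + f x.
  by rewrite ![g _ + _]addrC; exact: fg.
have r20 : 0 < r / 2 by rewrite divr_gt0.
have [L [LD LZ Lb LA]] := scc_touch_approx hf hg fg.
have [L' [LD' LZ' Lb' LA']] := scc_touch_approx hg hf gf.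
have [df dfE] := @differentiable_approx _ _ f w L _ _ _ r20 LD LZ Lb LA.
have [dg dgE] := @differentiable_approx _ _ g w L' _ _ _ r20 LD' LZ' Lb' LA'.
split => // v; rewrite dfE dgE.
(* The minimum of [f + g] bounds the linear map [L + L'] below by minus a quadratic. Scaling makes
   it nonnegative, and the opposite vector then makes it zero. *)
have near x : `|x| < r / 2 -> - (40 * C * `|x| ^+ 2) <= L x + L' x.
  move=> xe; have := LA _ xe; have := LA' _ xe; rewrite !ler_norml.
  have := fg (w + x); rewrite addrAC subrr add0r.
  have xr : `|x| < r by lra.
  by move=> /(_ xr); lra.
have pos x : 0 <= L x + L' x.
  rewrite leNgt; apply/negP => neg; pose D := - (L x + L' x).
  have D0 : 0 < D by rewrite /D; lra.
  have [k0 hk0] := exists_exp2_lt `|x| r20.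
  have : D = 0; last by move=> D0'; move: D0; rewrite D0' ltxx.
  apply: (@le_exp2_eq0 _ _ (40 * C * `|x| ^+ 2) k0) => k k0k.
  have p0 j : 0 < 2 ^+ j :> R by rewrite exprn_gt0.
  have : `|(2 ^+ k)^-1 *: x| < r / 2.
    rewrite normrZ gtr0_norm ?invr_gt0// mulrC ltr_pdivrMr//.
    apply: lt_le_trans hk0 _; rewrite mulrC ler_wpM2l ?(ltW r20)//.
    by rewrite ler_weXn2l// ler1n.
  move=> /near; rewrite LZ LZ' -mulrDr normrZ gtr0_norm ?invr_gt0// exprMn.
  rewrite (gtr0_norm D0) lerNl -mulrN -/D ler_pdivrMl// => /le_trans; apply.
  have := p0 k; set P := 2 ^+ k => P0.
  by rewrite le_eqVlt; apply/orP; left; apply/eqP; field; rewrite gt_eqF.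
have := pos (- 1 *: v); rewrite LZ LZ'; have := pos v; lra.
Qed.

End SemiconcaveDiff.

(** * Insertion between a semi-convex and a semi-concave function on a normed space *)

Section Insertion.
Context {R : realType} {V : normedModType R}.
Variable Q : V -> R.
Hypothesis Q_ge0 : forall x, 0 <= Q x.
Hypothesis Q_par : forall x h, Q (x + h) + Q (x - h) = 2 * Q x + 2 * Q h.
Hypothesis Q_norm : forall x, `|x| ^+ 2 <= Q x.
Implicit Types (F G phi : V -> R).

Definition midconvex phi := forall x h, 2 * phi x <= phi (x + h) + phi (x - h).

(* [H + K Q] is the largest midpoint convex function below [G + K Q]. The
   average of its translates by [h] and [-h], lowered by [(C + K) Q h], is a
   competitor, which is the upper bound on second differences. *)
Lemma insertion_from_below F G K0 C : (forall x, F x <= G x) ->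
  (forall x h, - (2 * K0 * Q h) <= F (x + h) + F (x - h) - 2 * F x) ->
  (forall x h, G (x + h) + G (x - h) - 2 * G x <= 2 * C * Q h) ->
  exists H : V -> R, [/\ forall x, F x <= H x, forall x, H x <= G x,
    forall x h, - (2 * (K0 + 1) * Q h) <= H (x + h) + H (x - h) - 2 * H x,
    forall x h, H (x + h) + H (x - h) - 2 * H x <= 2 * C * Q h &
    forall x, (exists2 d, 0 < d & forall z, Q (z - x) < d -> F z + d <= G z) ->
      F x < H x].
Proof.
move=> FG hF hG; pose K := K0 + 1.
pose S x := [set phi x | phi in [set phi | midconvex phi /\
  forall z, phi z <= G z + K * Q z]].
pose h x := sup (S x).
have FS : midconvex (fun z => F z + K * Q z).
  move=> x y; have := hF x y; have := Q_par x y; have := Q_ge0 y => ? E ?.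
  have : K * (Q (x + y) + Q (x - y)) = 2 * K * Q x + 2 * K * Q y.
    by rewrite E; ring.
  by rewrite /K; lra.
have S0 x : S x !=set0.
  by exists (F x + K * Q x), (fun z => F z + K * Q z) => //; split=> // z; rewrite lerD2r.
have hub phi x : midconvex phi -> (forall z, phi z <= G z + K * Q z) -> phi x <= h x.
  move=> p1 p2; apply: ub_le_sup; last by exists phi.
  by exists (G x + K * Q x) => _ [psi [_ le] <-]; exact: le.
have hle x : h x <= G x + K * Q x.
  by apply: ge_sup => // _ [psi [_ le] <-]; exact: le.
have hconv : midconvex h.
  move=> x y; rewrite -ler_pdivlMl//; apply: ge_sup => // _ [psi [p1 p2] <-].
  rewrite ler_pdivlMl//; apply: le_trans (p1 x y) _.
  by rewrite lerD// hub.
exists (fun x => h x - K * Q x); split.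
- by move=> x; rewrite lerBrDr; exact: (hub _ _ FS (fun z => lerD (FG z) (lexx _))).
- by move=> x; rewrite lerBlDr.
- move=> x y; have := hconv x y; have : K * (Q (x + y) + Q (x - y)) = K * (2 * Q x + 2 * Q y).
    by rewrite Q_par.
  by rewrite -/K; lra.
- move=> x y; pose psi z := 2^-1 * (h (z + y) + h (z - y)) - (C + K) * Q y.
  have : psi x <= h x.
    apply: hub.
      move=> z y'; rewrite /psi; have := hconv (z + y) y'; have := hconv (z - y) y'.
      have -> : z + y + y' = z + y' + y by rewrite addrAC.
      have -> : z + y - y' = z - y' + y by rewrite addrAC.
      have -> : z - y + y' = z + y' - y by rewrite addrAC.
      have -> : z - y - y' = z - y' - y by rewrite addrAC.
      lra.
    move=> z; rewrite /psi; have := hle (z + y); have := hle (z - y); have := hG z y.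
    have : K * (Q (z + y) + Q (z - y)) = K * (2 * Q z + 2 * Q y) by rewrite Q_par.
    lra.
  rewrite /psi; have : K * (Q (x + y) + Q (x - y)) = K * (2 * Q x + 2 * Q y).
    by rewrite Q_par.
  lra.
(* The extra unit in [K = K0 + 1] leaves room for a bump: adding [d - Q (z - x)] to [F + K Q] keeps
   it midpoint convex, and raises it only where [F + d <= G]. *)
- move=> x [d d0 hd]; pose phi z := F z + K * Q z + (d - Q (z - x)).
  have : phi x <= h x.
    apply: hub; last first.
      move=> z; rewrite /phi; have := FG z; have [/hd|] := ltrP (Q (z - x)) d.
        by have := Q_ge0 (z - x); lra.
      lra.
    move=> z y; rewrite /phi.
    have -> : z + y - x = z - x + y by rewrite addrAC.
    have -> : z - y - x = z - x - y by rewrite addrAC.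
    have := hF z y; have := Q_par (z - x) y.
    have : K * (Q (z + y) + Q (z - y)) = K * (2 * Q z + 2 * Q y) by rewrite Q_par.
    by rewrite /K; lra.
  have Q0 : Q 0 = 0.
    by have := Q_par 0 0; rewrite addr0 subr0; lra.
  by rewrite /phi subrr Q0; lra.
Qed.

(** Insertion from below keeps clear of [F] only; applied to [- G] and [- F] it keeps clear of [G]
    only. Averaging the two, after a change of sign, is strict on both sides. *)
Lemma insertion F G K C : (forall x, F x <= G x) -> 0 <= K -> 0 <= C ->
  continuous (F : V -> R^o) -> continuous (G : V -> R^o) ->
  (forall x h, - (2 * K * Q h) <= F (x + h) + F (x - h) - 2 * F x) ->
  (forall x h, G (x + h) + G (x - h) - 2 * G x <= 2 * C * Q h) ->
  exists H : V -> R, [/\ forall x, F x <= H x <= G x,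
    forall x, F x < G x -> F x < H x < G x &
    forall x h, `|H (x + h) + H (x - h) - 2 * H x| <= 2 * (K + C + 1) * Q h].
Proof.
move=> FG K0 C0 cF cG hF hG.
(* Each function moves by less than a third of the gap at [x], so a third of it is left as a uniform
   gap on a [Q]-ball. *)
have gap x : F x < G x ->
    exists2 d, 0 < d & forall z, Q (z - x) < d -> F z + d <= G z.
  move=> FGx; pose a := (G x - F x) / 3; have a0 : 0 < a by rewrite /a; lra.
  have /cvgrPdist_lt /(_ _ a0) /nbhs_normP[e1 /= e10 h1] := cF x.
  have /cvgrPdist_lt /(_ _ a0) /nbhs_normP[e2 /= e20 h2] := cG x.
  exists (Num.min a (Num.min e1 e2 ^+ 2)).
    by rewrite lt_min a0 exprn_gt0// lt_min e10.
  move=> z; rewrite lt_min => /andP[_ hz].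
  have : `|z - x| < Num.min e1 e2.
    rewrite -(ltr_pXn2r (_ : 0 < 2)%N) ?nnegrE ?le_min ?(ltW e10) ?(ltW e20)//.
    exact: le_lt_trans (Q_norm _) hz.
  rewrite distrC lt_min => /andP[/h1/= + /h2/=]; rewrite !ltr_norml => g1 g2.
  have : Num.min a (Num.min e1 e2 ^+ 2) <= a by rewrite ge_min lexx.
  rewrite /a in g1 g2 *; lra.
have [H1 [F1 G1 l1 u1 s1]] := insertion_from_below FG hF hG.
have [|||H2 [F2 G2 l2 u2 s2]] := @insertion_from_below (fun x => - G x) (fun x => - F x) C K.
- by move=> x; rewrite lerN2.
- by move=> x h; have := hG x h; lra.
- by move=> x h; have := hF x h; lra.
exists (fun x => 2^-1 * (H1 x - H2 x)); split.
- move=> x; have := F1 x; have := F2 x; have := G1 x; have := G2 x; lra.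
- move=> x FGx; have [d d0 hd] := gap _ FGx.
  have : F x < H1 x by apply: s1; exists d.
  have : - G x < H2 x by apply: s2; exists d => // z /hd; lra.
  have := F1 x; have := F2 x; have := G1 x; have := G2 x; lra.
- move=> x h; have := l1 x h; have := l2 x h; have := u1 x h; have := u2 x h.
  have := Q_ge0 h; have : 0 <= K * Q h by rewrite mulr_ge0.
  have : 0 <= C * Q h by rewrite mulr_ge0.
  rewrite ler_norml; lra.
Qed.

End Insertion.

(** * The Euclidean quadratic form on row vectors *)

Section SumSq.
Context {R : realType} {n : nat}.
Implicit Types x h : 'rV[R]_n.

(** The norm of row vectors is the maximum norm, which in general violates the parallelogram law;
    this form obeys it and is comparable to the squared norm. *)
Definition sumsq x : R := \sum_(i < n) x 0 i ^+ 2.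

Lemma sumsq_ge0 x : 0 <= sumsq x.
Proof. by apply: sumr_ge0 => i _; exact: sqr_ge0. Qed.

Lemma sumsq_par x h : sumsq (x + h) + sumsq (x - h) = 2 * sumsq x + 2 * sumsq h.
Proof.
rewrite /sumsq !big_distrr -!big_split /=; apply: eq_bigr => i _.
by rewrite !mxE; ring.
Qed.

Lemma rV_norm_coord x i : `|x 0 i| <= `|x|.
Proof.
rewrite [leRHS]/Num.norm/= mx_normrE.
exact: (le_bigmax _ (fun ij : 'I_1 * 'I_n => `|x ij.1 ij.2|) (0, i)).
Qed.

Lemma rV_norm_le x (B : R) : 0 <= B -> (forall i, `|x 0 i| <= B) -> `|x| <= B.
Proof.
move=> B0 xB; rewrite [leLHS]/Num.norm/= mx_normrE; apply: bigmax_le => // -[i j] _ /=.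
by rewrite ord1.
Qed.

Lemma rV_norm_attained x : x != 0 -> exists i, `|x| = `|x 0 i|.
Proof.
move=> x0; have : mx_norm x != 0 by move: x0; rewrite -normr_eq0.
by case/mx_norm_neq0 => -[i j] /=; rewrite ord1 => e; exists j.
Qed.

Lemma norm_sumsq x : `|x| ^+ 2 <= sumsq x.
Proof.
have [->|x0] := eqVneq x 0; first by rewrite normr0 expr0n/= sumsq_ge0.
have [i ->] := rV_norm_attained x0; rewrite real_normK ?num_real//.
by rewrite /sumsq (bigD1 i)//= lerDl; apply: sumr_ge0 => j _; exact: sqr_ge0.
Qed.

Lemma sumsq_norm x : sumsq x <= n%:R * `|x| ^+ 2.
Proof.
rewrite /sumsq; apply: le_trans (_ : \sum_(i < n) `|x| ^+ 2 <= _).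
  apply: ler_sum => i _; rewrite -[leLHS]real_normK ?num_real//.
  by rewrite lerXn2r ?nnegrE// rV_norm_coord.
by rewrite sumr_const card_ord mulr_natl.
Qed.

Lemma scc_sumsq w : scc sumsq w /\ scc (fun x => - sumsq x) w.
Proof.
pose C : R := n%:R * (`|w| + 1) ^+ 2 + 2 * n%:R.
have n0 : 0 <= n%:R :> R by [].
have fb x : `|x - w| < 1 -> `|sumsq x| <= C.
  move=> xw; rewrite ger0_norm ?sumsq_ge0//; apply: le_trans (sumsq_norm _) _.
  apply: le_trans (_ : n%:R * (`|w| + 1) ^+ 2 <= _); last by rewrite lerDl mulr_ge0.
  rewrite ler_wpM2l// lerXn2r ?nnegrE ?addr_ge0//.
  by have := ler_normD (x - w) w; rewrite subrK; lra.
have sd h : 2 * sumsq h <= C * `|h| ^+ 2.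
  have := sumsq_norm h; have : 0 <= n%:R * (`|w| + 1) ^+ 2 * `|h| ^+ 2.
    by rewrite !mulr_ge0 ?exprn_ge0 ?addr_ge0.
  by rewrite /C; lra.
split; apply: (@sccI _ _ C 1) => //.
- by move=> x h _ _; rewrite sumsq_par; have := sd h; lra.
- by move=> x /fb; rewrite normrN.
- move=> x h _ _; have := sumsq_par x h; have := sumsq_ge0 h.
  have : 0 <= C * `|h| ^+ 2 by rewrite !mulr_ge0 ?addr_ge0 ?mulr_ge0 ?exprn_ge0 ?addr_ge0.
  lra.
Qed.

End SumSq.

(** * First and second differences of C^1 and C^2 maps *)

Lemma subrBB (G : zmodType) (a b c d : G) : a - b - (c - d) = a - c - (b - d).
Proof. by rewrite !opprB addrACA [RHS]addrACA [- b - c]addrC. Qed.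

Section DerivativeBounds.
Context {R : realType}.
Implicit Types (V W : normedModType R).

Lemma is_derive_normP V W (f : V -> W) a v l :
  is_derive a v f l <-> forall d, 0 < d -> exists2 e, 0 < e &
    forall h : R, h != 0 -> `|h| < e -> `|l - h^-1 *: (f (a + h *: v) - f a)| <= d.
Proof.
split=> [[df dE] d d0|H].
  have : (fun h => h^-1 *: ((f \o shift a) (h *: v) - f a)) @ 0^' --> l by rewrite -dE.
  move=> /cvgrPdist_le /(_ _ d0) /nbhs_normP[e /= e0 he]; exists e => // h h0 hh.
  by have := he h; rewrite /= sub0r normrN [a + _]addrC => /(_ hh h0).
have cl : (fun h => h^-1 *: ((f \o shift a) (h *: v) - f a)) @ 0^' --> l.
  apply/cvgrPdist_le => d d0; have [e e0 he] := H _ d0.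
  apply/nbhs_normP; exists e => //= h /=; rewrite sub0r normrN => hh h0.
  by rewrite [_ + a]addrC; exact: he.
by split; [apply: cvgP cl|exact: cvg_lim].
Qed.

Lemma is_derive_line V W (f : V -> W) a v (t : R) l :
  is_derive (a + t *: v) v f l -> is_derive t 1 (fun s : R => f (a + s *: v)) l.
Proof.
move=> /is_derive_normP H; apply/is_derive_normP => d /H[e e0 he]; exists e => // h h0 hh.
by rewrite [h *: 1]mulr1 scalerDl addrA; exact: he.
Qed.

Lemma is_derive_shiftB V W (f : V -> W) a b v l l' :
  is_derive (a + b) v f l -> is_derive a v f l' ->
  is_derive a v (fun x => f (x + b) - f x) (l - l').
Proof.
move=> /is_derive_normP H /is_derive_normP H'; apply/is_derive_normP => d d0.
have d20 : 0 < d / 2 by rewrite divr_gt0.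
have [e e0 he] := H _ d20; have [e' e'0 he'] := H' _ d20.
exists (Num.min e e'); first by rewrite lt_min e0.
move=> h h0; rewrite lt_min => /andP[h1 h2].
have := he _ h0 h1; have := he' _ h0 h2; rewrite addrAC.
set X := f (a + h *: v + b); set Y := f (a + b).
set X' := f (a + h *: v); set Y' := f a => q1 q2.
have -> : l - l' - h^-1 *: (X - X' - (Y - Y')) =
   (l - h^-1 *: (X - Y)) - (l' - h^-1 *: (X' - Y')).
  by rewrite [X - X' - _]subrBB scalerBr subrBB.
by apply: le_trans (ler_normB _ _) _; move: q1 q2; lra.
Qed.

(** The conclusion of Hahn-Banach that reduces the vector mean value inequality to the scalar one.
    The first two clauses make [l] linear. *)
Definition norm_attaining W := forall y : W, exists l : W -> R,
  [/\ {morph l : x z / x - z >-> x - z}, forall t x, l (t *: x) = t * l x,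
      forall x, `|l x| <= `|x| & l y = `|y|].

Lemma norm_attaining_R : norm_attaining R^o.
Proof.
move=> y; exists (fun x => Num.sg y * x); split.
- by move=> x z; rewrite mulrBr.
- by move=> t x; rewrite mulrCA.
- move=> x; rewrite normrM normr_sg; case: (y != 0); rewrite ?mul1r//.
  by rewrite mul0r.
- by rewrite -normrEsg.
Qed.

Lemma norm_attaining_rV n : norm_attaining 'rV[R]_n.
Proof.
move=> y; have [->|y0] := eqVneq y 0.
  exists (fun=> 0); split; last by rewrite normr0.
  - by move=> x z; rewrite subrr.
  - by move=> t x; rewrite mulr0.
  - by move=> x; rewrite normr0 normr_ge0.
have [i yi] := rV_norm_attained y0.
exists (fun x : 'rV[R]_n => Num.sg (y 0 i) * x 0 i); split.
- by move=> x z; rewrite !mxE mulrBr.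
- by move=> t x; rewrite !mxE mulrCA.
- move=> x; rewrite normrM normr_sg; apply: le_trans (rV_norm_coord x i).
  by case: (_ != 0); rewrite ?mul1r// mul0r.
- by rewrite -normrEsg yi.
Qed.

Lemma norm_attaining_prod V W : norm_attaining V -> norm_attaining W ->
  norm_attaining (V * W)%type.
Proof.
move=> hV hW [y z]; rewrite prod_normE/=.
have [yz|/ltW yz] := leP `|y| `|z|.
  have [l [l1 l2 l3 l4]] := hW z; exists (fun x => l x.2); split.
  - by move=> [a b] [a' b'] /=; rewrite l1.
  - by move=> t [a b] /=; rewrite l2.
  - by move=> x; apply: le_trans (l3 _) _; rewrite prod_normE le_max lexx orbT.
  - by rewrite l4.
have [l [l1 l2 l3 l4]] := hV y; exists (fun x => l x.1); split.
- by move=> [a b] [a' b'] /=; rewrite l1.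
- by move=> t [a b] /=; rewrite l2.
- by move=> x; apply: le_trans (l3 _) _; rewrite prod_normE le_max lexx.
- by rewrite l4.
Qed.

Lemma mean_value_le_R (f df : R -> R) (c C : R) :
  (forall s, 0 <= s <= 1 -> is_derive (s * c) 1 f (df (s * c)) /\ `|df (s * c)| <= C) ->
  `|f c - f 0| <= C * `|c|.
Proof.
move=> H; have inseg t : (0 <= t <= c) \/ (c <= t <= 0) -> exists2 s, 0 <= s <= 1 & t = s * c.
  have [->|c0] := eqVneq c 0.
    by case=> /andP[? ?]; exists 0; rewrite ?lexx ?ler01// mul0r; lra.
  have cg : 0 < c \/ c < 0 by case: (ltgtP c 0) c0 => // *; [right|left].
  move=> ht; exists (t / c); last by rewrite divfK.
  case: cg => cg; case: ht => /andP[t1 t2].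
  - by rewrite divr_ge0 ?(ltW cg)// ler_pdivrMr// mul1r.
  - have : c <= 0 by lra. by move=> /(lt_le_trans cg); rewrite ltxx.
  - have : 0 <= c by lra. by move=> /le_lt_trans/(_ cg); rewrite ltxx.
  - by rewrite -[t / c]mulrNN -invrN divr_ge0 ?oppr_ge0 ?(ltW cg)//
      ler_pdivrMr ?oppr_gt0// mul1r lerN2.
have der t : (0 <= t <= c) \/ (c <= t <= 0) -> is_derive t 1 f (df t) /\ `|df t| <= C.
  by move=> /inseg[s /H ? ->].
have [c0|/ltW c0] := leP 0 c.
  have [||z zc] := @MVT_segment R f df 0 c c0.
  - by move=> x /itvP xi; apply: (der x _).1; left; rewrite !xi.
  - apply: derivable_within_continuous => x /itvP xi.
    have xi' : 0 <= x <= c by rewrite !xi.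
    exact: (@ex_derive _ _ _ _ _ _ _ (der x (or_introl xi')).1).
  rewrite subr0 => ->; rewrite normrM ler_wpM2r//; apply: (der z _).2.
  by left; rewrite !(itvP zc).
have [||z zc] := @MVT_segment R f df c 0 c0.
- by move=> x /itvP xi; apply: (der x _).1; right; rewrite !xi.
- apply: derivable_within_continuous => x /itvP xi.
  have xi' : c <= x <= 0 by rewrite !xi.
  exact: (@ex_derive _ _ _ _ _ _ _ (der x (or_intror xi')).1).
rewrite sub0r distrC => ->; rewrite normrM normrN ler_wpM2r//; apply: (der z _).2.
by right; rewrite !(itvP zc).
Qed.

Lemma mean_value_le V W (f : V -> W) (df : R -> W) a e (c C : R) :
  norm_attaining W ->
  (forall s, 0 <= s <= 1 ->
     is_derive (a + (s * c) *: e) e f (df (s * c)) /\ `|df (s * c)| <= C) ->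
  `|f (a + c *: e) - f a| <= C * `|c|.
Proof.
move=> hW H; have [l [lB lZ lle lE]] := hW (f (a + c *: e) - f a).
rewrite -lE; apply: le_trans (ler_norm _) _.
pose g s := l (f (a + s *: e)).
have -> : l (f (a + c *: e) - f a) = g c - g 0 by rewrite /g scale0r addr0 lB.
apply: (@mean_value_le_R _ (fun s => l (df s))) => s /H [h1 h2].
split; last exact: le_trans (lle _) h2.
apply/is_derive_normP => d d0.
have /is_derive_normP /(_ _ d0)[r r0 hr] := is_derive_line h1.
exists r => // h h0 /(hr h h0); rewrite /g.
set X := f _; set Y := f _ => q; apply: le_trans q.
by rewrite -[h^-1 *: _]/(h^-1 * _) -lB -lZ -lB.
Qed.

(** [Ck] speaks of one direction at a time, while a Lipschitz bound concerns all of them uniformly.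
    Joining [0] to [x] along finitely many fixed directions [e i], inside the ball of radius [|x|],
    leaves finitely many derivatives to bound. *)
Definition coordinate_paths V := exists m (e : nat -> V) (co : nat -> V -> R) (P : nat -> V -> V),
  [/\ forall x, P 0%N x = 0, forall x, P m x = x,
     forall i x, (i < m)%N -> P i.+1 x = P i x + co i x *: e i,
     forall i x, (i < m)%N -> `|co i x| <= `|x| &
     forall i x s, (i < m)%N -> 0 <= s <= 1 -> `|P i x + (s * co i x) *: e i| <= `|x|].

Lemma coordinate_paths_rV n : coordinate_paths 'rV[R]_n.
Proof.
exists n, (fun i => \row_j (i == j :> nat)%:R).
exists (fun i (x : 'rV[R]_n) => if insub i is Some j then x 0 j else 0).
exists (fun i (x : 'rV[R]_n) => \row_j (if (j < i)%N then x 0 j else 0)); split.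
- by move=> x; apply/rowP => j; rewrite !mxE.
- by move=> x; apply/rowP => j; rewrite !mxE ltn_ord.
- move=> i x im; apply/rowP => j; rewrite !mxE insubT/= ltnS leq_eqVlt.
  have [->|ji] := eqVneq j (Ordinal im).
    by rewrite /= eqxx ltnn mulr1 add0r; congr (x 0 _); exact: val_inj.
  by move: ji; rewrite -val_eqE/= [i == j]eq_sym => /negbTE ->; rewrite mulr0 addr0.
- by move=> i x im; rewrite insubT/= rV_norm_coord.
- move=> i x s im s01; apply: rV_norm_le => // j; rewrite !mxE insubT/=.
  have [->|ji] := eqVneq j (Ordinal im).
    rewrite /= eqxx ltnn mulr1 add0r normrM.
    apply: le_trans (_ : 1 * `|x 0 (Sub i im)| <= _).
      by rewrite ler_wpM2r// ger0_norm; case/andP: s01.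
    by rewrite mul1r rV_norm_coord.
  move: ji; rewrite -val_eqE/= [i == j]eq_sym => /negbTE ->; rewrite mulr0 addr0.
  by case: ifP => _; [exact: rV_norm_coord|rewrite normr0].
Qed.

Lemma coordinate_paths_prod V W : coordinate_paths V -> coordinate_paths W ->
  coordinate_paths (V * W)%type.
Proof.
move=> [m [e [co [P [P0 Pm PS con Pn]]]]] [m' [e' [co' [P' [P0' Pm' PS' con' Pn']]]]].
exists (m + m')%N, (fun i => if (i < m)%N then (e i, 0) else (0, e' (i - m)%N)).
exists (fun i x => if (i < m)%N then co i x.1 else co' (i - m)%N x.2).
exists (fun i x => (P (minn i m) x.1, P' (i - m)%N x.2)).
have i0 i : (i < m)%N -> (i - m = 0)%N by move=> /ltnW im; apply/eqP; rewrite subn_eq0.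
have mi i : (i < m)%N -> minn i m = i by move=> /ltnW /minn_idPl.
have im' i : (i < m + m')%N -> (i < m)%N = false -> (i - m < m')%N /\ minn i m = m.
  move=> h /negbT; rewrite -leqNgt => mi'; split; last exact/minn_idPr.
  by rewrite ltn_subLR.
split.
- by move=> x; rewrite min0n sub0n P0 P0'.
- by move=> [x y] /=; rewrite (minn_idPr (leq_addr _ _)) addnC addnK Pm Pm'.
- move=> i [x y] h; case: ifP => im.
    rewrite (mi i im) (minn_idPl im) (_ : (i.+1 - m = 0)%N); last by apply/eqP; rewrite subn_eq0.
    by rewrite (i0 i im) P0' PS//; congr pair; rewrite /= scaler0 addr0.
  have [h1 h2] := im' _ h im; rewrite h2.
  have mi' : (m <= i)%N by rewrite leqNgt im.
  rewrite (minn_idPr (leqW mi')) subSn// PS'// Pm.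
  by congr pair; rewrite /= scaler0 addr0.
- move=> i [x y] h /=; rewrite prod_normE/=; case: ifP => im.
    by apply: le_trans (con _ _ im) _; rewrite le_max lexx.
  have [h1 h2] := im' _ h im.
  by apply: le_trans (con' _ _ h1) _; rewrite le_max lexx orbT.
- move=> i [x y] s h s01 /=; rewrite !prod_normE/=; case: ifP => im.
    rewrite i0// P0' /= scaler0 addr0 normr0 mi// ge_max.
    rewrite (le_trans (Pn _ _ _ im s01)) ?le_max ?lexx//=.
    by rewrite normr_ge0.
  have [h1 h2] := im' _ h im; rewrite h2 Pm/= scaler0 addr0 ge_max !le_max lexx/=.
  by rewrite (Pn' _ _ _ h1 s01) orbT.
Qed.

Definition nbhd V (U : set V) w := exists2 e : R, 0 < e & forall x, `|x - w| < e -> U x.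

Lemma C1_lipschitz V W (U : set V) (f : V -> W) w :
  coordinate_paths V -> norm_attaining W -> nbhd U w -> Ck 1 U f ->
  exists C e, [/\ 0 <= C, 0 < e, forall x, `|x - w| < e -> U x &
    forall x y, `|x - w| < e -> `|y - w| < e -> `|f x - f y| <= C * `|x - y|].
Proof.
move=> [m [e [co [P [P0 Pm PS con Pn]]]]] hW [r r0 rU] [cf df].
have Uw : U w by apply: rU; rewrite subrr normr0.
have [C [d [C0 d0 dr bd]]] : exists C d, [/\ 0 <= C, 0 < d, d <= r &
    forall i x, (i < m)%N -> `|x - w| < d -> `|'D_(e i) f x| <= C].
  elim: (m) => [|k [C [d [C0 d0 dr bd]]]]; first by exists 0, r; split.
  have [_ [/(_ _ Uw)/cvgrPdist_lt /(_ 1 ltr01) /nbhs_normP[d' /= d'0 hd'] _]] := df (e k).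
  exists (Num.max C (`|'D_(e k) f w| + 1)), (Num.min d d'); split.
  - by rewrite le_max C0.
  - by rewrite lt_min d0.
  - by rewrite ge_min dr.
  - move=> i x; rewrite ltnS leq_eqVlt lt_min => /orP[/eqP->|ik] /andP[x1 x2].
      rewrite le_max; apply/orP; right.
      have := hd' x; rewrite /= distrC => /(_ x2).
      have := ler_normD ('D_(e k) f x - 'D_(e k) f w) ('D_(e k) f w).
      by rewrite subrK [`|'D_(e k) f w - _|]distrC; lra.
    by rewrite le_max bd.
exists (m%:R * C), (d / 3); split => //; first by rewrite mulr_ge0.
- by rewrite divr_gt0.
- by move=> x xw; apply: rU; lra.
- move=> y x yw xw; pose v := y - x.
  have v2 : `|v| < 2 * (d / 3).
    rewrite /v (_ : y - x = (y - w) - (x - w)); last by rewrite opprB addrA subrK.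
    by apply: le_lt_trans (ler_normB _ _) _; lra.
  have ind k : (k <= m)%N -> `|f (x + P k v) - f x| <= k%:R * (C * `|v|).
    elim: k => [|k IH] km; first by rewrite P0 addr0 subrr normr0 mul0r.
    have := IH (ltnW km); rewrite PS// addrA -natr1 mulrDl mul1r => {}IH.
    rewrite -[f _ - f x](subrKA (f (x + P k v))) [leRHS]addrC.
    apply: le_trans (ler_normD _ _) _; apply: lerD => //.
    apply: le_trans (_ : C * `|co k v| <= _); last by rewrite ler_wpM2l// con.
    apply: (@mean_value_le _ _ _ (fun s => 'D_(e k) f (x + P k v + s *: e k))) => // s s01.
    have xs : `|x + P k v + (s * co k v) *: e k - w| < d.
      rewrite -[x + P k v + _]addrA addrAC; apply: le_lt_trans (ler_normD _ _) _.
      by have := Pn _ v _ km s01; lra.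
    split; last exact: bd.
    apply: DeriveDef => //; apply: (df (e k)).1; apply: rU; lra.
  have := ind m (leqnn _); rewrite Pm /v [x + _]addrC subrK mulrA.
  exact.
Qed.

(** The second difference is the increment over [h], from [z = x - h], of [g y = f (y + h) - f y];
    the derivatives of [g] along the [e i] are [O(|h|)] because those of [f] are locally
    Lipschitz. *)
Lemma C2_nice V W (U : set V) (f : V -> W) w :
  coordinate_paths V -> norm_attaining W -> nbhd U w -> Ck 2 U f -> nice f w.
Proof.
move=> hV hW hU C2.
have C1 : Ck 1 U f by case: C2 => [cf df]; split=> // v; have [d1 [d2 _]] := df v.
have [C [r [C0 r0 rU fl]]] := C1_lipschitz hV hW hU C1.
have [m [e [co [P [P0 Pm PS con Pn]]]]] := hV; have [cf df] := C2.
have [D [d [D0 d0 dr bd]]] : exists D d, [/\ 0 <= D, 0 < d, d <= r &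
    forall i x y, (i < m)%N -> `|x - w| < d -> `|y - w| < d ->
    `|'D_(e i) f x - 'D_(e i) f y| <= D * `|x - y|].
  elim: (m) => [|k [D [d [D0 d0 dr bd]]]]; first by exists 0, r; split.
  have [D' [d' [D'0 d'0 _ fl']]] := C1_lipschitz hV hW hU (df (e k)).2.
  exists (Num.max D D'), (Num.min d d'); split.
  - by rewrite le_max D0.
  - by rewrite lt_min d0.
  - by rewrite ge_min dr.
  - move=> i x y; rewrite ltnS leq_eqVlt !lt_min => /orP[/eqP->|ik] /andP[x1 x2] /andP[y1 y2].
      by apply: le_trans (fl' _ _ x2 y2) _; rewrite ler_wpM2r// le_max lexx orbT.
    by apply: le_trans (bd _ _ _ ik x1 y1) _; rewrite ler_wpM2r// le_max lexx.
have d30 : 0 < d / 3 by rewrite divr_gt0.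
have mD0 : 0 <= m%:R * D by rewrite mulr_ge0.
exists (C + m%:R * D), (d / 3); split => //; first by rewrite addr_ge0.
  move=> x y xw yw; apply: le_trans (fl _ _ _ _) _; try lra.
  by rewrite ler_wpM2r// lerDl.
move=> x h xp xm; apply: le_trans (_ : m%:R * D * `|h| ^+ 2 <= _); last first.
  by rewrite ler_wpM2r ?exprn_ge0// lerDr.
have hn : `|h| < d / 3.
  have -> : h = 2^-1 *: ((x + h - w) - (x - h - w)).
    rewrite subrBB subrr subr0 opprB [h - x]addrC addrACA subrr add0r.
    by rewrite scalerDr half_double.
  rewrite normrZ ger0_norm ?invr_ge0//.
  by have := ler_normB (x + h - w) (x - h - w); lra.
pose z := x - h; pose g y := f (y + h) - f y.
have -> : f (x + h) + f (x - h) - 2 *: f x = g (z + h) - g z.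
  rewrite /g /z subrK scaler_nat mulr2n opprB opprD.
  by rewrite [RHS]addrACA.
have ind k : (k <= m)%N -> `|g (z + P k h) - g z| <= k%:R * (D * `|h| ^+ 2).
  elim: k => [|k IH] km; first by rewrite P0 addr0 subrr normr0 mul0r.
  have := IH (ltnW km); rewrite PS// addrA -natr1 mulrDl mul1r => {}IH.
  rewrite -[g _ - g z](subrKA (g (z + P k h))) [leRHS]addrC.
  apply: le_trans (ler_normD _ _) _; apply: lerD => //.
  apply: le_trans (_ : D * `|h| * `|co k h| <= _); last first.
    by rewrite expr2 mulrA ler_wpM2l ?mulr_ge0// con.
  apply: (@mean_value_le _ _ _ (fun s => 'D_(e k) f (z + P k h + s *: e k + h) -
     'D_(e k) f (z + P k h + s *: e k))) => // s s01.
  set y := z + P k h + _; have yE : y - w = (x - h - w) + (P k h + (s * co k h) *: e k).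
    by rewrite /y /z -[x - h + _ + _]addrA addrAC.
  have y1 : `|y - w| < d.
    by rewrite yE; apply: le_lt_trans (ler_normD _ _) _; have := Pn _ h _ km s01; lra.
  have y2 : `|y + h - w| < d.
    rewrite addrAC yE; apply: le_lt_trans (ler_normD _ _) _.
    have := ler_normD (x - h - w) (P k h + (s * co k h) *: e k).
    by have := Pn _ h _ km s01; lra.
  split.
    by apply: is_derive_shiftB; apply: DeriveDef => //; apply: (df (e k)).1; apply: rU; lra.
  by apply: le_trans (bd _ _ _ km y2 y1) _; rewrite [y + h - y]addrAC subrr add0r.
by have := ind m (leqnn _); rewrite Pm mulrA.
Qed.

End DerivativeBounds.

(** * Local bounds for convex functions *)

Section ConvexBounded.
Context {R : realType}.

Definition convex_near (V : normedModType R) (e : R) (w : V) (F : V -> R) :=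
  forall x y (t : R), `|x - w| < e -> `|y - w| < e -> 0 <= t <= 1 ->
    F (t *: x + (1 - t) *: y) <= t * F x + (1 - t) * F y.

Lemma convex_functionE (V : normedModType R) (D : set V) (F : V -> R) x y (t : R) :
  convex_function D F -> D x -> D y -> 0 <= t <= 1 ->
  F (t *: x + (1 - t) *: y) <= t * F x + (1 - t) * F y.
Proof.
move=> cF Dx Dy /andP[t0 t1].
exact: (cF (Itv01 t0 t1) x y (mem_set Dx) (mem_set Dy)).
Qed.

(* A convex function on a box is bounded by its values at the vertices: induction
   on the number of free coordinates. *)
Lemma convex_bounded_rV n (e : R) (F : 'rV[R]_n -> R) : 0 < e -> convex_near e 0 F ->
  exists B d, 0 < d /\ forall x, `|x| < d -> F x <= B.
Proof.
move=> e0 cF; pose d := e / 2; have d0 : 0 < d by rewrite divr_gt0.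
have de : d < e by rewrite /d; lra.
pose box (x : 'rV[R]_n) := forall i, `|x 0 i| <= d.
have boxe x : box x -> `|x - 0| < e.
  by move=> bx; rewrite subr0; apply: le_lt_trans (rV_norm_le (ltW d0) bx) _.
have H k : forall y, box y -> exists B, forall x, box x ->
    (forall j : 'I_n, (k <= j)%N -> x 0 j = y 0 j) -> F x <= B.
  elim: k => [|k IH] y by_.
    exists (F y) => x _ xy; rewrite (_ : x = y)//.
    by apply/rowP => j; exact: xy.
  have [kn|kn] := ltnP k n; last first.
    have [B hB] := IH y by_; exists B => x bx xy; apply: hB => // j kj.
    by have := leq_trans kn kj; rewrite leqNgt ltn_ord.
  pose i := Ordinal kn; pose upd (a : R) (x : 'rV[R]_n) := \row_j (if j == i then a else x 0 j).
  have bu a x : `|a| <= d -> box x -> box (upd a x).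
    by move=> ad bx j; rewrite mxE; case: eqP.
  have dd : `|d| <= d by rewrite gtr0_norm.
  have dd' : `|- d| <= d by rewrite normrN.
  have [B1 h1] := IH _ (bu _ _ dd by_); have [B2 h2] := IH _ (bu _ _ dd' by_).
  exists (Num.max B1 B2) => x bx xy; pose t := (x 0 i + d) / (2 * d).
  have := bx i; rewrite ler_norml => /andP[x1 x2].
  have t01 : 0 <= t <= 1.
    by rewrite /t divr_ge0 ?mulr_ge0 ?(ltW d0)//= ?ler_pdivrMr ?mulr_gt0//; lra.
  have -> : x = t *: upd d x + (1 - t) *: upd (- d) x.
    apply/rowP => j; rewrite !mxE; case: eqP => [->|_]; last by ring.
    by rewrite /t; field; rewrite gt_eqF.
  apply: le_trans (cF _ _ _ (boxe _ (bu _ _ dd bx)) (boxe _ (bu _ _ dd' bx)) t01) _.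
  have agree a : forall j : 'I_n, (k <= j)%N -> upd a x 0 j = upd a y 0 j.
    move=> j kj; rewrite !mxE; case: eqP => // /eqP ji; apply: xy.
    by rewrite ltn_neqAle kj andbT eq_sym -val_eqE in ji *.
  have q1 : F (upd d x) <= Num.max B1 B2 by rewrite le_max (h1 _ (bu _ _ dd bx) (agree d)).
  have q2 : F (upd (- d) x) <= Num.max B1 B2 by rewrite le_max (h2 _ (bu _ _ dd' bx) (agree (- d))) orbT.
  case/andP: t01 => t0 t1.
  have : t * F (upd d x) <= t * Num.max B1 B2 by rewrite ler_wpM2l.
  have : (1 - t) * F (upd (- d) x) <= (1 - t) * Num.max B1 B2.
    by rewrite ler_wpM2l// subr_ge0.
  lra.
have b0 : box 0 by move=> i; rewrite mxE normr0 ltW.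
have [B hB] := H n _ b0; exists B, d; split => // x xd; apply: hB.
  by move=> i; apply: le_trans (rV_norm_coord _ _) (ltW xd).
by move=> j; rewrite leqNgt ltn_ord.
Qed.

Lemma concave_scc_prod n (D : set ('rV[R]_n * 'rV[R]_n)%type)
    (k : ('rV[R]_n * 'rV[R]_n)%type -> R) w :
  nbhd D w -> convex_function D (fun z => - k z) -> scc k w.
Proof.
move=> [e e0 eD] ck.
(* The product is identified with ['rV[R]_(n + n)], where the bound by the vertices of a box is
   available. *)
pose j (z : 'rV[R]_(n + n)) := (lsubmx z, rsubmx z).
have jZ t z : j (t *: z) = t *: j z by rewrite /j !linearZ.
have jD z z' : j (z + z') = j z + j z' by rewrite /j !linearD.
have jn z : `|j z| <= `|z|.
  rewrite prod_normE/= ge_max; apply/andP; split; apply: rV_norm_le => // i.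
    by rewrite mxE rV_norm_coord.
  by rewrite mxE rV_norm_coord.
have [|B [d [d0 hB]]] := @convex_bounded_rV _ e (fun z => - k (w + j z)) e0.
  move=> x y t; rewrite !subr0 => xe ye t01.
  have -> : w + j (t *: x + (1 - t) *: y) = t *: (w + j x) + (1 - t) *: (w + j y).
    rewrite jD !jZ !scalerDr addrACA -scalerDl addrC [t + _]addrC subrK scale1r.
    by rewrite addrC.
  apply: (convex_functionE ck) => //; apply: eD; rewrite addrAC subrr add0r.
    exact: le_lt_trans (jn _) xe.
  exact: le_lt_trans (jn _) ye.
have low x : `|x - w| < d -> - k x <= B.
  move=> xw; pose z := row_mx (x - w).1 (x - w).2.
  have zE : w + j z = x.
    by rewrite /j /z row_mxKl row_mxKr -surjective_pairing [w + _]addrC subrK.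
  rewrite -zE; apply: hB; apply: le_lt_trans xw.
  apply: rV_norm_le => // i; rewrite /z mxE prod_normE le_max.
  by case: splitP => i' _; rewrite rV_norm_coord ?orbT.
pose r := Num.min d e; have r0 : 0 < r by rewrite lt_min d0.
have mid x h : `|x + h - w| < r -> `|x - h - w| < r -> k (x + h) + k (x - h) - 2 * k x <= 0.
  rewrite !lt_min => /andP[_ h1] /andP[_ h2].
  have t01 : 0 <= (2^-1 : R) <= 1 by lra.
  have := convex_functionE ck (eD _ h1) (eD _ h2) t01.
  have -> : 1 - 2^-1 = 2^-1 :> R by lra.
  by rewrite half_addB; lra.
pose C := `|B| + 2 * `|k w|.
apply: (@sccI _ _ C r) => //.
  (* The vertices bound [- k] from above only; reflecting [x] in [w] and using the midpoint
     inequality bounds it from below. *)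
  move=> x xw; have xw' : `|w - (x - w) - w| < r by rewrite addrAC subrr add0r normrN.
  have := mid w (x - w); rewrite [w + (x - w)]addrC subrK => /(_ xw xw').
  have : - k x <= B by apply: low; move: xw; rewrite lt_min => /andP[].
  have : - k (w - (x - w)) <= B by apply: low; move: xw'; rewrite lt_min => /andP[].
  have := ler_norm B; have := ler_norm (k w); have := ler_norm (- k w).
  by rewrite normrN /C ler_norml; lra.
by move=> x h h1 h2; apply: le_trans (mid _ _ h1 h2) _; rewrite mulr_ge0 ?exprn_ge0// addr_ge0 ?mulr_ge0.
Qed.

End ConvexBounded.

(** * Semi-concavity on a manifold, read in charts *)

Lemma lipschitz_continuous (R : realType) (V W : normedModType R) (f : V -> W) w :
  (exists K e, [/\ 0 <= K, 0 < e & forall x, `|x - w| < e -> `|f x - f w| <= K * `|x - w|]) ->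
  {for w, continuous f}.
Proof.
move=> [K [e [K0 e0 h]]]; apply/cvgrPdist_lt => d d0; apply/nbhs_normP.
exists (Num.min e (d / (K + 1))); first by rewrite /= lt_min e0 divr_gt0// ltr_wpDl.
move=> x /=; rewrite lt_min distrC => /andP[xe xd]; rewrite distrC.
apply: le_lt_trans (h x xe) _.
move: xd; rewrite ltr_pdivlMr ?ltr_wpDl//; apply: le_lt_trans.
by rewrite mulrC ler_wpM2l// lerDl.
Qed.

Section Charts.
Context {R : realType} {T : topologicalType} {V : normedModType R}.
Implicit Types p : chart T V.

Lemma cimg_inv p w : is_chart p -> cimg p w -> cdom p (cinv p w) /\ cmap p (cinv p w) = w.
Proof. by move=> [_ _ K _ _] [x px <-]; rewrite K. Qed.

Lemma chart_ball p x (N : set T) : is_chart p -> cdom p x -> nbhs x N ->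
  exists2 e, 0 < e & forall z, `|z - cmap p x| < e -> cimg p z /\ N (cinv p z).
Proof.
move=> [od oi K cm ci] px Nx; have pw : cimg p (cmap p x) by exists x.
have /nbhs_normP[e1 /= e10 h1] := open_nbhs_nbhs (conj oi pw).
have := ci _ pw N; rewrite K// => /(_ Nx) /nbhs_normP[e2 /= e20 h2].
exists (Num.min e1 e2); first by rewrite lt_min e10.
by move=> z; rewrite lt_min distrC => /andP[z1 z2]; split; [apply: h1|apply: h2].
Qed.

Lemma chart_nbhs p x (P : set V) : is_chart p -> cdom p x -> nbhs (cmap p x) P ->
  \forall z \near x, cdom p z /\ P (cmap p z).
Proof.
move=> [od oi K cm ci] px Px; have := cm _ px P Px => h.
by apply: filterS2 (open_nbhs_nbhs (conj od px)) h => z.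
Qed.

End Charts.

Section ManifoldSemiconcave.
Context {R : realType} {n : nat} {M : topologicalType}.
Variable A : set (chart M 'rV[R]_n).
Hypothesis sA : smooth_structure A.
Local Notation V := 'rV[R]_n.
Implicit Types (p q : chart M V) (f g : M -> R).

Lemma nice_transition p q x : A p -> A q -> cdom p x -> cdom q x ->
  nice (transition p q) (cmap p x).
Proof.
move=> Ap Aq px qx; have [sm _] := atlas_compatible sA Ap Aq.
have cp := atlas_chart sA Ap; have cq := atlas_chart sA Aq.
apply: (C2_nice (coordinate_paths_rV n) (norm_attaining_rV (n := n)) _ (sm 2)).
have [_ _ _ _ _] := cp; have [oq _ _ _ _] := cq.
have [e e0 he] := chart_ball cp px (open_nbhs_nbhs (conj oq qx)).
exists e => // z /he [iz qz]; have [dz zK] := cimg_inv cp iz.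
by exists (cinv p z).
Qed.

Definition mscc_at f x := forall p, A p -> cdom p x -> scc (f \o cinv p) (cmap p x).

(** Transition maps are C^{1,1} and composition with them preserves semi-concavity, so one chart
    decides for all. *)
Lemma mscc_atI f x p : A p -> cdom p x -> scc (f \o cinv p) (cmap p x) -> mscc_at f x.
Proof.
move=> Ap px sf q Aq qx.
have cp := atlas_chart sA Ap; have cq := atlas_chart sA Aq.
have [op _ Kp _ _] := cp; have [_ _ Kq _ _] := cq.
have E : transition q p (cmap q x) = cmap p x by rewrite /transition/= Kq.
apply: (@scc_near _ _ _ ((f \o cinv p) \o transition q p)); last first.
  by apply: scc_comp; [exact: nice_transition|rewrite E].
have [e e0 he] := chart_ball cq qx (open_nbhs_nbhs (conj op px)).
by exists e => // z /he [iz pz]; rewrite /transition/= Kp.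
Qed.

Lemma mscc_at_near f g x : (\forall z \near x, f z = g z) -> mscc_at g x -> mscc_at f x.
Proof.
move=> fg sg p Ap px; apply: scc_near (sg p Ap px).
have [e e0 he] := chart_ball (atlas_chart sA Ap) px fg.
by exists e => // z /he[].
Qed.

Lemma mscc_at_cst (a : R) x : mscc_at (fun=> a) x.
Proof. by move=> p _ _; exact: scc_cst. Qed.

Lemma mscc_at_add f g x : mscc_at f x -> mscc_at g x -> mscc_at (fun z => f z + g z) x.
Proof. by move=> sf sg p Ap px; exact: scc_add (sf p Ap px) (sg p Ap px). Qed.

Lemma mscc_at_mul f g x : (forall z, 0 <= f z) ->
  mscc_at f x -> mscc_at (fun z => - f z) x -> mscc_at g x ->
  mscc_at (fun z => f z * g z) x.
Proof.
move=> f0 sf snf sg p Ap px.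
by apply: scc_mul (sf p Ap px) (snf p Ap px) (sg p Ap px) => z; exact: f0.
Qed.

Lemma mscc_at_sum (F : nat -> M -> R) m x : (forall i, (i < m)%N -> mscc_at (F i) x) ->
  mscc_at (fun z => \sum_(i < m) F i z) x.
Proof. by move=> h p Ap px; apply: (@scc_sum _ _ (fun i => F i \o cinv p)) => i /h; apply. Qed.

Lemma mscc_at_continuous f x : mscc_at f x -> {for x, continuous (f : M -> R^o)}.
Proof.
move=> sf; have [p Ap px] := atlas_cover sA x.
have cp := atlas_chart sA Ap; have [_ _ K _ _] := cp.
move=> P /=; rewrite -[x in f x]K// => /(scc_continuous (sf p Ap px)) h.
have := chart_nbhs cp px h; rewrite -nbhs_nearE /nbhs/=.
by apply: filterS => z [pz]; rewrite /= K.
Qed.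

Lemma mscc_C11 f : (forall x, mscc_at f x) -> (forall x, mscc_at (fun z => - f z) x) ->
  C11 A f.
Proof.
move=> sf snf p Ap; have cp := atlas_chart sA Ap.
have loc w : cimg p w -> exists K e, [/\ 0 < e, forall a, `|a - w| < e -> differentiable (in_chart f p) a &
   forall a b v, `|a - w| < e -> `|b - w| < e ->
    `|'d (in_chart f p) a v - 'd (in_chart f p) b v| <= K * `|a - b| * `|v|].
  move=> [x px <-]; exact: scc_two_sided_c11 (sf x p Ap px) (snf x p Ap px).
split; last first.
  move=> w /loc[K [e [e0 _ h]]]; exists K, e; split=> // a b v.
  by rewrite -ball_normE/= ![`|w - _|]distrC; exact: h.
have dif w : cimg p w -> differentiable (in_chart f p) w.
  by move=> /loc[K [e [e0 h _]]]; apply: h; rewrite subrr normr0.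
split=> [w /dif|v]; first exact: differentiable_continuous.
split=> [w /dif|]; first exact: diff_derivable.
split=> // w pw; have [K [e [e0 hd hl]]] := loc _ pw.
apply: lipschitz_continuous; exists (`|K| * `|v|), e; split; first by rewrite mulr_ge0.
  exact: e0.
move=> a aw; have ww : `|w - w| < e by rewrite subrr normr0.
rewrite !deriveE; [|exact: hd|exact: hd].
apply: le_trans (hl a w v aw ww) _.
by rewrite -mulrA [X in _ * X]mulrC mulrA ler_wpM2r// ler_wpM2r// ler_norm.
Qed.

Lemma mscc_touch f g x : mscc_at f x -> mscc_at g x ->
  (\forall z \near x, f x + g x <= f z + g z) ->
  [/\ mdifferentiable A f x, mdifferentiable A g x &
     forall p : charts_at A x, mdiff g p = (fun v => - mdiff f p v)].
Proof.
move=> sf sg fg.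
have H p : A p -> cdom p x -> [/\ differentiable (in_chart f p) (cmap p x),
    differentiable (in_chart g p) (cmap p x) &
    forall v, 'd (in_chart g p) (cmap p x) v = - 'd (in_chart f p) (cmap p x) v].
  move=> Ap px; apply: scc_touch; [exact: sf|exact: sg|].
  have cp := atlas_chart sA Ap; have [_ _ K _ _] := cp.
  have [e e0 he] := chart_ball cp px fg.
  by exists e => // z /he[_]; rewrite /in_chart/= K.
split=> [p Ap px|p Ap px|[p [Ap px]]]; [by have [] := H p Ap px|by have [] := H p Ap px|].
by apply/funext => v; have [_ _] := H p Ap px; exact.
Qed.

(** The hypothesis provides some chart [r] of the maximal product atlas, perhaps not a product
    chart. There [c] is a smooth plus a concave function, both semi-concave; the transition map from
    the product chart to [r] is C^{1,1}, which transfers the bound. *)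
Lemma semiconcave_prod_chart (c : M * M -> R) p q y x :
  locally_semiconcave (prod_atlas A) c -> A p -> A q -> cdom p y -> cdom q x ->
  scc (fun z : V * V => c (cinv p z.1, cinv q z.2)) (cmap p y, cmap q x).
Proof.
move=> sc Ap Aq py qx; have [r [[cr comp] rz _ [h [k [sh ck hk]]]]] := sc (y, x).
have cp := atlas_chart sA Ap; have cq := atlas_chart sA Aq.
have [_ _ Kp _ _] := cp; have [_ _ Kq _ _] := cq; have [or oir Kr cmr cir] := cr.
have [_ sm] := comp _ _ Ap Aq.
pose pq := prod_chart p q; pose w := (cmap p y, cmap q x).
pose U := cmap pq @` (cdom r `&` cdom pq).
have [[N1 N2] /= [Ny Nx] NN] : nbhs (y, x) (cdom r) by exact: open_nbhs_nbhs.
have [e1 e10 he1] := chart_ball cp py Ny; have [e2 e20 he2] := chart_ball cq qx Nx.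
have hV := coordinate_paths_prod (coordinate_paths_rV (R := R) n) (coordinate_paths_rV n).
have hW := norm_attaining_prod (norm_attaining_rV (R := R) (n := n)) (norm_attaining_rV (n := n)).
have Uw : exists2 e, 0 < e & forall z : V * V, `|z - w| < e ->
    [/\ cimg p z.1, cimg q z.2 & cdom r (cinv p z.1, cinv q z.2)].
  exists (Num.min e1 e2); first by rewrite lt_min e10.
  move=> z; rewrite prod_normE/= gt_max !lt_min => /andP[/andP[z1 _] /andP[_ z2]].
  have [i1 n1] := he1 _ z1; have [i2 n2] := he2 _ z2.
  by split => //; exact: (NN (_, _)).
have nU : nbhd U w.
  have [e e0 he] := Uw; exists e => // z /he [i1 i2 rz'].
  have [d1 E1] := cimg_inv cp i1; have [d2 E2] := cimg_inv cq i2.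
  exists (cinv p z.1, cinv q z.2); first by split.
  by rewrite /= E1 E2 -surjective_pairing.
have nice1 : nice (transition pq r) w by apply: (C2_nice hV hW nU); exact: sm.
have E : transition pq r w = cmap r (y, x) by rewrite /transition/= Kp// Kq.
have nr : nbhd (cimg r) (cmap r (y, x)).
  have [e e0 he] := chart_ball cr rz (@filterT _ _ _).
  by exists e => // z /he[].
have shk : scc (fun v => h v + k v) (cmap r (y, x)).
  apply: scc_add; last exact: concave_scc_prod nr ck.
  by have [] := nice_scc (C2_nice hV (@norm_attaining_R R) nr (sh 2)).
apply: (@scc_near _ _ _ ((fun v => h v + k v) \o transition pq r)); last first.
  by apply: scc_comp => //; rewrite E.
have [e e0 he] := Uw; exists e => // z /he [i1 i2 rz'].
rewrite /transition/= -hk ?Kr//.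
by exists (cinv p z.1, cinv q z.2).
Qed.

End ManifoldSemiconcave.

(** * Compactness and countability *)

Section Topology.
Context {T : topologicalType}.

(** Near-covering compactness along the filter of large integers; monotonicity turns local validity
    for one [N] into validity for all larger ones. *)
Lemma compact_uniform_nat (K : set T) (P : nat -> T -> Prop) : compact K ->
  (forall N N' x, (N <= N')%N -> P N x -> P N' x) ->
  (forall x, K x -> exists N, \forall z \near x, P N z) ->
  exists N, forall x, K x -> P N x.
Proof.
move=> /compact_near_coveringP cK mono loc.
have [|N0 _ hN] := cK nat \oo P _.
  move=> x /loc[N hN]; exists (P N, [set m | (N <= m)%N]) => /=.
    by split=> //; exists N.
  by move=> [z m] /= [Pz Nm]; exact: mono Pz.
by exists N0 => x Kx; exact: (hN N0 (leqnn _) x Kx).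
Qed.

Definition countable_base (U : nat -> set T) :=
  forall x (N : set T), nbhs x N -> exists i, U i x /\ U i `<=` N.

Lemma second_countable_base : @second_countable T -> exists U, countable_base U.
Proof.
move=> [B /countable_injP[e einj] [Bo Bn]].
(* An index that codes no member of the base gives the empty set. *)
exists (fun i => [set x | exists2 W, B W /\ e W = i & W x]) => x N Nx.
have [W /= [BW Wx] WN] := Bn x N Nx.
exists (e W); split; first by exists W.
move=> y [W' [BW' eW] W'y]; apply: WN; rewrite -(einj _ _ _ _ eW)//; exact/mem_set.
Qed.

(** For each basic open set contained in some [O x] with [x] in [S], one such [x] is selected; [z0]
    is the default for the other indices. *)
Lemma lindelof (U : nat -> set T) (S : set T) (O : T -> set T) z0 :
  countable_base U -> S z0 -> (forall z, S z -> nbhs z (O z)) ->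
  exists s : nat -> T, (forall i, S (s i)) /\ forall z, S z -> exists i, O (s i) z.
Proof.
move=> bU Sz0 SO; pose Q i := [set x | S x /\ U i `<=` O x].
have [s hs] : {s : nat -> T & forall i, S (s i) /\ (Q i !=set0 -> Q i (s i))}.
  apply: (@choice _ _ (fun i x => S x /\ (Q i !=set0 -> Q i x))) => i.
  have [[x Qx]|nQ] := pselect (Q i !=set0); last by exists z0.
  by exists x; split=> //; case: Qx.
exists s; split=> [i|z Sz]; first exact: (hs i).1.
have [i [Uz UO]] := bU _ _ (SO z Sz).
have [_ h] := (hs i).2 (ex_intro _ z (conj Sz UO)).
by exists i; exact: h.
Qed.

End Topology.

Lemma countable_base_prod (T : topologicalType) (U : nat -> set T) :
  countable_base U -> exists U2 : nat -> set (T * T), countable_base U2.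
Proof.
move=> bU; exists (fun k => if unpickle k is Some ij then U ij.1 `*` U ij.2 else set0).
move=> [x y] N [[N1 N2] /= [Nx Ny] NN].
have [i [Ui iN]] := bU _ _ Nx; have [j [Uj jN]] := bU _ _ Ny.
exists (pickle (i, j)); rewrite pickleK; split=> // -[a b] /= [Ua Ub].
by apply: NN; split; [exact: iN|exact: jN].
Qed.

(** * Cutoff functions of class C^{1,1} *)

Section Bump.
Context {R : realType} {n : nat}.
Local Notation V := 'rV[R]_n.

Definition two_sided (W : normedModType R) (f : W -> R) w :=
  scc f w /\ scc (fun x => - f x) w.

Lemma two_sided_nice (W : normedModType R) (f : W -> R) w :
  two_sided f w -> nice (f : W -> R^o) w.
Proof.
move=> [sf snf]; have [C [e [[C0 e0 _ fl fs] [_ _ _ _ nfs]]]] := scc_common sf snf.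
exists C, e; split=> // x h xp xm.
have := fs _ _ xp xm; have := nfs _ _ xp xm; rewrite /=.
by rewrite -[2 *: f x]/(2 * f x) ler_norml; lra.
Qed.

(** The building block of the cutoffs: its second differences lie between [0] and [2 h ^+ 2], which
    is all the smoothness that the patching asks for. *)
Definition posq (t : R) : R := Num.max t 0 ^+ 2.

Lemma posq_sd (a h : R) : 0 <= posq (a + h) + posq (a - h) - 2 * posq a <= 2 * h ^+ 2.
Proof.
rewrite /posq /Num.max.
case: ltP => h1; case: ltP => h2; case: ltP => h3; apply/andP; split; nra.
Qed.

Lemma two_sided_posq (t : R) : two_sided (posq : R^o -> R) t.
Proof.
pose C := (`|t| + 1) ^+ 2 + 2.
have C2 : 2 <= C by rewrite /C lerDr exprn_ge0// addr_ge0.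
have b x : `|x - t| < 1 -> `|posq x| <= C.
  move=> xt; rewrite ger0_norm ?exprn_ge0 ?le_max ?lexx ?orbT//.
  apply: le_trans (_ : (`|t| + 1) ^+ 2 <= _); last by rewrite /C lerDl.
  rewrite lerXn2r ?nnegrE ?le_max ?lexx ?orbT ?addr_ge0// ge_max addr_ge0// andbT.
  by have := ler_norm x; have := ler_normD (x - t) t; rewrite subrK; lra.
have sq (h : R^o) : 2 * h ^+ 2 <= C * `|h| ^+ 2.
  by rewrite real_normK ?num_real// ler_wpM2r// sqr_ge0.
split; apply: (@sccI _ _ C 1) => //.
- move=> x h _ _; have /andP[_ u] := posq_sd x h; exact: le_trans u (sq h).
- by move=> x /b; rewrite normrN.
- move=> x h _ _; have /andP[l u] := posq_sd x h.
  have : 0 <= C * `|h| ^+ 2 by rewrite mulr_ge0 ?exprn_ge0//; lra.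
  by rewrite /=; lra.
Qed.

Lemma two_sided_comp_posq (f : V -> R) w : two_sided f w ->
  two_sided (fun x => posq (f x)) w.
Proof.
move=> /two_sided_nice nf; have [s1 s2] := two_sided_posq (f w).
by split; [exact: (scc_comp nf s1)|exact: (scc_comp nf s2)].
Qed.

Lemma two_sided_affine (a b : R) (W : normedModType R) (f : W -> R) w :
  two_sided f w -> two_sided (fun x => a + b * f x) w.
Proof.
move=> [sf snf].
have gen c : scc (fun x => c * f x) w.
  have [c0|/ltW c0] := leP 0 c; first exact: scc_scale.
  have nc : 0 <= - c by rewrite oppr_ge0.
  apply: scc_near (scc_scale nc snf).
  by exists 1 => // x _; rewrite mulrNN.
split; first by apply: scc_add; [exact: scc_cst|exact: gen].
apply: (@scc_near _ _ _ (fun x => - a + (- b) * f x)).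
  by exists 1 => // x _; rewrite opprD mulNr.
by apply: scc_add; [exact: scc_cst|exact: gen].
Qed.

(* Equal to [1] where [|x - w0| <= s], to [0] where [|x - w0| >= 2 s], both
   for the Euclidean norm. *)
Definition cutoff (w0 : V) (s : R) (x : V) : R :=
  1 - posq (1 - posq (2 - sumsq (x - w0) / s ^+ 2)).

Lemma cutoff_two_sided w0 s w : two_sided (cutoff w0 s) w.
Proof.
have s0 : two_sided (fun x => sumsq (x - w0)) w.
  have nb : nice (fun x : V => x - w0) w.
    exists 1, 1; split=> // [x y _ _|x h _ _].
      by rewrite subrBB subrr subr0 mul1r.
    have -> : x + h - w0 + (x - h - w0) = 2 *: (x - w0).
      rewrite addrACA [x + h + _]addrACA subrr addr0 -!mulr2n -mulrnDl.
      by rewrite scaler_nat.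
    by rewrite subrr normr0 mulr_ge0// exprn_ge0.
  by have [s1 s2] := scc_sumsq (w - w0); split; [exact: (scc_comp nb s1)|exact: (scc_comp nb s2)].
have s1 := two_sided_affine 2 (- (s ^+ 2)^-1) s0.
have s2 := two_sided_affine 1 (- 1) (two_sided_comp_posq s1).
have [s3 s4] := two_sided_affine 1 (- 1) (two_sided_comp_posq s2).
have E x : cutoff w0 s x = 1 + - 1 * posq (1 + - 1 * posq (2 + - (s ^+ 2)^-1 * sumsq (x - w0))).
  by rewrite /cutoff !mulN1r mulNr [_^-1 * _]mulrC.
split; [apply: scc_near s3|apply: scc_near s4]; exists 1 => // x _; rewrite E//.
Qed.

Lemma cutoff_ge0 w0 s x : 0 <= cutoff w0 s x.
Proof.
rewrite /cutoff subr_ge0 /posq exprn_ile1// ?le_max ?lexx ?orbT//.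
by rewrite ge_max ler01 andbT gerBl exprn_ge0// le_max lexx orbT.
Qed.

Lemma cutoff_le1 w0 s x : cutoff w0 s x <= 1.
Proof. by rewrite /cutoff gerBl exprn_ge0// le_max lexx orbT. Qed.

Lemma cutoff_eq0 w0 s x : 0 < s -> 2 * s < `|x - w0| -> cutoff w0 s x = 0.
Proof.
move=> s0 h; have := norm_sumsq (x - w0); set S := sumsq _ => hS.
have : 2 <= S / s ^+ 2.
  rewrite ler_pdivlMr ?exprn_gt0//; apply: le_trans hS.
  have : (2 * s) ^+ 2 <= `|x - w0| ^+ 2 by rewrite lerXn2r ?nnegrE ?mulr_ge0// ltW.
  by rewrite exprMn; have := sqr_ge0 s; lra.
move=> h2; rewrite /cutoff -/S; have -> : posq (2 - S / s ^+ 2) = 0.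
  by rewrite /posq max_r ?expr0n//; lra.
by rewrite subr0 /posq max_l// expr1n subrr.
Qed.

Lemma cutoff_eq1 w0 s x : 0 < s -> sumsq (x - w0) <= s ^+ 2 -> cutoff w0 s x = 1.
Proof.
move=> s0 h; have : sumsq (x - w0) / s ^+ 2 <= 1 by rewrite ler_pdivrMr ?exprn_gt0// mul1r.
set a := _ / _ => a1; rewrite /cutoff -/a.
have p1 : 1 <= posq (2 - a).
  by rewrite /posq exprn_ege1// le_max; apply/orP; left; lra.
by rewrite [posq (1 - _)]/posq max_r ?expr0n ?subr0//=; lra.
Qed.

Lemma cutoff_near1 w0 s : 0 < s -> exists2 e : R, 0 < e & forall x, `|x - w0| < e -> cutoff w0 s x = 1.
Proof.
move=> s0; have p : 0 < n%:R + 1 :> R by rewrite ltr_wpDl.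
exists (s / (n%:R + 1)); first by rewrite divr_gt0.
move=> x; rewrite ltr_pdivlMr// => h; apply: cutoff_eq1 => //.
apply: le_trans (sumsq_norm _) _.
have : (`|x - w0| * (n%:R + 1)) ^+ 2 <= s ^+ 2.
  by rewrite lerXn2r ?nnegrE ?mulr_ge0 ?(ltW s0) ?(ltW p)// ltW.
apply: le_trans; rewrite exprMn mulrC ler_wpM2l ?exprn_ge0//.
have : 0 <= n%:R :> R by []. nra.
Qed.

End Bump.

(** * Insertion inside one chart *)

Section ManifoldInsertion.
Context {R : realType} {n : nat} {M : topologicalType}.
Variable A : set (chart M 'rV[R]_n).
Hypothesis sA : smooth_structure A.
Hypothesis hM : hausdorff_space M.
Local Notation V := 'rV[R]_n.
Implicit Types (p q : chart M V) (f g : M -> R) (w : V).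

Lemma compact_rV_ball (w0 : V) (r : R) : compact [set w : V | `|w - w0| <= r].
Proof.
apply: bounded_closed_compact.
  exists (`|w0| + r); split; first exact: num_real.
  move=> a ar w /= wr; apply: le_trans (ltW ar).
  by have := ler_normD (w - w0) w0; rewrite subrK; lra.
rewrite (_ : mkset _ = closed_ball_ Num.norm w0 r); last first.
  by apply/seteqP; split => w /=; rewrite distrC.
exact: closed_closed_ball_.
Qed.

Lemma compact_chart_ball p (w0 : V) (r : R) : is_chart p ->
  (forall w, `|w - w0| <= r -> cimg p w) -> compact (cinv p @` [set w : V | `|w - w0| <= r]).
Proof.
move=> [_ _ _ _ ci] sub; apply: continuous_compact; last exact: compact_rV_ball.
apply: continuous_in_subspaceT => w; rewrite inE/= => /sub; exact: ci.
Qed.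

Definition ext0 p (h : V -> R) (z : M) : R := if `[< cdom p z >] then h (cmap p z) else 0.

(** The image of the closed ball is compact, hence closed because [M] is Hausdorff; so the extension
    vanishes on a neighbourhood of each point outside the domain of [p]. *)
Lemma ext0_mscc p (h : V -> R) (w0 : V) (r : R) : A p ->
  (forall w, `|w - w0| <= r -> cimg p w) -> (forall w, r < `|w - w0| -> h w = 0) ->
  (forall w, scc h w) -> forall z, mscc_at A (ext0 p h) z.
Proof.
move=> Ap sub h0 sh z; have cp := atlas_chart sA Ap; have [od _ K _ _] := cp.
have [pz|pz] := pselect (cdom p z).
  apply: (mscc_atI sA Ap pz); apply: scc_near (sh _).
  have [e e0 he] := chart_ball cp pz (@filterT _ _ _).
  exists e => // w /he[/(cimg_inv cp)[d wK] _].
  by rewrite /ext0/= asboolT// wK.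
pose B := cinv p @` [set w : V | `|w - w0| <= r].
have cB : closed B by apply: compact_closed => //; exact: compact_chart_ball.
have nB : ~ B z.
  by move=> [w /= /sub/(cimg_inv cp)[dw _] wz]; apply: pz; rewrite -wz.
have : nbhs z (~` B) by apply: open_nbhs_nbhs; split => //; exact: closed_openC.
move=> nz; apply: (mscc_at_near sA) (@mscc_at_cst _ _ _ A 0 z).
apply: filterS nz => y nBy; rewrite /ext0; case: asboolP => // py.
apply: h0; rewrite ltNge; apply/negP => yr; apply: nBy.
by exists (cmap p y) => //; rewrite K.
Qed.

Lemma scc_uniform (G : V -> R) (w0 : V) (r : R) : 0 < r -> (forall w, scc G w) ->
  (forall w, r < `|w - w0| -> G w = 0) ->
  exists2 C, 0 <= C & forall x h, G (x + h) + G (x - h) - 2 * G x <= C * `|h| ^+ 2.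
Proof.
(* With the margin [1], a centre outside this ball sees only zeros for increments of norm at most
   [1]. *)
move=> r0 sG G0; pose K := [set w : V | `|w - w0| <= r + 1].
pose P (N : nat) (x : V) := `|G x| <= N%:R /\ forall h, `|h| * N.+1%:R <= 1 ->
  G (x + h) + G (x - h) - 2 * G x <= N%:R * `|h| ^+ 2.
have [||N hN] := @compact_uniform_nat _ K P (@compact_rV_ball w0 (r + 1)).
- move=> N N' x NN [b1 b2]; split; first by apply: le_trans b1 _; rewrite ler_nat.
  move=> h hN; apply: le_trans (b2 h _) _; last by rewrite ler_wpM2r ?exprn_ge0// ler_nat.
  by apply: le_trans hN; rewrite ler_wpM2l// ler_nat ltnS.
- move=> x _; have [C [e [C0 e0 b _ sd]]] := sG x.
  have e20 : 0 < e / 2 by rewrite divr_gt0.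
  have [N CN small] := exists_nat_small C0 e20; exists N.
  apply/nbhs_ballP; exists (e / 2) => // z; rewrite -ball_normE/= distrC => zx.
  split; first by apply: le_trans (b _ _) CN; lra.
  move=> h /small he.
  apply: le_trans (sd _ _ _ _) _; last by rewrite ler_wpM2r ?exprn_ge0.
    by rewrite addrAC; apply: le_lt_trans (ler_normD _ _) _; lra.
  by rewrite addrAC; apply: le_lt_trans (ler_normB _ _) _; lra.
have Gb w : `|G w| <= N%:R.
  have [wr|wr] := leP `|w - w0| (r + 1); first exact: (hN _ wr).1.
  by rewrite G0 ?normr0//; lra.
(* The second term is for increments longer than [1 / (N + 1)]: the second difference is at most
   [4 N] by the bound on [G], which [4 N (N + 1) ^+ 2 |h| ^+ 2] dominates. *)
pose C : R := N%:R + 4 * N%:R * N.+1%:R ^+ 2.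
have C0 : 0 <= C by rewrite addr_ge0// mulr_ge0 ?exprn_ge0// mulr_ge0.
exists C => // x h.
have big : 1 < `|h| * N.+1%:R -> G (x + h) + G (x - h) - 2 * G x <= C * `|h| ^+ 2.
  move=> hN1; have : 1 <= (`|h| * N.+1%:R) ^+ 2 by rewrite exprn_ege1// ltW.
  rewrite exprMn => q.
  have := Gb (x + h); have := Gb (x - h); have := Gb x; rewrite !ler_norml.
  have : 4 * N%:R * 1 <= 4 * N%:R * (`|h| ^+ 2 * N.+1%:R ^+ 2) by rewrite ler_wpM2l ?mulr_ge0.
  have : 0 <= N%:R * `|h| ^+ 2 by rewrite mulr_ge0 ?exprn_ge0.
  by rewrite /C; lra.
have [hs|/big//] := leP (`|h| * N.+1%:R) 1.
have [xr|xr] := leP `|x - w0| (r + 1).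
  apply: le_trans ((hN _ xr).2 _ hs) _; rewrite ler_wpM2r ?exprn_ge0//.
  by rewrite /C lerDl mulr_ge0 ?exprn_ge0// mulr_ge0.
have h1 : `|h| <= 1.
  apply: le_trans hs; rewrite ler_peMr// ler1n//.
have far y : `|y| <= 1 -> G (x + y) = 0.
  move=> y1; apply: G0; have := ler_normB (x + y - w0) y.
  by rewrite addrAC addrK; lra.
have -> : G x = 0 by rewrite -[x]addr0 far// normr0.
by rewrite !far ?normrN// addr0 mulr0 subr0 mulr_ge0 ?exprn_ge0.
Qed.

Lemma insertion_chart p (w0 : V) (r : R) (f g : M -> R) : A p -> 0 < r ->
  (forall w, `|w - w0| <= r -> cimg p w) -> (forall z, f z <= g z) ->
  (forall z, ~ cdom p z \/ r < `|cmap p z - w0| -> f z = 0 /\ g z = 0) ->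
  (forall z, mscc_at A (fun y => - f y) z) -> (forall z, mscc_at A g z) ->
  exists h : M -> R, [/\ forall z, f z <= h z <= g z,
    forall z, f z < g z -> f z < h z < g z,
    forall z, mscc_at A h z & forall z, mscc_at A (fun y => - h y) z].
Proof.
move=> Ap r0 sub fg supp sf sg; have cp := atlas_chart sA Ap; have [_ _ Kp _ _] := cp.
pose res (u : M -> R) w : R := if `[< cimg p w >] then u (cinv p w) else 0.
have resE u z : cdom p z -> res u (cmap p z) = u z.
  by move=> pz; rewrite /res asboolT ?Kp//; exists z.
have res0 (u : M -> R) : (forall z, ~ cdom p z \/ r < `|cmap p z - w0| -> u z = 0) ->
    forall w, r < `|w - w0| -> res u w = 0.
  move=> u0 w rw; rewrite /res; case: asboolP => // iw.
  by have [dw wK] := cimg_inv cp iw; apply: u0; right; rewrite wK.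
have ress (u : M -> R) : (forall z, ~ cdom p z \/ r < `|cmap p z - w0| -> u z = 0) ->
    (forall z, mscc_at A u z) -> forall w, scc (res u) w.
  move=> u0 su w; have [rw|rw] := ltP r `|w - w0|.
    apply: scc_near (scc_cst 0 w); exists (`|w - w0| - r); first by rewrite subr_gt0.
    move=> x xw; apply: res0 => //; have := ler_distD x w w0.
    by rewrite [`|w - x|]distrC; lra.
  have [dw wK] := cimg_inv cp (sub _ rw).
  have := su _ p Ap dw; rewrite wK; apply: scc_near.
  have [e e0 he] := chart_ball cp dw (@filterT _ _ _).
  by exists e => // x; rewrite -{1}wK => /he[ix _]; rewrite /res asboolT.
pose nf y := - f y.
have nf0 z : ~ cdom p z \/ r < `|cmap p z - w0| -> nf z = 0.
  by move=> /supp[f0 _]; rewrite /nf f0 oppr0.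
have g0 z : ~ cdom p z \/ r < `|cmap p z - w0| -> g z = 0 by move=> /supp[].
have sF := ress _ nf0 sf; have sG := ress _ g0 sg.
have [C C0 hC] := scc_uniform r0 sG (res0 _ g0).
have [D D0 hD] := scc_uniform r0 sF (res0 _ nf0).
pose F w := - res nf w; pose G := res g.
have FE w : F w = if `[< cimg p w >] then f (cinv p w) else 0.
  by rewrite /F /res; case: asboolP; rewrite /nf ?opprK// oppr0.
have FG w : F w <= G w by rewrite FE /G /res; case: asboolP.
have cF : continuous (F : V -> R^o).
  move=> w; apply: (@continuousN _ _ _ (res nf : V -> R^o)).
  exact: scc_continuous (sF w).
have cG : continuous (G : V -> R^o) by move=> w; exact: scc_continuous (sG w).
have [||H [H1 H2 H3]] := insertion (@sumsq_ge0 R n) (@sumsq_par R n) (@norm_sumsq R n) FG D0 C0 cF cG.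
- move=> x h; have := hD x h; rewrite /F.
  have : D * `|h| ^+ 2 <= D * sumsq h by rewrite ler_wpM2l// norm_sumsq.
  have : 0 <= D * sumsq h by rewrite mulr_ge0// sumsq_ge0.
  by lra.
- move=> x h; have := hC x h; rewrite /G.
  have : C * `|h| ^+ 2 <= C * sumsq h by rewrite ler_wpM2l// norm_sumsq.
  have : 0 <= C * sumsq h by rewrite mulr_ge0// sumsq_ge0.
  by lra.
(* Squeezed between two functions that vanish, [H] vanishes outside the ball, so its extension by
   zero is regular on all of [M]. *)
have H0 w : r < `|w - w0| -> H w = 0.
  move=> rw; have := H1 w; rewrite /G res0// /F res0// oppr0 => h.
  by apply/eqP; rewrite eq_le andbC.
have tH w : two_sided H w.
  pose c : R := 2 * (D + C + 1) * n%:R.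
  have c0 : 0 <= D + C + 1 by rewrite !addr_ge0.
  have [CF [eF [cF0 eF0 bF _ _]]] := sF w; have [CG [eG [cG0 eG0 bG _ _]]] := sG w.
  pose e := Num.min eF eG; have e0 : 0 < e by rewrite lt_min eF0.
  have c00 : 0 <= c by rewrite /c !mulr_ge0.
  have sd x h : `|H (x + h) + H (x - h) - 2 * H x| <= (c + CF + CG) * `|h| ^+ 2.
    apply: le_trans (H3 x h) _; apply: le_trans (_ : c * `|h| ^+ 2 <= _).
      by rewrite /c -[leRHS]mulrA ler_wpM2l ?mulr_ge0// sumsq_norm.
    by rewrite ler_wpM2r ?exprn_ge0// -addrA lerDl addr_ge0.
  have b x : `|x - w| < e -> `|H x| <= c + CF + CG.
    rewrite lt_min => /andP[/bF b1 /bG b2]; have := H1 x; move: b1 b2.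
    by rewrite /F /G !ler_norml; lra.
  split; apply: (@sccI _ _ (c + CF + CG) e) => //.
  - by move=> x h _ _; apply: le_trans (ler_norm _) _.
  - by move=> x /b; rewrite normrN.
  - move=> x h _ _; apply: le_trans (sd x h); rewrite /= -normrN.
    by apply: le_trans (ler_norm _); lra.
have E z : f z <= ext0 p H z <= g z /\ (f z < g z -> f z < ext0 p H z < g z).
  rewrite /ext0; case: asboolP => pz; last first.
    by have [-> ->] := supp z (or_introl pz); rewrite lexx ltxx.
  have := H1 (cmap p z); have := H2 (cmap p z); rewrite /G resE// /F resE// /nf opprK.
  by [].
exists (ext0 p H); split.
- by move=> z; have [] := E z.
- by move=> z; have [] := E z.
- by apply: (ext0_mscc Ap sub) => // w; have [] := tH w.
- move=> z; have := @ext0_mscc p (fun w => - H w) w0 r Ap sub.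
  have h0 w : r < `|w - w0| -> - H w = 0 by move=> /H0 ->; rewrite oppr0.
  move=> /(_ h0 (fun w => (tH w).2) z); congr (mscc_at A _ z); apply/funext => y.
  by rewrite /ext0; case: ifP; rewrite ?oppr0.
Qed.

End ManifoldInsertion.

(** * Gluing the insertions over the manifold *)

Section GlobalInsertion.
Context {R : realType} {n : nat} {M : topologicalType}.
Variable A : set (chart M 'rV[R]_n).
Hypothesis mA : smooth_manifold A.
Let sA := manifold_structure mA.
Let hM := manifold_hausdorff mA.
Local Notation V := 'rV[R]_n.
Implicit Types (f g : M -> R).

Definition mtwo f z := mscc_at A f z /\ mscc_at A (fun y => - f y) z.

Lemma mscc_at_ext f g z : f =1 g -> mscc_at A g z -> mscc_at A f z.
Proof. by move=> /funext ->. Qed.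

Lemma mtwo_mul f g z : (forall y, 0 <= f y) -> mtwo f z -> mtwo g z ->
  mtwo (fun y => f y * g y) z.
Proof.
move=> f0 [sf nf] [sg ng]; split; first exact: mscc_at_mul.
apply: (@mscc_at_ext _ (fun y => f y * - g y)); last exact: mscc_at_mul.
by move=> y; rewrite mulrN.
Qed.

Lemma mtwo_1B f z : mtwo f z -> mtwo (fun y => 1 - f y) z.
Proof.
move=> [sf nf]; split; first by apply: mscc_at_add => //; exact: mscc_at_cst.
apply: (@mscc_at_ext _ (fun y => - 1 + f y)); first by move=> y; rewrite opprB addrC.
by apply: mscc_at_add => //; exact: mscc_at_cst.
Qed.

Lemma manifold_bump x (N : set M) : nbhs x N -> exists p r (b : M -> R),
  [/\ A p, 0 < r, forall w, `|w - cmap p x| <= r -> cimg p w /\ N (cinv p w),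
    forall z, ~ cdom p z \/ r < `|cmap p z - cmap p x| -> b z = 0 &
    [/\ forall z, 0 <= b z <= 1, \forall z \near x, b z = 1 & forall z, mtwo b z]].
Proof.
move=> Nx; have [p Ap px] := atlas_cover sA x; have cp := atlas_chart sA Ap.
have [e e0 he] := chart_ball cp px Nx; pose s := e / 4; have s0 : 0 < s by rewrite divr_gt0.
have [_ _ K _ _] := cp; pose w0 := cmap p x.
have sub w : `|w - w0| <= 2 * s -> cimg p w /\ N (cinv p w).
  by move=> h; apply: he; move: h; rewrite /s; lra.
have sub' w : `|w - w0| <= 2 * s -> cimg p w by move=> /sub[].
exists p, (2 * s), (ext0 p (cutoff w0 s)); split=> //; first by rewrite mulr_gt0.
  move=> z [pz|zs]; rewrite /ext0; case: asboolP => // _; exact: cutoff_eq0.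
have b0 w : 2 * s < `|w - w0| -> cutoff w0 s w = 0 by exact: cutoff_eq0.
split.
- by move=> z; rewrite /ext0; case: asboolP; rewrite ?cutoff_ge0 ?cutoff_le1// lexx ler01.
- have [d d0 hd] := @cutoff_near1 R n w0 s s0.
  have : nbhs (cmap p x) [set w | `|w - w0| < d].
    by apply/nbhs_ballP; exists d => // w; rewrite -ball_normE/= distrC.
  move=> /(chart_nbhs cp px); apply: filterS => z [pz /= /hd h].
  by rewrite /ext0 asboolT.
- move=> z; split; first by apply: (ext0_mscc sA hM Ap sub' b0) => w; have [] := cutoff_two_sided w0 s w.
  apply: (@mscc_at_ext _ (ext0 p (fun w => - cutoff w0 s w))).
    by move=> y; rewrite /ext0; case: ifP; rewrite ?oppr0.
  apply: (ext0_mscc sA hM Ap sub') => [w /b0->|w]; first by rewrite oppr0.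
  by have [] := cutoff_two_sided w0 s w.
Qed.

(** Insertion is compatible with a partition of unity: each pair [chi i * f], [chi i * g] is
    supported in one chart, and the sum of the inserted functions is strict where [f < g] because
    some [chi k] is positive there. *)
Lemma insertion_manifold f g : (forall z, f z <= g z) ->
  (forall z, mscc_at A (fun y => - f y) z) -> (forall z, mscc_at A g z) ->
  exists h : M -> R, [/\ forall z, f z <= h z <= g z,
    forall z, f z < g z -> f z < h z < g z & forall z, mtwo h z].
Proof.
move=> fg sf sg; have [[x0 _]|M0] := pselect ([set: M] !=set0); last first.
  by exists f; split=> z; case: M0; exists z.
have [U bU] := second_countable_base (manifold_second_countable mA).
pose P x (t : chart M V * R * (M -> R)) := [/\ A t.1.1, 0 < t.1.2,
      forall w, `|w - cmap t.1.1 x| <= t.1.2 -> cimg t.1.1 w,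
      forall z, ~ cdom t.1.1 z \/ t.1.2 < `|cmap t.1.1 z - cmap t.1.1 x| -> t.2 z = 0 &
      [/\ forall z, 0 <= t.2 z <= 1, \forall z \near x, t.2 z = 1 &
          forall z, mtwo t.2 z]].
have [B hB] : {B : M -> chart M V * R * (M -> R) & forall x, P x (B x)}.
  apply: choice => x; have [p [r [b [h1 h2 h3 h4 h5]]]] := manifold_bump (@filterT _ (nbhs x) _).
  by exists (p, r, b); split=> // w /h3[].
(* Requiring the value [1] on a neighbourhood, and not just at a point, makes the sums below locally
   finite. *)
have Bn x : setT x -> nbhs x [set z | \forall y \near z, (B x).2 y = 1].
  by move=> _; have [_ _ _ _ [_ h _]] := hB x; exact: nbhs_interior h.
have [s [_ hs]] := lindelof bU (I : setT x0) Bn.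
pose b i := (B (s i)).2.
have b01 i z : 0 <= b i z <= 1 by have [_ _ _ _ [h _ _]] := hB (s i); exact: h.
have bt i z : mtwo (b i) z by have [_ _ _ _ [_ _ h]] := hB (s i); exact: h.
(* [rest i] is the product of the [1 - b j] with [j < i]; sums of [chi] telescope to [1 - rest], and
   the terms after an index with [b i z = 1] vanish. *)
pose fix rest (i : nat) (z : M) {struct i} : R := if i is j.+1 then rest j z * (1 - b j z) else 1.
pose chi i z := rest i z * b i z.
have rest0 i z : 0 <= rest i z.
  by elim: i => //= i IH; rewrite mulr_ge0// subr_ge0; case/andP: (b01 i z).
have chi0 i z : 0 <= chi i z by rewrite mulr_ge0//; case/andP: (b01 i z).
have restt i z : mtwo (rest i) z.
  elim: i => [|i IH]; first by split; [exact: (@mscc_at_cst _ _ _ A 1 z)|exact: (@mscc_at_cst _ _ _ A (- 1) z)].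
  by apply: (@mtwo_mul (rest i) (fun y => 1 - b i y)) => //; exact: mtwo_1B.
have chit i z : mtwo (chi i) z by exact: mtwo_mul.
have chisum m z : \sum_(i < m) chi i z = 1 - rest m z.
  elim: m => [|m IH]; first by rewrite big_ord0 subrr.
  by rewrite big_ord_recr/= IH /chi; ring.
have rest_eq0 i j z : b i z = 1 -> (i < j)%N -> rest j z = 0.
  move=> bi; elim: j => // j IH; rewrite ltnS leq_eqVlt => /orP[/eqP<-/=|/IH/= ->].
    by rewrite bi subrr mulr0.
  by rewrite mul0r.
have loc i : exists h : M -> R, [/\ forall z, chi i z * f z <= h z <= chi i z * g z,
    forall z, chi i z * f z < chi i z * g z -> chi i z * f z < h z < chi i z * g z &
    forall z, mtwo h z].
  have [h1 h2 h3 h4 _] := hB (s i).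
  have [||||h [k1 k2 k3 k4]] := @insertion_chart _ _ _ _ sA hM (B (s i)).1.1 (cmap (B (s i)).1.1 (s i))
    (B (s i)).1.2 (fun z => chi i z * f z) (fun z => chi i z * g z) h1 h2 h3.
  - by move=> z; rewrite ler_wpM2l.
  - by move=> z /h4 bz; rewrite /chi /b bz mulr0 !mul0r.
  - move=> z; apply: (@mscc_at_ext _ (fun y => chi i y * - f y)).
      by move=> y; rewrite mulrN.
    by have [c1 c2] := chit i z; exact: mscc_at_mul.
  - by move=> z; have [c1 c2] := chit i z; exact: mscc_at_mul.
  by exists h; split.
have [H hH] := choice loc.
have Heq0 i j z : b i z = 1 -> (i < j)%N -> H j z = 0.
  move=> bi ij; have [/(_ z) + _ _] := hH j.
  by rewrite /chi (rest_eq0 i)// !mul0r => h; apply/eqP; rewrite eq_le andbC.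
have Hsum i m z : b i z = 1 -> (i < m)%N -> \sum_(j < m) H j z = \sum_(j < i.+1) H j z.
  move=> bi; elim: m => // m IH; rewrite ltnS leq_eqVlt => /orP[/eqP->//|im].
  by rewrite big_ord_recr/= IH// (Heq0 i)// addr0.
have [N hN] : {N : M -> nat & forall z, b (N z) z = 1}.
  by apply: (@choice _ _ (fun z i => b i z = 1)) => z; have [i /nbhs_singleton] := hs z I; exists i.
(* The index [N z] may jump with [z]; by [vE] the value is nevertheless that of one fixed finite sum
   near each point. *)
pose v z := \sum_(j < (N z).+1) H j z.
have vE i z : b i z = 1 -> v z = \sum_(j < i.+1) H j z.
  move=> bi; rewrite -(Hsum i (maxn i (N z)).+1)// ?ltnS ?leq_maxl//.
  by rewrite (Hsum (N z))// ltnS leq_maxr.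
have chi1 z : \sum_(j < (N z).+1) chi j z = 1.
  by rewrite chisum (rest_eq0 (N z)) ?subr0.
have vb z : f z <= v z <= g z.
  have E (u : M -> R) : u z = \sum_(j < (N z).+1) chi j z * u z.
    by rewrite -mulr_suml chi1 mul1r.
  rewrite (E f) (E g) /v; apply/andP; split; apply: ler_sum => j _;
    by have [/(_ z)/andP[]] := hH j.
exists v; split=> // [z fgz|z].
  have [k kN ck] : exists2 k, (k < (N z).+1)%N & 0 < chi k z.
    apply/not_exists2P => hk; have := chi1 z; rewrite big1 => [/esym/eqP|j _].
      by rewrite oner_eq0.
    have [h|h] := hk j; first by case: h.
    by apply/eqP; rewrite eq_le chi0 andbT leNgt; exact/negP.
  have [_ /(_ z) + _] := hH k; rewrite ltr_pM2l// => /(_ fgz) /andP[l1 l2].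
  have E (u : M -> R) : u z = \sum_(j < (N z).+1) chi j z * u z.
    by rewrite -mulr_suml chi1 mul1r.
  have Ef := E f; have Eg := E g.
  rewrite (bigD1 (Ordinal kN))//= in Ef; rewrite (bigD1 (Ordinal kN))//= in Eg.
  have Ev : v z = H k z + \sum_(j < (N z).+1 | j != Ordinal kN) H j z.
    by rewrite /v (bigD1 (Ordinal kN)).
  rewrite Ef Eg Ev; apply/andP; split.
    by apply: ltr_leD => //; apply: ler_sum => j _; have [/(_ z)/andP[]] := hH j.
  by apply: ltr_leD => //; apply: ler_sum => j _; have [/(_ z)/andP[]] := hH j.
have [i bi] := hs z I; have near_v : \forall y \near z, v y = \sum_(j < i.+1) H j y.
  by apply: filterS bi => y; exact: vE.
split.
  apply: (mscc_at_near sA near_v); apply: mscc_at_sum => j _.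
  by have [_ _ /(_ z)[]] := hH j.
apply: (@mscc_at_near _ _ _ _ sA _ (fun y => \sum_(j < i.+1) - H j y)).
  by apply: filterS near_v => y ->; rewrite sumrN.
apply: (@mscc_at_sum _ _ _ _ (fun j y => - H j y)) => j _.
by have [_ _ /(_ z)[]] := hH j.
Qed.

End GlobalInsertion.

(** * Primitives and reparametrizations on the line *)

Section RealCurves.
Context {R : realType}.

Lemma primitive_integral (s F : R -> R) : continuous s ->
  (forall t : R, 0 <= t <= 1 -> is_derive t 1 F (s t)) ->
  \int[lebesgue_measure]_(t in `[0, 1]) s t = F 1 - F 0.
Proof.
move=> cs dF; rewrite /Rintegral (@continuous_FTC2 _ s F 0 1 ltr01)//.
- exact: continuous_subspaceT.
- have cF (t : R) : 0 <= t <= 1 -> {for t, continuous F}.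
    by move=> /dF[dt _]; apply: differentiable_continuous; apply/derivable1_diffP.
  split.
  + by move=> x; rewrite in_itv/= => /andP[x0 x1]; have [] := dF x _; rewrite ?ltW//= ltW.
  + by apply: cvg_at_right_filter; apply: cF; rewrite lexx ler01.
  + by apply: cvg_at_left_filter; apply: cF; rewrite lexx ler01.
- move=> x; rewrite in_itv/= => /andP[x0 x1]; rewrite derive1E.
  have x01 : 0 <= x <= 1 by rewrite !ltW.
  by have [_ ->] := dF x x01.
Qed.

Lemma continuous_primitive (s : R -> R) : continuous s -> exists F : R -> R,
  (forall t : R, 0 <= t <= 1 -> is_derive t 1 F (s t)) /\
  \int[lebesgue_measure]_(t in `[0, 1]) s t = F 1 - F 0.
Proof.
(* Integrating from [-1], with integrability up to [2], gives two-sided derivatives at both ends of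
   [[0, 1]]. *)
move=> cs; pose F x := \int[lebesgue_measure]_(t in `[-1, x]) s t.
have ints : lebesgue_measure.-integrable `[-1, 2 : R] (EFin \o s).
  apply: continuous_compact_integrable; first exact: segment_compact.
  exact: continuous_subspaceT.
have dF (t : R) : 0 <= t <= 1 -> is_derive t 1 F (s t).
  move=> t01; have t1 : -1 < t by lra.
  have t2 : t < 2 by lra.
  have [d1 d2] := continuous_FTC1_closed t2 ints t1 (cs t).
  by apply: DeriveDef => //; rewrite -derive1E.
by exists F; split=> //; exact: primitive_integral.
Qed.

Lemma is_derive_comp (W : normedModType R) (f : R -> W) (s : R -> R) (t ds : R) (df : W) :
  is_derive t 1 s ds -> is_derive (s t) 1 f df -> is_derive t 1 (f \o s) (ds *: df).
Proof.
move=> [d1 e1] [d2 e2].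
have D1 : differentiable s t by apply/derivable1_diffP.
have D2 : differentiable f (s t) by apply/derivable1_diffP.
apply: DeriveDef; first by apply/derivable1_diffP; exact: differentiable_comp.
rewrite deriveE; last exact: differentiable_comp.
have E1 : 'd s t 1 = ds by rewrite -deriveE.
rewrite diff_comp//= E1 -e2 deriveE//.
by rewrite -[in LHS](mulr1 ds) -[ds * 1]/(ds *: (1 : R^o)) linearZ.
Qed.

Definition dposq (t : R) : R := 2 * Num.max t 0.

Lemma is_derive_posq (t : R) : is_derive t 1 (@posq R) (dposq t).
Proof.
apply/is_derive_normP => d d0; exists d => // h h0 hd.
rewrite [h *: 1]mulr1 -[h^-1 *: _]/(h^-1 * _).
have -> : dposq t - h^-1 * (posq (t + h) - posq t) =
    - (h^-1 * (posq (t + h) - posq t - dposq t * h)) by field.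
rewrite normrN normrM normfV ler_pdivrMl ?normr_gt0//.
apply: le_trans (_ : `|h| ^+ 2 <= _); last by rewrite expr2 ler_wpM2l// ltW.
rewrite real_normK ?num_real// /posq /dposq /Num.max ler_norml.
by case: ltP => h1; case: ltP => h2; apply/andP; split; nra.
Qed.

Lemma continuous_dposq : continuous dposq.
Proof.
move=> t; apply: (@lipschitz_continuous R R^o R^o); exists 2, 1; split=> // x _.
rewrite /dposq -mulrBr normrM ger0_norm// ler_wpM2l//.
have A := ler_norm (x - t); have B := ler_norm (t - x); rewrite distrC in B.
by rewrite /Num.max ler_norml; case: ltP => h1; case: ltP => h2; lra.
Qed.

Lemma posq_ge0 (t : R) : 0 <= posq t.
Proof. by rewrite /posq exprn_ge0// le_max lexx orbT. Qed.

Lemma posq_le0 (t : R) : t <= 0 -> posq t = 0.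
Proof. by move=> t0; rewrite /posq max_r// expr0n. Qed.

Lemma posq1 : posq 1 = 1 :> R. Proof. by rewrite /posq max_l// expr1n. Qed.

Lemma dposq_ge0 t : 0 <= dposq t.
Proof. by rewrite /dposq mulr_ge0// le_max lexx orbT. Qed.

(* A [C^1] reparametrization of [0, 1]: nondecreasing from [0] to [1],
   constant outside of [[0, 1]]. *)
Definition smoothstep (t : R) : R := 1 - posq (1 - posq t).
Definition dsmoothstep (t : R) : R := dposq (1 - posq t) * dposq t.

Lemma smoothstep0 : smoothstep 0 = 0.
Proof. by rewrite /smoothstep (posq_le0 (lexx 0)) subr0 posq1 subrr. Qed.

Lemma smoothstep1 : smoothstep 1 = 1.
Proof. by rewrite /smoothstep posq1 subrr (posq_le0 (lexx 0)) subr0. Qed.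

Lemma smoothstep_ge0 t : 0 <= smoothstep t.
Proof.
rewrite /smoothstep subr_ge0 {1}/posq exprn_ile1// ?le_max ?lexx ?orbT//.
by rewrite ge_max ler01 andbT gerBl posq_ge0.
Qed.

Lemma smoothstep_le1 t : smoothstep t <= 1.
Proof. by rewrite /smoothstep gerBl posq_ge0. Qed.

Lemma is_derive_affine (a b t : R) : is_derive t 1 (fun x => a + b * x) b.
Proof.
apply/is_derive_normP => d d0; exists 1 => // h h0 _.
rewrite [h *: 1]mulr1 -[h^-1 *: _]/(h^-1 * _) (_ : _ - _ = 0) ?normr0 ?ltW//.
by field.
Qed.

Lemma is_derive_smoothstep (t : R) : is_derive t 1 smoothstep (dsmoothstep t).
Proof.
have h1 := is_derive_comp (is_derive_posq t) (is_derive_affine 1 (- 1) (posq t)).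
have h2 := is_derive_comp h1 (is_derive_posq _).
have h3 := is_derive_comp h2 (is_derive_affine 1 (- 1) _).
have E : smoothstep = (fun x => 1 + - 1 * x) \o (@posq R \o ((fun x => 1 + - 1 * x) \o @posq R)).
  by apply/funext => x; rewrite /smoothstep/= !mulN1r.
rewrite E; apply: is_derive_eq h3 _; rewrite /= mulN1r /dsmoothstep.
rewrite -![_ *: _]/(_ * _); ring.
Qed.

Lemma continuous_posq : continuous (@posq R).
Proof.
move=> t; apply: differentiable_continuous; apply/derivable1_diffP.
by have [] := is_derive_posq t.
Qed.

Lemma continuous_dsmoothstep : continuous dsmoothstep.
Proof.
move=> t; apply: cvgM; last exact: continuous_dposq.
apply: (@continuous_comp _ _ _ (fun x => 1 - posq x) dposq); last exact: continuous_dposq.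
by apply: cvgB; [exact: cvg_cst|exact: continuous_posq].
Qed.

Lemma dsmoothstep_ge0 t : 0 <= dsmoothstep t.
Proof. by rewrite mulr_ge0// dposq_ge0. Qed.

End RealCurves.

(** * Curves, speed and length *)

Section Curves.
Context {R : realType} {n : nat} {M : topologicalType}.
Variable A : set (chart M 'rV[R]_n).
Variable g : chart M 'rV[R]_n -> M -> 'rV[R]_n -> 'rV[R]_n -> R.
Hypothesis sA : smooth_structure A.
Hypothesis gA : riemannian_metric A g.
Local Notation V := 'rV[R]_n.
Implicit Types (p q : chart M V) (gam : R -> M).

Lemma metricE p x (u v : V) : A p -> cdom p x -> g p x u v =
  \sum_(i < n) \sum_(j < n) u 0 i * v 0 j * g p x (delta_mx 0 i) (delta_mx 0 j).
Proof.
move=> Ap px.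
have lin (w : V) (a : R) (v1 v2 : V) := metric_linear gA w a v1 v2 Ap px.
have g0 w : g p x w 0 = 0.
  by have := lin w 1 0 0; rewrite scaler0 addr0 mul1r => h; lra.
have exp w z : g p x w z = \sum_(j < n) z 0 j * g p x w (delta_mx 0 j).
  rewrite {1}(row_sum_delta z).
  have S (r : seq 'I_n) : g p x w (\sum_(j <- r) z 0 j *: delta_mx 0 j) =
      \sum_(j <- r) z 0 j * g p x w (delta_mx 0 j).
    by elim: r => [|j r IH]; rewrite ?big_nil// !big_cons lin IH.
  exact: S.
rewrite exp exchange_big/=; apply: eq_bigr => j _.
rewrite (Defs.metric_sym gA _ _ Ap px) exp big_distrr/=; apply: eq_bigr => i _.
by rewrite (Defs.metric_sym gA (delta_mx 0 j) _ Ap px); ring.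
Qed.

Lemma metricZ p x (a : R) (u : V) : A p -> cdom p x ->
  g p x (a *: u) (a *: u) = a ^+ 2 * g p x u u.
Proof.
move=> Ap px; rewrite !metricE// big_distrr/=; apply: eq_bigr => i _.
by rewrite big_distrr/=; apply: eq_bigr => j _; rewrite !mxE; ring.
Qed.

Lemma metric_ge0 p x (u : V) : A p -> cdom p x -> 0 <= g p x u u.
Proof.
move=> Ap px; have [->|u0] := eqVneq u 0.
  by have := @metricZ p x 0 0 Ap px; rewrite scale0r expr0n/= mul0r => ->.
exact/ltW/(metric_pos gA Ap px).
Qed.

Lemma continuous_sum (X : topologicalType) (m : nat) (F : 'I_m -> X -> R) x :
  (forall i, {for x, continuous (F i)}) -> {for x, continuous (fun y => \sum_(i < m) F i y)}.
Proof.
elim: m F => [|m IH] F cF.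
  rewrite (_ : (fun _ => _) = cst 0); first exact: cst_continuous.
  by apply/funext => y; rewrite big_ord0.
rewrite (_ : (fun _ => _) = (fun y => \sum_(i < m) F (widen_ord (leqnSn m) i) y + F ord_max y)).
  by apply: cvgD; [exact: IH|exact: cF].
by apply/funext => y; rewrite big_ord_recr.
Qed.

(** [metric_smooth] concerns fixed vectors; expanding over the standard basis extends continuity to
    vectors that move. *)
Lemma continuous_metric (X : topologicalType) p (w v : X -> V) x : A p ->
  (\forall y \near x, cimg p (w y)) ->
  {for x, continuous w} -> {for x, continuous v} ->
  {for x, continuous (fun y => g p (cinv p (w y)) (v y) (v y))}.
Proof.
move=> Ap nw cw cv; have cp := atlas_chart sA Ap.
have ci (i : 'I_n) : {for x, continuous (fun y => v y 0 i)}.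
  exact: (@continuous_comp _ _ _ v (fun z : V => z 0 i) x cv (@coord_continuous R 1 n 0 i (v x))).
have cg (i j : 'I_n) : {for x, continuous (fun y => g p (cinv p (w y)) (delta_mx 0 i) (delta_mx 0 j))}.
  have [cs _] := metric_smooth gA (delta_mx 0 i) (delta_mx 0 j) Ap 0%N.
  exact: (@continuous_comp _ _ _ w (fun z : V => g p (cinv p z) (delta_mx 0 i) (delta_mx 0 j)) x cw
    (cs _ (nbhs_singleton nw))).
pose G y := \sum_(i < n) \sum_(j < n) v y 0 i * v y 0 j *
  g p (cinv p (w y)) (delta_mx 0 i) (delta_mx 0 j).
have cG : {for x, continuous G}.
  apply: continuous_sum => i; apply: continuous_sum => j.
  exact: (cvgM (cvgM (ci i) (ci j)) (cg i j)).
have GE y : cimg p (w y) -> g p (cinv p (w y)) (v y) (v y) = G y.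
  by move=> /(cimg_inv cp)[dw _]; rewrite metricE.
rewrite /prop_for /continuous_at GE; last exact: nbhs_singleton nw.
apply: cvg_trans cG; apply: near_eq_cvg; apply: filterS nw => y /GE; exact.
Qed.

(** A pointwise form of [C1_curve], suited to gluing and reparametrization. *)
Definition C1_at gam t := {for t, continuous gam} /\ forall p, A p -> cdom p (gam t) ->
  derivable (cmap p \o gam) t 1 /\ {for t, continuous (derive1 (cmap p \o gam))}.

Lemma derivable_scale (W : normedModType R) (f : R -> W) (t v : R) : derivable f t 1 ->
  derivable f t v /\ 'D_v f t = v *: derive1 f t.
Proof.
move=> d1; have D : differentiable f t by apply/derivable1_diffP.
split; first exact: diff_derivable.
rewrite derive1E !deriveE// -{1}[v]mulr1 -[v * 1]/(v *: (1 : R^o)).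
by rewrite linearZ.
Qed.

Lemma Ck1_line (W : normedModType R) (f : R -> W) (U : set R) :
  (forall t, U t -> derivable f t 1) -> (forall t, U t -> \forall s \near t, U s) ->
  (forall t, U t -> {for t, continuous (derive1 f)}) -> Ck 1 (U : set R^o) (f : R^o -> W).
Proof.
move=> df nU cf; split=> [t /df d|v].
  by apply: differentiable_continuous; apply/derivable1_diffP.
split=> [t /df/(derivable_scale v)[]|]; first by [].
split=> [t Ut|]; last by [].
rewrite /prop_for /continuous_at (derivable_scale v (df _ Ut)).2.
apply: cvg_trans (cvgZl_tmp (k := v) (cf t Ut)).
apply: near_eq_cvg; apply: filterS (nU _ Ut) => s Us.
by rewrite (derivable_scale v (df _ Us)).2.
Qed.

Lemma near_dom gam p t : A p -> {for t, continuous gam} -> cdom p (gam t) ->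
  \forall s \near t, cdom p (gam s).
Proof.
move=> Ap cg pt; have [op _ _ _ _] := atlas_chart sA Ap.
by apply: cg; exact: open_nbhs_nbhs.
Qed.

Lemma C1_curveP gam : C1_curve A gam <-> forall t, C1_at gam t.
Proof.
split=> [[cg h] t|h].
  split=> [|p Ap pt]; first exact: cg.
  have [_ /(_ 1)[d [c _]]] := h p Ap; split; first exact: d.
  rewrite (_ : derive1 _ = 'D_1 (cmap p \o gam)); first exact: c.
  by apply/funext => s; rewrite derive1E.
have cg : continuous gam by move=> t; exact: (h t).1.
split=> [|p Ap]; first exact: cg.
have h1 t : (gam @^-1` cdom p) t -> derivable (cmap p \o gam) t 1.
  move=> pt; exact: ((h t).2 p Ap pt).1.
have h2 t : (gam @^-1` cdom p) t -> \forall s \near t, (gam @^-1` cdom p) s.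
  exact: near_dom Ap (cg t).
have h3 t : (gam @^-1` cdom p) t -> {for t, continuous (derive1 (cmap p \o gam))}.
  move=> pt; exact: ((h t).2 p Ap pt).2.
exact (Ck1_line h1 h2 h3).
Qed.

Lemma speed_continuous gam s : (forall t, C1_at gam t) -> has_speed A g gam s -> continuous s.
Proof.
move=> h hs t; have [p Ap pt] := atlas_cover sA (gam t).
have cp := atlas_chart sA Ap; have [_ _ K cm _] := cp.
have [cg hg] := h t; have nd := near_dom Ap cg pt.
have [_ cv] := hg p Ap pt.
pose G r := g p (cinv p (cmap p (gam r))) (derive1 (cmap p \o gam) r) (derive1 (cmap p \o gam) r).
have cG : {for t, continuous G}.
  apply: (@continuous_metric _ p (cmap p \o gam)) => //.
    by apply: filterS nd => r pr; exists (gam r).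
  by apply: continuous_comp => //; exact: cm.
have E r : cdom p (gam r) -> s r = Num.sqrt (G r).
  by move=> pr; rewrite (hs r p Ap pr) /G K.
rewrite /prop_for /continuous_at E//.
have c2 : {for t, continuous (fun r => Num.sqrt (G r))}.
  by apply: (@continuous_comp _ _ _ G Num.sqrt) => //; exact: sqrt_continuous.
apply: cvg_trans c2; apply: near_eq_cvg; apply: filterS nd => r pr; exact/esym/E.
Qed.

Lemma speed_ge0 gam s t : has_speed A g gam s -> 0 <= s t.
Proof.
move=> hs; have [p Ap pt] := atlas_cover sA (gam t).
by rewrite (hs t p Ap pt) sqrtr_ge0.
Qed.

(** The length is encoded by a primitive [F] of the speed instead of an integral, so that
    restriction and reparametrization become the chain rule. *)
Definition path_length x y (l : R) := exists gam s F,
  [/\ forall t, C1_at gam t, has_speed A g gam s, gam 0 = x, gam 1 = y &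
   (forall t : R, 0 <= t <= 1 -> is_derive t 1 F (s t)) /\ l = F 1 - F 0].

Lemma path_length_set x y : [set l | exists gam s,
         [/\ C1_curve A gam, gam 0 = x, gam 1 = y, has_speed A g gam s &
             l = \int[lebesgue_measure]_(t in `[0, 1]) s t]] = path_length x y.
Proof.
apply/seteqP; split=> [l [gam [s [/C1_curveP h g0 g1 hs ->]]]|l [gam [s [F [h hs g0 g1 [dF ->]]]]]].
  have [F [dF ->]] := continuous_primitive (speed_continuous h hs).
  by exists gam, s, F; split.
exists gam, s; split=> //; first exact/C1_curveP.
by rewrite (primitive_integral (speed_continuous h hs) dF).
Qed.

Lemma path_length_ge0 x y l : path_length x y l -> 0 <= l.
Proof.
move=> [gam [s [F [h hs _ _ [dF ->]]]]].
rewrite -(primitive_integral (speed_continuous h hs) dF).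
by apply: Rintegral_ge0 => t _; exact: speed_ge0 hs.
Qed.

End Curves.
Section Smoothstep.
Context {R : realType}.

Lemma smoothstep_ge1 (t : R) : 1 <= t -> smoothstep t = 1.
Proof.
move=> t1; rewrite /smoothstep (posq_le0 (t := 1 - posq t)) ?subr0//.
by rewrite subr_le0 /posq exprn_ege1// le_max t1.
Qed.

Lemma smoothstep_le0 (t : R) : t <= 0 -> smoothstep t = 0.
Proof. by move=> t0; rewrite /smoothstep (posq_le0 t0) subr0 posq1 subrr. Qed.

Lemma dsmoothstep_ge1 (t : R) : 1 <= t -> dsmoothstep t = 0.
Proof.
move=> t1; rewrite /dsmoothstep {1}/dposq max_r ?mulr0 ?mul0r//.
by rewrite subr_le0 /posq exprn_ege1// le_max t1.
Qed.

Lemma dsmoothstep_le0 (t : R) : t <= 0 -> dsmoothstep t = 0.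
Proof. by move=> t0; rewrite /dsmoothstep [X in _ * X]/dposq max_r// !mulr0. Qed.

Lemma is_derive_smoothstep_affine (a b t : R) :
  is_derive t 1 (fun x => smoothstep (a + b * x)) (b * dsmoothstep (a + b * t)).
Proof. exact: (is_derive_comp (is_derive_affine a b t) (is_derive_smoothstep _)). Qed.

Lemma is_derive_affine_smoothstep (a b t : R) :
  is_derive t 1 (fun x => a + b * smoothstep x) (b * dsmoothstep t).
Proof.
have := is_derive_comp (is_derive_smoothstep t) (is_derive_affine a b _).
by move=> /is_derive_eq; apply; rewrite mulrC.
Qed.

Lemma continuous_dsmoothstep_affine (a b : R) :
  continuous (fun x => b * dsmoothstep (a + b * x)).
Proof.
move=> t; apply: cvgM; first exact: cvg_cst.
apply: (@continuous_comp _ _ _ (fun x => a + b * x) dsmoothstep); last exact: continuous_dsmoothstep.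
by apply: cvgD; [exact: cvg_cst|apply: cvgM; [exact: cvg_cst|exact: cvg_id]].
Qed.

End Smoothstep.

(** * Reversal, restriction and concatenation of paths *)

Section PathOperations.
Context {R : realType} {n : nat} {M : topologicalType}.
Variable A : set (chart M 'rV[R]_n).
Variable g : chart M 'rV[R]_n -> M -> 'rV[R]_n -> 'rV[R]_n -> R.
Hypothesis sA : smooth_structure A.
Hypothesis gA : riemannian_metric A g.
Local Notation V := 'rV[R]_n.
Implicit Types (p q : chart M V) (gam : R -> M).

Lemma derive1_near (W : normedModType R) (f h : R -> W) (t : R) :
  (\forall s \near t, f s = h s) -> derive1 f t = derive1 h t.
Proof. by move=> fh; rewrite !derive1E; exact: near_eq_derive. Qed.

Lemma derivable_near (W : normedModType R) (f h : R -> W) (t : R) :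
  (\forall s \near t, f s = h s) -> derivable h t 1 -> derivable f t 1.
Proof.
by move=> fh; apply: near_eq_derivable => //; apply: filterS fh => s ->.
Qed.

Lemma C1_at_near gam a (t : R) : (\forall s \near t, gam s = a s) -> C1_at A a t ->
  C1_at A gam t /\ forall p, derive1 (cmap p \o gam) t = derive1 (cmap p \o a) t.
Proof.
move=> ga [ca ha]; have gat := nbhs_singleton ga.
have nn p : \forall s \near t, derive1 (cmap p \o gam) s = derive1 (cmap p \o a) s.
  apply: filterS (nbhs_interior ga) => s hs; apply: derive1_near.
  by apply: filterS hs => r /= ->.
split; last by move=> p; exact: nbhs_singleton (nn p).
split.
  rewrite /prop_for /continuous_at gat; apply: cvg_trans ca.
  by apply: near_eq_cvg; apply: filterS ga => s ->.
move=> p Ap; rewrite gat => pt; have [d c] := ha p Ap pt; split.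
  apply: derivable_near d; apply: filterS ga => s gs; exact: (congr1 (cmap p) gs).
rewrite /prop_for /continuous_at (nbhs_singleton (nn p)); apply: cvg_trans c.
by apply: near_eq_cvg; apply: filterS (nn p) => s ->.
Qed.

Lemma C1_at_cst y (t : R) : C1_at A (fun=> y) t /\ forall p, derive1 (cmap p \o (fun=> y)) t = 0.
Proof.
have E p : cmap p \o (fun=> y) = cst (cmap p y) :> (R -> V) by apply/funext.
have D p : derive1 (cst (cmap p y) : R -> V) = cst 0 by apply/funext => s; exact: derive1_cst.
split; last by move=> p; rewrite E D.
split; first exact: cst_continuous.
by move=> p _ _; rewrite E D; split; [exact: derivable_cst|exact: cst_continuous].
Qed.

Lemma C1_reparam gam (s0 : R -> R) (s ds : R -> R) :
  (forall t, C1_at A gam t) -> has_speed A g gam s0 ->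
  (forall t : R, is_derive t 1 s (ds t)) -> continuous ds ->
  (forall t, C1_at A (gam \o s) t) /\
  has_speed A g (gam \o s) (fun t => s0 (s t) * `|ds t|).
Proof.
move=> h hs dds cds.
have cs : continuous s.
  move=> t; apply: differentiable_continuous; apply/derivable1_diffP.
  by have [] := dds t.
have cgs : continuous (gam \o s).
  by move=> t; apply: continuous_comp; [exact: cs|exact: (h _).1].
have der p (t : R) : A p -> cdom p (gam (s t)) ->
    is_derive t 1 (cmap p \o (gam \o s)) (ds t *: derive1 (cmap p \o gam) (s t)).
  move=> Ap pt; apply: (@is_derive_comp _ _ (cmap p \o gam) s _ _ _ (dds t)).
  apply: DeriveDef; first exact: ((h (s t)).2 p Ap pt).1.
  by rewrite derive1E.
have derE p (t : R) : A p -> cdom p (gam (s t)) ->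
    derive1 (cmap p \o (gam \o s)) t = ds t *: derive1 (cmap p \o gam) (s t).
  by move=> Ap pt; rewrite derive1E; have [_ ->] := der p t Ap pt.
split=> [t|t p Ap pt].
  split; first exact: cgs.
  move=> p Ap pt; split; first exact: (@ex_derive _ _ _ _ _ _ _ (der p t Ap pt)).
  rewrite /prop_for /continuous_at derE//.
  have c2 : {for t, continuous (fun r => ds r *: derive1 (cmap p \o gam) (s r))}.
    apply: cvgZ; first exact: cds.
    apply: (@continuous_comp _ _ _ s (derive1 (cmap p \o gam))); first exact: cs.
    exact: ((h (s t)).2 p Ap pt).2.
  apply: cvg_trans c2; apply: near_eq_cvg.
  apply: filterS (near_dom sA Ap (cgs t) pt) => r pr; exact/esym/derE.
rewrite /= derE// (metricZ gA _ _ Ap pt) (hs (s t) p Ap pt)/= sqrtrM ?sqr_ge0// sqrtr_sqr.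
by rewrite mulrC.
Qed.

Lemma path_length_refl x : path_length A g x x 0.
Proof.
exists (fun=> x), (fun=> 0), (fun=> 0); split=> //.
- by move=> t; have [] := C1_at_cst x t.
- move=> t p Ap px; rewrite /= (C1_at_cst x t).2.
  have := metricZ gA 0 0 Ap px; rewrite scale0r expr0n/= mul0r => ->.
  by rewrite sqrtr0.
- split; last by rewrite subrr.
  by move=> t _; exact: is_derive_cst.
Qed.

Lemma path_length_sym x y l : path_length A g x y l -> path_length A g y x l.
Proof.
move=> [gam [s [F [h hs g0 g1 [dF lE]]]]].
have cm1 : continuous (fun _ : R => - 1 : R) by move=> t; exact: cvg_cst.
have [h' hs'] := C1_reparam h hs (is_derive_affine 1 (- 1)) cm1.
exists (gam \o (fun t => 1 + - 1 * t)), (fun t => s (1 + - 1 * t) * `|- 1|), (fun t => - F (1 + - 1 * t)).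
have E1 : 1 + - 1 * 1 = 0 :> R by lra.
have E0 : 1 + - 1 * 0 = 1 :> R by lra.
split=> //=; rewrite ?E1 ?E0//.
split; last by rewrite lE; lra.
move=> t t01; have t' : 0 <= 1 + - 1 * t <= 1 by lra.
have := is_deriveN (is_derive_comp (is_derive_affine 1 (- 1) t) (dF _ t')).
by move=> /is_derive_eq; apply; rewrite normrN normr1 mulr1 scaleN1r opprK.
Qed.

Lemma path_length_sub x y gam s F (a b : R) :
  (forall t, C1_at A gam t) -> has_speed A g gam s ->
  (forall t : R, 0 <= t <= 1 -> is_derive t 1 F (s t)) ->
  0 <= a -> a <= b -> b <= 1 -> gam a = x -> gam b = y ->
  path_length A g x y (F b - F a).
Proof.
move=> h hs dF a0 ab b1 ga gb.
have cd : continuous (fun t : R => (b - a) * dsmoothstep t).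
  by move=> t; apply: cvgM; [exact: cvg_cst|exact: continuous_dsmoothstep].
have [h' hs'] := C1_reparam h hs (is_derive_affine_smoothstep a (b - a)) cd.
exists (gam \o (fun t => a + (b - a) * smoothstep t)),
  (fun t => s (a + (b - a) * smoothstep t) * `|(b - a) * dsmoothstep t|),
  (fun t => F (a + (b - a) * smoothstep t)).
have E1 : a + (b - a) * smoothstep 1 = b by rewrite smoothstep1; lra.
have E0 : a + (b - a) * smoothstep 0 = a by rewrite smoothstep0; lra.
split=> //=; rewrite ?E1 ?E0//.
split; last by [].
move=> t _; have t' : 0 <= a + (b - a) * smoothstep t <= 1.
  have := smoothstep_ge0 t; have := smoothstep_le1 t => h1 h2.
  by apply/andP; split; nra.
have := is_derive_comp (is_derive_affine_smoothstep a (b - a) t) (dF _ t').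
move=> /is_derive_eq; apply.
have p : 0 <= (b - a) * dsmoothstep t by rewrite mulr_ge0 ?subr_ge0// dsmoothstep_ge0.
by rewrite (ger0_norm p) [RHS]mulrC.
Qed.

Lemma path_length_trans x y z l l' : path_length A g x y l -> path_length A g y z l' ->
  path_length A g x z (l + l').
Proof.
move=> [g1 [s1 [F1 [h1 hs1 g10 g11 [dF1 ->]]]]] [g2 [s2 [F2 [h2 hs2 g20 g21 [dF2 ->]]]]].
(* The first path runs during [[0, 1/3]], the second during [[2/3, 1]], with a rest at [y] in
   between. Both pieces agree on an open interval around the junction [1/2], so the concatenation is
   C^1 there. *)
pose u1 (t : R) := smoothstep (0 + 3 * t); pose u2 (t : R) := smoothstep (- 2 + 3 * t).
pose d1 (t : R) := 3 * dsmoothstep (0 + 3 * t); pose d2 (t : R) := 3 * dsmoothstep (- 2 + 3 * t).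
have d10 t : 0 <= d1 t by rewrite mulr_ge0// dsmoothstep_ge0.
have d20 t : 0 <= d2 t by rewrite mulr_ge0// dsmoothstep_ge0.
have [k1 ks1] := C1_reparam h1 hs1 (is_derive_smoothstep_affine 0 3) (@continuous_dsmoothstep_affine R 0 3).
have [k2 ks2] := C1_reparam h2 hs2 (is_derive_smoothstep_affine (- 2) 3) (@continuous_dsmoothstep_affine R (- 2) 3).
pose a := g1 \o u1; pose b := g2 \o u2.
pose gam (t : R) := if t <= 2^-1 then a t else b t.
have a1 (t : R) : 3^-1 <= t -> a t = y.
  by move=> t3; rewrite /a/= /u1 smoothstep_ge1//; lra.
have b0 (t : R) : t <= 2 * 3^-1 -> b t = y.
  by move=> t3; rewrite /b/= /u2 smoothstep_le0//; lra.
have d1z (t : R) : 3^-1 <= t -> d1 t = 0.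
  by move=> t3; rewrite /d1 dsmoothstep_ge1 ?mulr0//; lra.
have d2z (t : R) : t <= 2 * 3^-1 -> d2 t = 0.
  by move=> t3; rewrite /d2 dsmoothstep_le0 ?mulr0//; lra.
have ga (t : R) : t < 2 * 3^-1 -> gam t = a t.
  move=> t3; rewrite /gam; case: leP => // t2; rewrite b0 ?a1//; lra.
have gb (t : R) : 3^-1 < t -> gam t = b t.
  move=> t3; rewrite /gam; case: leP => // t2; rewrite b0 ?a1//; lra.
have nga (t : R) : t < 2 * 3^-1 -> \forall r \near t, gam r = a r.
  move=> t3; have : \forall r \near t, r < 2 * 3^-1 by exact: lt_nbhsl.
  by apply: filterS => r; exact: ga.
have ngb (t : R) : 3^-1 < t -> \forall r \near t, gam r = b r.
  move=> t3; have : \forall r \near t, 3^-1 < r by exact: lt_nbhsr.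
  by apply: filterS => r; exact: gb.
(* At each time at most one summand of the speed is nonzero. *)
exists gam, (fun t => s1 (u1 t) * `|d1 t| + s2 (u2 t) * `|d2 t|), (fun t => F1 (u1 t) + F2 (u2 t)).
split.
- move=> t; have [t2|t2] := leP (t : R) 2^-1.
    have t3 : t < 2 * 3^-1 by lra.
    exact: (C1_at_near (nga t t3) (k1 t)).1.
  have t3 : 3^-1 < t by lra.
  exact: (C1_at_near (ngb t t3) (k2 t)).1.
- move=> t p Ap; have [t2|t2] := leP t 2^-1.
    have t3 : t < 2 * 3^-1 by lra.
    rewrite ga// => pt; have [_ ->] := C1_at_near (nga t t3) (k1 t).
    rewrite d2z ?normr0 ?mulr0 ?addr0; last by lra.
    exact: (ks1 t p Ap pt).
  have t3 : 3^-1 < t by lra.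
  rewrite gb// => pt; have [_ ->] := C1_at_near (ngb t t3) (k2 t).
  rewrite d1z ?normr0 ?mulr0 ?add0r; last by lra.
  exact: (ks2 t p Ap pt).
- by rewrite ga ?/a/= ?/u1 ?mulr0 ?addr0 ?smoothstep0//; lra.
- by rewrite gb ?/b/= ?/u2 ?smoothstep_ge1//; lra.
split.
  move=> t _; have u10 : 0 <= u1 t <= 1 by rewrite smoothstep_ge0 smoothstep_le1.
  have u20 : 0 <= u2 t <= 1 by rewrite smoothstep_ge0 smoothstep_le1.
  have D1 := is_derive_comp (is_derive_smoothstep_affine 0 3 t) (dF1 _ u10).
  have D2 := is_derive_comp (is_derive_smoothstep_affine (- 2) 3 t) (dF2 _ u20).
  have := is_deriveD D1 D2 => /is_derive_eq; apply.
  by rewrite !ger0_norm// -![_ *: _]/(_ * _) ![_ * s1 _]mulrC ![_ * s2 _]mulrC.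
have -> : u1 1 = 1 by rewrite /u1 smoothstep_ge1//; lra.
have -> : u2 1 = 1 by rewrite /u2 smoothstep_ge1//; lra.
have -> : u1 0 = 0 by rewrite /u1 smoothstep_le0//; lra.
have -> : u2 0 = 0 by rewrite /u2 smoothstep_le0//; lra.
by ring.
Qed.

End PathOperations.

(** * Comparison of the metric with the norm of a chart *)

Section LocalMetric.
Context {R : realType} {n : nat} {M : topologicalType}.
Variable A : set (chart M 'rV[R]_n).
Variable g : chart M 'rV[R]_n -> M -> 'rV[R]_n -> 'rV[R]_n -> R.
Hypothesis sA : smooth_structure A.
Hypothesis hM : hausdorff_space M.
Hypothesis gA : riemannian_metric A g.
Local Notation V := 'rV[R]_n.
Implicit Types (p q : chart M V) (gam : R -> M).

Lemma derive_mono (F G s r : R -> R) (a b : R) : a <= b ->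
  (forall t : R, a <= t <= b -> [/\ is_derive t 1 F (s t), is_derive t 1 G (r t) & s t <= r t]) ->
  F b - F a <= G b - G a.
Proof.
move=> ab H; have dH (t : R) : a <= t <= b -> is_derive t 1 (fun x => G x - F x) (r t - s t).
  by move=> /H[d1 d2 _]; exact: is_deriveB.
have [||c cab] := @MVT_segment R (fun x => G x - F x) (fun t => r t - s t) a b ab.
- by move=> x /itvP xi; apply: dH; rewrite !xi.
- apply: derivable_within_continuous => x /itvP xi.
  have xi' : a <= x <= b by rewrite !xi.
  exact: (@ex_derive _ _ _ _ _ _ _ (dH x xi')).
have : 0 <= (r c - s c) * (b - a).
  have cab' : a <= c <= b by rewrite !(itvP cab).
  by rewrite mulr_ge0 ?subr_ge0//; have [_ _] := H c cab'.
by move=> h0 h1; move: h0; rewrite -h1; lra.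
Qed.

Lemma is_derive_functional (W : normedModType R) (f : R -> W) (l : W -> R) (t : R) (df : W) :
  {morph l : x z / x - z >-> x - z} -> (forall a x, l (a *: x) = a * l x) ->
  (forall x, `|l x| <= `|x|) -> is_derive t 1 f df -> is_derive t 1 (l \o f) (l df).
Proof.
move=> lB lZ lle /is_derive_normP D; apply/is_derive_normP => d d0.
have [e e0 he] := D _ d0; exists e => // h h0 /(he h h0); apply: le_trans.
by rewrite /= -[h^-1 *: _]/(h^-1 * _) -lB -lZ -lB.
Qed.

Lemma metric_local_bounds p x : A p -> cdom p x -> exists e c C : R,
  [/\ 0 < e, 0 < c, 0 < C & forall w, `|w - cmap p x| < e -> cimg p w /\
    forall v, (c * `|v|) ^+ 2 <= g p (cinv p w) v v <= (C * `|v|) ^+ 2].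
Proof.
move=> Ap px; have cp := atlas_chart sA Ap; have [_ _ K _ _] := cp.
pose w0 := cmap p x; pose G i j w := g p (cinv p w) (delta_mx 0 i) (delta_mx 0 j).
pose S := [set v : V | `|v| = 1].
have cS : compact S.
  apply: (@subclosed_compact _ _ [set v : V | `|v - 0| <= 1]).
  - rewrite (_ : S = (fun v : V => `|v|) @^-1` [set 1]); last by [].
    apply: closed_comp; last exact: closed_eq.
    by move=> v _; exact: norm_continuous.
  - exact: compact_rV_ball.
  - by move=> v; rewrite /S/= subr0 => ->.
(* The minimum of the form over the unit sphere; an empty sphere, which occurs for [n = 0], admits
   any positive constant. *)
have [m m0 hm] : exists2 m, 0 < m & forall v, S v -> m <= g p x v v.
  have [S0|S0] := pselect (S !=set0); last by exists 1 => // v Sv; case: S0; exists v.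
  have [|v + hv] := @compact_EVT_min _ R (fun v => g p x v v) S S0 cS.
    apply: continuous_subspaceT => v.
    have := @continuous_metric R n M A g sA gA V p (fun=> w0) id v Ap; rewrite K//; apply.
    - by near do by exists x.
    - exact: cst_continuous.
    - exact: cvg_id.
  rewrite inE /S/= => v1; exists (g p x v v).
    by apply: (metric_pos gA Ap px); rewrite -normr_gt0 v1.
  by move=> u Su; apply: hv; rewrite inE.
pose N : R := n%:R ^+ 2; have N0 : 0 <= N by rewrite exprn_ge0.
(* If all coefficients move by less than [eta], the form changes by at most [N * eta * |v| ^+ 2],
   hence by at most half of [m * |v| ^+ 2]. *)
pose eta := m / (2 * (N + 1)).
have eta0 : 0 < eta by rewrite divr_gt0// mulr_gt0// ltr_wpDl.
have near_w : \forall w \near w0, cimg p w /\ forall ij : 'I_n * 'I_n, `|G ij.1 ij.2 w0 - G ij.1 ij.2 w| < eta.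
  have [op oi _ _ _] := cp.
  have h1 : \forall w \near w0, cimg p w by apply: open_nbhs_nbhs; split=> //; exists x.
  have hij (ij : 'I_n * 'I_n) : nbhs w0 [set w | `|G ij.1 ij.2 w0 - G ij.1 ij.2 w| < eta].
    case: ij => i j /=.
    have [cs _] := metric_smooth gA (delta_mx 0 i) (delta_mx 0 j) Ap 0%N.
    have w0i : cimg p w0 by exists x.
    by have /cvgrPdist_lt /(_ _ eta0) := cs _ w0i.
  have h2 := filter_forall (nbhs_filter w0) hij.
  by apply: filterS2 h1 h2 => w.
have [e e0 he] := chart_ball cp px (@filterT _ _ _).
move/nbhs_ballP: near_w => [e' /= e'0 he'].
have expw w v : cimg p w -> g p (cinv p w) v v = \sum_i \sum_j v 0 i * v 0 j * G i j w.
  by move=> /(cimg_inv cp)[dw _]; rewrite (metricE gA).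
have dbl (a : R) (v : V) (F : 'I_n -> 'I_n -> R) : 0 <= a -> (forall i j, `|F i j| <= a) ->
    `|\sum_i \sum_j v 0 i * v 0 j * F i j| <= N * a * `|v| ^+ 2.
  move=> a0 Fa; apply: le_trans (ler_norm_sum _ _ _) _.
  apply: le_trans (_ : \sum_(i < n) \sum_(j < n) a * `|v| ^+ 2 <= _).
    apply: ler_sum => i _; apply: le_trans (ler_norm_sum _ _ _) _; apply: ler_sum => j _.
    by rewrite !normrM mulrC ler_pM// expr2 ler_pM ?rV_norm_coord.
  rewrite !sumr_const !card_ord le_eqVlt; apply/orP; left; apply/eqP.
  by rewrite -[RHS]mulrA /N expr2 -[RHS]mulrA !mulr_natl.
pose B := \sum_i \sum_j `|G i j w0|.
have GB i j : `|G i j w0| <= B.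
  rewrite /B (bigD1 i)//= (bigD1 j)//= -addrA lerDl addr_ge0//.
    by apply: sumr_ge0.
  by apply: sumr_ge0 => k _; apply: sumr_ge0.
have B0 : 0 <= B by apply: sumr_ge0 => i _; apply: sumr_ge0.
have w0i : cimg p w0 by exists x.
have exp0 v : g p x v v = \sum_i \sum_j v 0 i * v 0 j * G i j w0.
  by rewrite -expw// /w0 K.
have up0 v : g p x v v <= N * B * `|v| ^+ 2.
  rewrite exp0; apply: le_trans (ler_norm _) _; exact: dbl.
have low0 v : m * `|v| ^+ 2 <= g p x v v.
  have [->|v0] := eqVneq v 0.
    by rewrite normr0 expr0n/= mulr0 (metric_ge0 gA).
  have vp : 0 < `|v| by rewrite normr_gt0.
  have Sv : S (`|v|^-1 *: v).
    by rewrite /S/= normrZ gtr0_norm ?invr_gt0// mulVf// gt_eqF.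
  have := hm _ Sv; rewrite (metricZ gA _ _ Ap px) exprVn.
  by rewrite ler_pdivlMl ?exprn_gt0// mulrC.
have dif w v : `|w - w0| < e' -> `|g p (cinv p w) v v - g p x v v| <= N * eta * `|v| ^+ 2.
  move=> we; have [iw hw] : cimg p w /\ forall ij : 'I_n * 'I_n, `|G ij.1 ij.2 w0 - G ij.1 ij.2 w| < eta.
    by apply: he'; rewrite -ball_normE/= distrC.
  rewrite exp0 expw// -sumrB.
  rewrite (eq_bigr (fun i => \sum_j v 0 i * v 0 j * (G i j w - G i j w0))).
    by apply: dbl => [|i j]; rewrite ?(ltW eta0)// distrC ltW// (hw (i, j)).
  by move=> i _; rewrite -sumrB; apply: eq_bigr => j _; rewrite mulrBr.
pose C := N * B + N * eta + 1; have C1 : 1 <= C.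
  by rewrite /C lerDr addr_ge0// mulr_ge0// ltW.
exists (Num.min e e'), (Num.sqrt (m / 2)), C; split.
- by rewrite lt_min e0.
- by rewrite sqrtr_gt0 divr_gt0.
- by apply: lt_le_trans C1.
move=> w; rewrite lt_min => /andP[/he[iw _] we]; split=> // v.
have := dif w v we; have := up0 v; have := low0 v; rewrite ler_norml !exprMn.
set X := `|v| ^+ 2; have X0 : 0 <= X by rewrite exprn_ge0.
rewrite sqr_sqrtr ?divr_ge0 ?(ltW m0)// => l0 u0 /andP[l1 u1].
have Neta : N * eta * X <= m / 2 * X.
  rewrite ler_wpM2r// /eta mulrA ler_pdivrMr ?mulr_gt0 ?ltr_wpDl//.
  by rewrite mulrA divfK// mulrC ler_wpM2l ?(ltW m0)// lerDl.
apply/andP; split; first by lra.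
apply: le_trans (_ : C * X <= _).
  by rewrite /C; lra.
by rewrite ler_wpM2r// expr2 ler_peMr// (le_trans ler01).
Unshelve. all: by end_near. Qed.

Lemma straight_path p (w u : V) (C : R) : A p ->
  (forall t : R, 0 <= t <= 1 -> cimg p (w + t *: u) /\
     g p (cinv p (w + t *: u)) u u <= C ^+ 2) -> 0 <= C ->
  exists2 l, l <= C & path_length A g (cinv p w) (cinv p (w + u)) l.
Proof.
move=> Ap H C0; have cp := atlas_chart sA Ap; have [_ _ Kp _ ci] := cp.
(* The reparametrization keeps [L t] on the segment for every real [t], so the curve stays in the
   chart although it is defined on the whole line. *)
pose L (t : R) := w + smoothstep t *: u; pose gam t := cinv p (L t).
have st (t : R) : 0 <= smoothstep t <= 1 by rewrite smoothstep_ge0 smoothstep_le1.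
have iL t : cimg p (L t) by exact: (H _ (st t)).1.
have cL : continuous L.
  move=> t; apply: cvgD; first exact: cvg_cst.
  apply: cvgZr_tmp; apply: differentiable_continuous; apply/derivable1_diffP.
  by have [] := is_derive_smoothstep t.
have cgam : continuous gam.
  by move=> t; apply: (@continuous_comp _ _ _ L (cinv p)); [exact: cL|exact: ci].
have pgam t : cdom p (gam t) by exact: (cimg_inv cp (iL t)).1.
have Kgam t : cmap p (gam t) = L t by exact: (cimg_inv cp (iL t)).2.
pose U q := cmap p @` (cdom p `&` cdom q).
have UL q t : cdom q (gam t) -> U q (L t) by move=> qt; exists (gam t).
have sm q (Aq : A q) := (atlas_compatible sA Ap Aq).1 1%N.
have der q (t : R) : A q -> cdom q (gam t) ->
    is_derive t 1 (cmap q \o gam) (dsmoothstep t *: 'D_u (transition p q) (L t)).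
  move=> Aq qt; have [_ /(_ u)[d _]] := sm q Aq.
  apply: (@is_derive_comp _ _ (fun s : R => transition p q (w + s *: u)) (@smoothstep R)).
    exact: is_derive_smoothstep.
  by apply: is_derive_line; apply: DeriveDef => //; apply: d; exact: UL.
have derE q (t : R) : A q -> cdom q (gam t) ->
    derive1 (cmap q \o gam) t = dsmoothstep t *: 'D_u (transition p q) (L t).
  by move=> Aq qt; rewrite derive1E; have [_ ->] := der q t Aq qt.
have C1 t : C1_at A gam t.
  split; first exact: cgam.
  move=> q Aq qt; split; first exact: (@ex_derive _ _ _ _ _ _ _ (der q t Aq qt)).
  rewrite /prop_for /continuous_at derE//.
  have c2 : {for t, continuous (fun r => dsmoothstep r *: 'D_u (transition p q) (L r))}.
    apply: cvgZ; first exact: continuous_dsmoothstep.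
    have [_ /(_ u)[_ [c _]]] := sm q Aq.
    by apply: (@continuous_comp _ _ _ L ('D_u (transition p q))); [exact: cL|apply: c; exact: UL].
  apply: cvg_trans c2; apply: near_eq_cvg.
  apply: filterS (near_dom sA Aq (cgam t) qt) => r qr; exact/esym/derE.
pose s (t : R) := dsmoothstep t * Num.sqrt (g p (gam t) u u).
have hs : has_speed A g gam s.
  move=> t q Aq qt; rewrite /= derE// (metricZ gA _ _ Aq qt).
  rewrite sqrtrM ?sqr_ge0// sqrtr_sqr ger0_norm ?dsmoothstep_ge0// -Kgam.
  by rewrite -(metric_transition gA u u Ap Aq (pgam t) qt).
have [F [dF _]] := continuous_primitive (speed_continuous sA gA C1 hs).
exists (F 1 - F 0).
  have -> : C = C * smoothstep 1 - C * smoothstep 0.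
    by rewrite smoothstep0 smoothstep1; ring.
  apply: (@derive_mono F (fun t => C * smoothstep t) s (fun t => C * dsmoothstep t)) => // t t01.
  split; [exact: dF| |].
    have := is_derive_affine_smoothstep 0 C t.
    by rewrite (_ : (fun _ => _) = (fun t => C * smoothstep t))//; apply/funext => r; rewrite add0r.
  rewrite /s mulrC ler_wpM2r ?dsmoothstep_ge0//.
  rewrite -[leRHS](ger0_norm C0) -sqrtr_sqr ler_wsqrtr//.
  exact: (H _ (st t)).2.
exists gam, s, F; split=> //.
- by rewrite /gam /L smoothstep0 scale0r addr0.
- by rewrite /gam /L smoothstep1 scale1r.
Qed.

End LocalMetric.

(** * The Riemannian distance *)

Section RiemannianDistance.
Context {R : realType} {n : nat} {M : topologicalType}.
Variable A : set (chart M 'rV[R]_n).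
Variable g : chart M 'rV[R]_n -> M -> 'rV[R]_n -> 'rV[R]_n -> R.
Hypothesis mA : smooth_manifold A.
Hypothesis gA : riemannian_metric A g.
Hypothesis cM : connected [set: M].
Let sA := manifold_structure mA.
Let hM := manifold_hausdorff mA.
Local Notation V := 'rV[R]_n.
Local Notation d := (rdist A g).
Implicit Types (p q : chart M V) (gam : R -> M).

(** Let [T] be the supremum of the times up to which the path is inside. The length bound keeps the
    path strictly inside at [T], and openness then forces [T = 1]. *)
Lemma short_path_inside p x y l (c r : R) : A p -> cdom p x -> 0 < c -> 0 < r ->
  (forall w, `|w - cmap p x| <= r -> cimg p w /\
    forall v, (c * `|v|) ^+ 2 <= g p (cinv p w) v v) ->
  path_length A g x y l -> l < c * r ->
  cdom p y /\ `|cmap p y - cmap p x| < r.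
Proof.
move=> Ap px c0 r0 hb [gam [s [F [h hs g0 g1 [dF ->]]]]] lr.
have cp := atlas_chart sA Ap; have [op _ Kp cm _] := cp.
have [p0 p1] : F 0 <= F 1 /\ True by split=> //; have := path_length_ge0 sA gA
  (ex_intro _ gam (ex_intro _ s (ex_intro _ F (And5 h hs g0 g1 (conj dF erefl))))); lra.
pose w0 := cmap p x.
pose inside (t : R) := cdom p (gam t) /\ `|cmap p (gam t) - w0| < r.
have cg : continuous gam by move=> t; exact: (h t).1.
have inside0 : inside 0 by rewrite /inside g0 subrr normr0.
have inside_open (t : R) : inside t -> \forall s \near t, inside s.
  move=> [pt rt]; have nb : nbhs (cmap p (gam t)) [set w | `|w - w0| < r].
    apply/nbhs_ballP; exists (r - `|cmap p (gam t) - w0|); first by rewrite /= subr_gt0.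
    move=> w; rewrite -ball_normE/= distrC => h1.
    by have := ler_distD (cmap p (gam t)) w w0; lra.
  have nn : nbhs t (gam @^-1` [set z | cdom p z /\ `|cmap p z - w0| < r]).
    exact: (cg t _ (chart_nbhs cp pt nb)).
  exact: nn.
(* A functional [k] attaining its norm measures the displacement in coordinates; its derivative
   along the path is at most the norm of the velocity, which [c] compares with the speed. *)
have est (t : R) : 0 <= t <= 1 -> (forall s, 0 <= s < t -> inside s) -> cdom p (gam t) ->
    `|cmap p (gam t) - w0| <= r -> c * `|cmap p (gam t) - w0| <= F t - F 0.
  move=> /andP[t0 t1] ins pt rt; have [k [kB kZ kle kE]] := norm_attaining_rV (cmap p (gam t) - w0).
  pose f := fun s : R => k (cmap p (gam s)).
  have -> : `|cmap p (gam t) - w0| = f t - f 0 by rewrite -kE kB /f g0.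
  rewrite mulrBr.
  apply: (@derive_mono R (fun s => c * f s) F
     (fun r => c * k (derive1 (cmap p \o gam) r)) s) => // u /andP[u0 ut].
  have [pu ru] : cdom p (gam u) /\ `|cmap p (gam u) - w0| <= r.
    move: ut; rewrite le_eqVlt => /predU1P[->//|ut].
    by have [? ?] : inside u by [apply: ins; rewrite u0]; split=> //; exact: ltW.
  split; [|by apply: dF; rewrite u0 (le_trans ut)|].
    have D : is_derive u 1 f (k (derive1 (cmap p \o gam) u)).
      apply: (@is_derive_functional R V (cmap p \o gam) k u _ kB kZ kle).
      by rewrite derive1E; apply: DeriveDef; first exact: ((h u).2 p Ap pu).1.
    exact: (is_deriveZ c D).
  rewrite (hs u p Ap pu)/=; set v := derive1 _ _.
  apply: le_trans (_ : c * `|v| <= _).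
    by rewrite ler_wpM2l ?(ltW c0)//; exact: le_trans (ler_norm _) (kle v).
  have cv0 : 0 <= c * `|v| by rewrite mulr_ge0// ltW.
  rewrite -[leLHS]ger0_norm// -sqrtr_sqr ler_wsqrtr//.
  have [_ /(_ v)] := hb _ ru; by rewrite Kp.
pose E := [set t : R | 0 <= t <= 1 /\ forall s, 0 <= s <= t -> inside s].
have E0 : E 0.
  by split=> [|s']; [rewrite lexx ler01|rewrite -eq_le => /eqP <-].
have hE : has_sup E by split; [exists 0|exists 1 => t [/andP[]]].
pose T := sup E.
have T0 : 0 <= T by apply: sup_upper_bound.
have T1 : T <= 1 by apply: ge_sup; [exists 0|move=> t [/andP[]]].
have before (s' : R) : 0 <= s' < T -> inside s'.
  move=> /andP[s0 sT]; have : 0 < T - s' by rewrite subr_gt0.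
  move=> /sup_adherent /(_ hE)[t [_ ins]]; rewrite subKr => st.
  by apply: ins; rewrite s0 ltW.
(* The path might leave the domain of the chart at time [T]. It does not: the image of the closed
   ball is compact, hence closed, and contains the points [gam s] for [s < T]. *)
have [pT rT] : cdom p (gam T) /\ `|cmap p (gam T) - w0| <= r.
  have [T00|T00] := eqVneq T 0; first by rewrite T00; have [? /ltW] := inside0.
  have Tp : 0 < T by rewrite lt_def T00.
  pose B := cinv p @` [set w : V | `|w - w0| <= r].
  have sub w : `|w - w0| <= r -> cimg p w by move=> /hb[].
  have cB : closed B by apply: compact_closed => //; exact: compact_chart_ball.
  have [w /= wr wT] : B (gam T).
    apply: cB => N /(cg T) NT.
    have : nbhs T [set s | N (gam s)] by exact: NT.
    move=> /nbhs_ballP[e /= e0 he].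
    pose s' := Num.max 0 (T - e / 2).
    have s0 : 0 <= s' by rewrite /s' le_max lexx.
    have sT : s' < T by rewrite /s' gt_max Tp/=; lra.
    have [ps rs] : inside s' by apply: before; rewrite s0.
    exists (gam s'); split; first by exists (cmap p (gam s')); rewrite /= ?Kp// ltW.
    apply: he; rewrite -ball_normE/= ger0_norm ?subr_ge0 1?ltW//.
    have : T - e / 2 <= s' by rewrite /s' le_max lexx orbT.
    lra.
  by have [dw wK] := cimg_inv cp (sub w wr); rewrite -wT wK.
have T01 : 0 <= T <= 1 by rewrite T0.
have insT : inside T.
  split=> //; have := est T T01 before pT rT.
  have FT : F T <= F 1.
    have := @derive_mono R (fun=> 0) F (fun=> 0) s T 1 T1; rewrite subrr subr_ge0; apply.
    move=> t /andP[Tt t1]; split; [exact: is_derive_cst| |exact: (speed_ge0 sA _ hs)].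
    by apply: dF; rewrite (le_trans T0 Tt).
  move=> h1; rewrite -(ltr_pM2l c0); lra.
have TE : T = 1.
  apply/eqP; rewrite eq_le T1 leNgt; apply/negP => Tlt.
  have /nbhs_ballP[e /= e0 he] := inside_open T insT.
  pose t := Num.min 1 (T + e / 2).
  have Tt : T < t by rewrite /t lt_min Tlt/=; lra.
  have tle : t <= T + e / 2 by rewrite /t ge_min lexx orbT.
  have t1 : t <= 1 by rewrite /t ge_min lexx.
  have : E t.
    split; first by rewrite t1 (le_trans T0 (ltW Tt)).
    move=> s' /andP[s0 st]; have [sT|sT] := ltP s' T; first by apply: before; rewrite s0.
    by apply: he; rewrite -ball_normE/= ler0_norm ?subr_le0//; lra.
  by move=> /(sup_upper_bound hE); rewrite leNgt Tt.
by move: insT; rewrite TE /inside g1.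
Qed.

Lemma rdist_ge0 x y : 0 <= d x y.
Proof.
rewrite /rdist (path_length_set sA gA).
(* Without any path the infimum is over the empty set and equals [0]; connectedness excludes this
   case in [paths_exist]. *)
have [P0|P0] := pselect (path_length A g x y !=set0); last first.
  rewrite (_ : path_length A g x y = set0) ?inf0//.
  by apply/seteqP; split=> // l hl; case: P0; exists l.
by apply: lb_le_inf => // l; exact: path_length_ge0.
Qed.

Lemma rdist_le x y l : path_length A g x y l -> d x y <= l.
Proof.
move=> P; rewrite /rdist (path_length_set sA gA); apply: ge_inf => //.
by exists 0 => k; exact: path_length_ge0.
Qed.

Lemma near_path x (e : R) : 0 < e -> \forall y \near x, exists2 l, l < e & path_length A g x y l.
Proof.
move=> e0; have [p Ap px] := atlas_cover sA x; have cp := atlas_chart sA Ap.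
have [_ _ Kp _ _] := cp.
have [e1 [c [C [e10 c0 C0 hb]]]] := metric_local_bounds sA gA Ap px.
pose r := Num.min e1 (e / C); have r0 : 0 < r by rewrite lt_min e10 divr_gt0.
have nb : nbhs (cmap p x) [set w | `|w - cmap p x| < r].
  by apply/nbhs_ballP; exists r => // w; rewrite -ball_normE/= distrC.
apply: filterS (chart_nbhs cp px nb) => y [py /= yr].
move: yr; rewrite lt_min => /andP[y1 y2]; pose u := cmap p y - cmap p x.
have [||l lC] := @straight_path R n M A g sA gA p (cmap p x) u (C * `|u|) Ap.
- move=> t /andP[t0 t1]; have : `|cmap p x + t *: u - cmap p x| < e1.
    rewrite addrAC subrr add0r normrZ ger0_norm//; apply: le_lt_trans y1.
    by rewrite ler_piMl.
  by move=> /hb[i /(_ u)/andP[]].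
- by rewrite mulr_ge0// ltW.
rewrite Kp// /u [_ + (_ - _)]addrC subrK Kp// => P; exists l => //.
apply: le_lt_trans lC _; move: y2; rewrite ltr_pdivlMr// mulrC; exact.
Qed.

(** The set reached from [x] is open and closed, since nearby points are joined by straight segments
    in a chart. *)
Lemma paths_exist x y : exists l, path_length A g x y l.
Proof.
pose S := [set y | exists l, path_length A g x y l].
suff : S = setT by move=> /seteqP[_]; apply.
apply: cM.
- by exists x, 0; exact: path_length_refl.
- exists S; last by rewrite setTI.
  rewrite openE => z [l Pl]; apply: filterS (near_path z ltr01) => z' [l' _ Pl'].
  by exists (l + l'); exact: path_length_trans Pl Pl'.
- exists S; last by rewrite setTI.
  move=> z cz; have [z' [[l Pl] [l' _ Pl']]] := cz _ (near_path z ltr01).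
  by exists (l + l'); apply: path_length_trans Pl _ => //; exact: path_length_sym.
Qed.

Lemma rdist_lt x y (r : R) : d x y < r -> exists2 l, l < r & path_length A g x y l.
Proof.
rewrite /rdist (path_length_set sA gA) => /inf_lt[|l Pl lr]; last by exists l.
by have [l Pl] := paths_exist x y; exists l.
Qed.

Lemma rdist_refl x : d x x = 0.
Proof.
by apply/eqP; rewrite eq_le rdist_ge0 andbT; apply: rdist_le; exact: path_length_refl.
Qed.

Lemma rdist_sym x y : d x y = d y x.
Proof.
have H z w : d z w <= d w z.
  apply/ler_addgt0Pr => e e0; have : d w z < d w z + e by rewrite ltrDl.
  move=> /rdist_lt[l lr Pl]; apply: le_trans (ltW lr).
  by apply: rdist_le; exact: path_length_sym.
by apply/eqP; rewrite eq_le !H.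
Qed.

Lemma rdist_triangle x y z : d x z <= d x y + d y z.
Proof.
apply/ler_addgt0Pr => e e0; have e20 : 0 < e / 2 by rewrite divr_gt0.
have /rdist_lt[l lr Pl] : d x y < d x y + e / 2 by rewrite ltrDl.
have /rdist_lt[l' lr' Pl'] : d y z < d y z + e / 2 by rewrite ltrDl.
have := rdist_le (path_length_trans sA gA Pl Pl'); lra.
Qed.

Lemma rdist_near x (e : R) : 0 < e -> \forall y \near x, d x y < e.
Proof.
move=> e0; apply: filterS (near_path x e0) => y [l le P].
exact: le_lt_trans (rdist_le P) le.
Qed.

(** The intermediate value theorem, applied to the primitive of the speed, cuts a path at length
    [r1]; the strict inequality leaves room for a path that is not minimizing. *)
Lemma rdist_split x y (r1 r2 : R) : 0 <= r1 -> 0 <= r2 -> d x y < r1 + r2 ->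
  exists z, d x z <= r1 /\ d z y <= r2.
Proof.
move=> r10 r20 /rdist_lt[l lr [gam [s [F [h hs g0 g1 [dF lE]]]]]].
have [lr1|lr1] := leP l r1.
  exists y; rewrite rdist_refl; split=> //; apply: le_trans lr1; apply: rdist_le.
  by exists gam, s, F.
have cF : {within `[0, 1], continuous F}.
  apply: derivable_within_continuous => t /itvP ti.
  have t01 : 0 <= t <= 1 by rewrite !ti.
  exact: (@ex_derive _ _ _ _ _ _ _ (dF t t01)).
have [|t ti tE] := @IVT R F 0 1 (F 0 + r1) ler01 cF.
  have F01 : F 0 <= F 1 by lra.
  by rewrite (min_idPl F01) (max_idPr F01); apply/andP; split; lra.
have [t0 t1] : 0 <= t /\ t <= 1 by rewrite !(itvP ti).
exists (gam t); split.
  have := rdist_le (path_length_sub sA gA h hs dF (lexx 0) t0 t1 g0 erefl); lra.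
have := rdist_le (path_length_sub sA gA h hs dF t0 t1 (lexx 1) erefl g1); lra.
Qed.

Lemma rdist_small_ball x : exists2 rho : R, 0 < rho &
  exists2 K, compact K & [set y | d x y < rho] `<=` K.
Proof.
have [p Ap px] := atlas_cover sA x; have cp := atlas_chart sA Ap.
have [e [c [C [e0 c0 C0 hb]]]] := metric_local_bounds sA gA Ap px.
pose r := e / 2; have r0 : 0 < r by rewrite divr_gt0.
have hb' w : `|w - cmap p x| <= r -> cimg p w /\
    forall v, (c * `|v|) ^+ 2 <= g p (cinv p w) v v.
  move=> wr; have : `|w - cmap p x| < e by move: wr; rewrite /r; lra.
  by move=> /hb[i hv]; split=> // v; have /andP[] := hv v.
exists (c * r); first by rewrite mulr_gt0.
exists (cinv p @` [set w : V | `|w - cmap p x| <= r]).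
  by apply: compact_chart_ball => // w /hb'[].
move=> y /= /rdist_lt[l lr P].
have [py yr] := short_path_inside Ap px c0 r0 hb' P lr.
have [_ _ Kp _ _] := cp.
by exists (cmap p y); [rewrite /= ltW|rewrite Kp].
Qed.

End RiemannianDistance.

(** * Hopf-Rinow for a length distance *)

Section HopfRinow.
Context {R : realType} {T : topologicalType}.
Variable d : T -> T -> R.
Hypothesis d_refl : forall x, d x x = 0.
Hypothesis d_sym : forall x y, d x y = d y x.
Hypothesis d_tri : forall x y z, d x z <= d x y + d y z.
Hypothesis d_near : forall x e, 0 < e -> \forall y \near x, d x y < e.
Hypothesis d_split : forall x y r1 r2, 0 <= r1 -> 0 <= r2 -> d x y < r1 + r2 ->
  exists z, d x z <= r1 /\ d z y <= r2.
Hypothesis d_small : forall x, exists2 rho, 0 < rho &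
  exists2 K, compact K & [set y | d x y < rho] `<=` K.
Hypothesis d_complete : complete_dist d.

Definition bounded_in_compact x r := exists2 K, compact K & [set y | d x y <= r] `<=` K.

(** Suppose that all balls of radius [3/4 r] centred in the ball are relatively compact. Then one
    compact set contains the [9/16 r]-balls around all points of the ball of radius [r / 2], as
    [9/16 + 1/16 + 1/16 < 3/4]; these reach every point at distance at most [r], as
    [1/2 + 9/16 > 1]. *)
Lemma bounded_in_compact_step x r : 0 < r -> ~ bounded_in_compact x r ->
  exists y, d x y <= r /\ ~ bounded_in_compact y (3 / 4 * r).
Proof.
move=> r0 nb; apply: contrapT => H.
have {}H y : d x y <= r -> bounded_in_compact y (3 / 4 * r).
  by move=> xy; apply: contrapT => ny; apply: H; exists y.
have [K cK xK] : bounded_in_compact x (r / 2).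
  have [|K cK hK] := H x; first by rewrite d_refl ltW.
  by exists K => // y /= xy; apply: hK => /=; lra.
apply: nb.
(* The filter of compact sets directed by inclusion; near-covering along it extracts one compact set
   valid over all of [K]. *)
pose F := [set P : set (set T) | exists2 K0, compact K0 & forall S, K0 `<=` S -> P S].
have FF : Filter F.
  split; first by exists set0; [exact: compact0|].
    move=> P Q [K1 c1 h1] [K2 c2 h2]; exists (K1 `|` K2); first exact: compactU.
    by move=> S hS; split; [apply: h1|apply: h2] => z Kz; apply: hS; [left|right].
  by move=> P Q PQ [K0 c0 h0]; exists K0 => // S /h0; exact: PQ.
pose P (S : set T) (z : T) := d x z <= r / 2 -> [set y | d z y <= 9 / 16 * r] `<=` S.
have r16 : 0 < r / 16 by rewrite divr_gt0.
have /compact_near_coveringP nc := cK.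
have [|K0 c0 h0] := nc _ F P FF.
  (* [K] may contain points outside the half ball, where [P] holds vacuously; otherwise a nearby
     point [y] of the half ball provides the compact set. *)
  move=> z Kz; have [[y [zy xy]]|none] := pselect (exists y, d z y < r / 16 /\ d x y <= r / 2).
    have [|Ky cy hy] := H y; first by lra.
    exists ([set z' | d z z' < r / 16], [set S | Ky `<=` S]).
      by split; [exact: d_near|exists Ky].
    move=> [z' S] /= [zz' KS] xz' w /= zw; apply: KS; apply: hy => /=.
    have := d_tri y z' w; have := d_tri y z z'; rewrite [d y z]d_sym; lra.
  exists ([set z' | d z z' < r / 16], setT); first by split; [exact: d_near|exact: filterT].
  by move=> [z' S] /= [zz' _] xz'; case: none; exists z'.
exists K0 => // y /= xy.
have [|||z [xz zy]] := @d_split x y (r / 2) (9 / 16 * r); [lra|lra|lra|].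
exact: (h0 K0 (fun _ => id) z (xK z xz) xz y zy).
Qed.

(** A ball that is not relatively compact contains the centre of another one, smaller by the factor
    [3/4]. The successive centres form a Cauchy sequence, and the bad balls end up inside the
    relatively compact ball of [d_small] around the limit. *)
Lemma hopf_rinow x r : bounded_in_compact x r.
Proof.
apply: contrapT => nb.
have r0 : 0 < r.
  rewrite ltNge; apply/negP => r0; have [rho rho0 [K cK hK]] := d_small x.
  by apply: nb; exists K => // y /= xy; apply: hK => /=; lra.
have [f hf] : {f : T * R -> T & forall xr, 0 < xr.2 -> ~ bounded_in_compact xr.1 xr.2 ->
    d xr.1 (f xr) <= xr.2 /\ ~ bounded_in_compact (f xr) (3 / 4 * xr.2)}.
  apply: (@choice _ _ (fun xr y => 0 < xr.2 -> ~ bounded_in_compact xr.1 xr.2 ->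
    d xr.1 y <= xr.2 /\ ~ bounded_in_compact y (3 / 4 * xr.2))) => -[y s] /=.
  have [s0|s0] := ltP 0 s; last by exists y.
  have [h|h] := pselect (bounded_in_compact y s); first by exists y.
  by have [z hz] := bounded_in_compact_step s0 h; exists z.
pose q : R := 3 / 4; pose s k := q ^+ k * r.
have s0 k : 0 < s k by rewrite mulr_gt0// exprn_gt0// /q; lra.
have sS k : s k.+1 = 3 / 4 * s k by rewrite /s exprS mulrA.
pose u := fix u k := if k is j.+1 then f (u j, s j) else x.
have nu k : ~ bounded_in_compact (u k) (s k).
  elim: k => [|k IH]; first by rewrite /s expr0 mul1r.
  by rewrite sS; exact: (hf (u k, s k) (s0 k) IH).2.
have du k : d (u k) (u k.+1) <= s k by exact: (hf (u k, s k) (s0 k) (nu k)).1.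
(* Since [s i - s i.+1] equals [s i / 4], the bound on the distances telescopes. *)
have dum i m : d (u i) (u (i + m)%N) <= 4 * (s i - s (i + m)%N).
  elim: m => [|m IH]; first by rewrite addn0 d_refl subrr mulr0.
  rewrite addnS; have := d_tri (u i) (u (i + m)%N) (u (i + m).+1).
  by have := du (i + m)%N; rewrite sS; lra.
have s_small e : 0 < e -> exists N, forall i, (N <= i)%N -> s i < e.
  move=> e0; have q1 : `|q| < 1 by rewrite ger0_norm /q; lra.
  have er0 : 0 < e / r by rewrite divr_gt0.
  have := cvg_expr q1 => /cvgrPdist_lt /(_ _ er0) [N _ hN].
  exists N => i Ni; have := hN i Ni; rewrite /= sub0r normrN => h.
  rewrite /s -ltr_pdivlMr//; exact: le_lt_trans (ler_norm _) h.
have [e|l hl] := @d_complete u.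
  move=> e0; have e80 : 0 < e / 4 by rewrite divr_gt0.
  have [N hN] := s_small _ e80; exists N => i j Ni Nj.
  wlog ij : i j Ni Nj / (i <= j)%N.
    by move=> W; have [/W|/ltnW/W] := leqP i j; [exact|rewrite d_sym; exact].
  have := dum i (j - i)%N; rewrite subnKC//; have := s0 j; have := hN i Ni; lra.
have [rho rho0 [K cK hK]] := d_small l.
have rho20 : 0 < rho / 2 by rewrite divr_gt0.
have [N1 h1] := hl _ rho20; have [N2 h2] := s_small _ rho20.
pose k := maxn N1 N2; apply: (nu k); exists K => // y /= uy; apply: hK => /=.
have := d_tri l (u k) y; have := h1 k (leq_maxl _ _); have := h2 k (leq_maxr _ _).
rewrite [d l (u k)]d_sym; lra.
Qed.

End HopfRinow.

(** * The critical constant *)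

Section CriticalConstant.
Context {R : realType} {T : Type}.
Variable c : T * T -> R.

Fixpoint chain_cost (a : R) (x : T) (s : seq T) : R :=
  if s is y :: s' then c (x, y) + a + chain_cost a y s' else 0.

Lemma chain_cost_rcons a x s y :
  chain_cost a x (rcons s y) = chain_cost a x s + (c (last x s, y) + a).
Proof. by elim: s x => [|z s IH] x /=; rewrite ?addr0 ?add0r// IH addrA. Qed.

Lemma chain_cost_subsolution a u x s : subsolution c a u ->
  u (last x s) - u x <= chain_cost a x s.
Proof.
move=> su; elim: s x => [|y s IH] x /=; first by rewrite subrr.
by have := IH y; have := su x y; lra.
Qed.

Lemma chain_cost_shift a b x s :
  chain_cost b x s = chain_cost a x s + (size s)%:R * (b - a).
Proof.
elim: s x => [|y s IH] x /=; first by rewrite mul0r addr0.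
by rewrite IH -natr1; ring.
Qed.

Lemma critical_subsolution (x0 : T) (C a0 : R) : (forall z, - C <= c z) ->
  (forall x, c (x, x) <= a0) -> exists u, subsolution c (critical_constant c) u.
Proof.
move=> cC ca; pose S := [set a | exists u, subsolution c a u].
have SC : S C by exists (fun=> 0) => x y; have := cC (x, y); lra.
have lS : lbound S (- a0).
  by move=> a [u su]; have := su x0 x0; have := ca x0; lra.
pose b := inf S.
have hS : has_inf S by split; [exists C|exists (- a0)].
have bS : lbound S b by apply: ge_inf; case: hS.
(* A subsolution at a level [a] makes cycles nonnegative at that level; passing down to [b] costs
   [size s] times [a - b], whence the tolerance. *)
have cyc x s : last x s = x -> 0 <= chain_cost b x s.
  move=> lx; apply/ler_addgt0Pr => e e0.
  have e0' : 0 < e / ((size s)%:R + 1) by rewrite divr_gt0// ltr_wpDl.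
  have [a [u su] ab] := inf_adherent e0' hS.
  have := chain_cost_subsolution x s su; rewrite lx subrr => h.
  rewrite (chain_cost_shift a); have : (size s)%:R * (a - b) <= e; last by lra.
  apply: le_trans (_ : ((size s)%:R + 1) * (a - b) <= _).
    have : b <= a by apply: bS; exists u.
    by move=> ba; rewrite ler_wpM2r ?subr_ge0// lerDl.
  by rewrite mulrC -ler_pdivlMr ?ltr_wpDl//; rewrite -/b in ab; lra.
have Sb : S b.
  (* The infimum of the costs of nonempty chains from [x0] to [y]; closing a chain into a cycle at
     [x0] bounds it from below. *)
  pose E y := [set chain_cost b x0 (rcons s y) | s in [set: seq T]].
  have E0 y : E y !=set0 by exists (chain_cost b x0 (rcons [::] y)), [::].
  have lE y : lbound (E y) (- (c (y, x0) + b)).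
    move=> _ [s _ <-]; have := cyc x0 (rcons (rcons s y) x0).
    by rewrite last_rcons chain_cost_rcons last_rcons => /(_ erefl); lra.
  exists (fun y => inf (E y)) => y z; rewrite lerBlDl -lerBlDr.
  apply: lb_le_inf => // _ [s _ <-]; rewrite lerBlDr; apply: ge_inf.
    by exists (- (c (z, x0) + b)).
  by exists (rcons s y); rewrite ?chain_cost_rcons ?last_rcons.
have ex : [set alpha | S alpha /\ lbound S alpha] !=set0 by exists b.
by have [] := xgetPex 0 ex.
Qed.

End CriticalConstant.

(** * The Lax-Oleinik operators *)

Section LaxOleinik.
Context {R : realType} {T : Type}.
Implicit Types (k : T -> T -> R) (u v : T -> R).

Definition sub k u := forall x y, u y - u x <= k x y.

Definition lax k u x : R := inf [set u y + k y x | y in [set: T]].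

Definition swap k x y := k y x.

(** Reversing the cost and the sign exchanges the two operators, so the properties of this one are
    read off from those of [lax]. *)
Definition lax_plus k u x : R := - lax (swap k) (fun y => - u y) x.

Lemma sub_swap k u : sub k u -> sub (swap k) (fun y => - u y).
Proof. by move=> su x y; have := su y x; rewrite /swap; lra. Qed.

Lemma lax_le k u x y : sub k u -> lax k u x <= u y + k y x.
Proof.
move=> su; apply: ge_inf; last by exists y.
by exists (u x) => _ [z _ <-]; have := su z x; lra.
Qed.

Lemma lax_ge k u x : sub k u -> u x <= lax k u x.
Proof.
move=> su; apply: lb_le_inf; first by exists (u x + k x x), x.
by move=> _ [z _ <-]; have := su z x; lra.
Qed.

Lemma lax_near k u x e : 0 < e -> sub k u -> exists y, u y + k y x < lax k u x + e.
Proof.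
move=> e0 su; have h : has_inf [set u y + k y x | y in [set: T]].
  split; first by exists (u x + k x x), x.
  by exists (u x) => _ [z _ <-]; have := su z x; lra.
by have [_ [y _ <-] hy] := inf_adherent e0 h; exists y.
Qed.

(** The chain [v y <= lax k u y <= u x + k x y <= v x + k x y] uses no regularity of [v], which
    leaves full freedom inside the band. *)
Lemma sub_between k u v : sub k u -> (forall x, u x <= v x <= lax k u x) -> sub k v.
Proof.
move=> su h x y; have /andP[_ h1] := h y; have /andP[h2 _] := h x.
by have := lax_le y x su; lra.
Qed.

Lemma sub_lax k u : sub k u -> sub k (lax k u).
Proof. by move=> su; apply: (sub_between su) => x; apply/andP; split; [exact: lax_ge|exact: lexx]. Qed.

Lemma lax_plus_ge k u x y : sub k u -> u y - k x y <= lax_plus k u x.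
Proof.
by move=> /sub_swap su; have := lax_le x y su; rewrite /lax_plus /swap; lra.
Qed.

Lemma lax_plus_le k u x : sub k u -> lax_plus k u x <= u x.
Proof. by move=> /sub_swap su; have := lax_ge x su; rewrite /lax_plus; lra. Qed.

Lemma sub_lax_plus k u : sub k u -> sub k (lax_plus k u).
Proof. by move=> /sub_swap/sub_lax/sub_swap. Qed.

Lemma sub_between_plus k u v : sub k u -> (forall x, lax_plus k u x <= v x <= u x) -> sub k v.
Proof.
move=> su h x y; have /andP[_ h1] := h y; have /andP[h2 _] := h x.
by have := lax_plus_ge x y su; lra.
Qed.

(** Calibration of [u] on the pair. *)
Definition tight k u x y := u y - u x = k x y.

Lemma tight_lax k u x y : sub k u -> tight k (lax k u) x y ->
  lax k u x = u x /\ lax k u y = u x + k x y.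
Proof.
rewrite /tight => su t; have := lax_le y x su; have := lax_ge x su; split; lra.
Qed.

Lemma tight_lax_plus k u x y : sub k u -> tight k (lax_plus k u) x y ->
  lax_plus k u y = u y /\ lax_plus k u x = u y - k x y.
Proof.
rewrite /tight => su t; have := lax_plus_ge x y su; have := lax_plus_le y su; split; lra.
Qed.

End LaxOleinik.

(** * Semi-concave costs and their subsolutions *)

Section GoodCost.
Context {R : realType} {n : nat} {M : topologicalType}.
Variable A : set (chart M 'rV[R]_n).
Hypothesis mA : smooth_manifold A.
Let sA := manifold_structure mA.
Let hM := manifold_hausdorff mA.
Variable d : M -> M -> R.
Hypothesis d_ge0 : forall x y, 0 <= d x y.
Hypothesis d_refl : forall x, d x x = 0.
Hypothesis d_sym : forall x y, d x y = d y x.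
Hypothesis d_tri : forall x y z, d x z <= d x y + d y z.
Hypothesis d_near : forall x e, 0 < e -> \forall y \near x, d x y < e.
Hypothesis d_split : forall x y r1 r2, 0 <= r1 -> 0 <= r2 -> d x y < r1 + r2 ->
  exists z, d x z <= r1 /\ d z y <= r2.
Hypothesis d_compact : forall x r, bounded_in_compact d x r.
Local Notation V := 'rV[R]_n.
Implicit Types (k : M -> M -> R) (u v : M -> R).

(** The properties of a cost behind the Lax-Oleinik estimates; they are symmetric in the two
    variables, so that [lax_plus] is covered along with [lax]. *)
Record good_cost k : Prop := GoodCost {
  good_scc : forall p q y x, A p -> A q -> cdom p y -> cdom q x ->
    scc (fun z : V * V => k (cinv p z.1) (cinv q z.2)) (cmap p y, cmap q x);
  good_superlinear : forall a, 0 <= a -> exists C, forall x y, a * d x y - C <= k x y;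
  good_bounded : forall r, exists a, forall x y, d x y <= r -> k x y <= a }.

Lemma good_swap k : good_cost k -> good_cost (swap k).
Proof.
move=> [k1 k2 k3]; split.
- move=> p q y x Ap Aq py qx.
  pose sw := fun z : V * V => (z.2, z.1).
  have n_sw : nice sw (cmap p y, cmap q x).
    exists 1, 1; split=> // [z z' _ _|z h _ _].
      by rewrite mul1r !prod_normE/= maxC.
    have -> : sw (z + h) + sw (z - h) - 2 *: sw z = 0.
      rewrite /sw; congr pair; rewrite /= addrACA subrr addr0 scaler_nat mulr2n subrr//.
    by rewrite normr0 mulr_ge0// exprn_ge0.
  exact: (scc_comp n_sw (k1 q p x y Aq Ap qx py)).
- by move=> a a0; have [C hC] := k2 a a0; exists C => x y; rewrite d_sym; exact: hC.
- by move=> r; have [a ha] := k3 r; exists a => x y xy; apply: ha; rewrite d_sym.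
Qed.

Lemma good_partial k y x : good_cost k -> mscc_at A (k y) x.
Proof.
move=> gk q Aq qx; have [p Ap py] := atlas_cover sA y.
have [_ _ Kp _ _] := atlas_chart sA Ap.
pose j := fun w : V => (cmap p y, w).
have nj : nice j (cmap q x).
  exists 1, 1; split=> // [z z' _ _|z h _ _].
    by rewrite mul1r prod_normE/= subrr normr0 ge_max normr_ge0 lexx.
  have -> : j (z + h) + j (z - h) - 2 *: j z = 0.
    by rewrite /j; congr pair; rewrite /= scaler_nat mulr2n ?subrr// addrACA subrr addr0 subrr.
  by rewrite normr0 mulr_ge0// exprn_ge0.
apply: scc_near (scc_comp nj (good_scc gk Ap Aq py qx)).
by exists 1 => // w _; rewrite /= Kp.
Qed.

Lemma good_continuous k yx : good_cost k ->
  {for yx, continuous (fun z : M * M => k z.1 z.2)}.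
Proof.
case: yx => y x gk.
have [p Ap py] := atlas_cover sA y; have [q Aq qx] := atlas_cover sA x.
have cp := atlas_chart sA Ap; have cq := atlas_chart sA Aq.
have [op _ Kp cmp _] := cp; have [oq _ Kq cmq _] := cq.
have c1 := scc_continuous (good_scc gk Ap Aq py qx).
pose f (z : M * M) := (cmap p z.1, cmap q z.2).
have cf : {for (y, x), continuous f}.
  have f1 : {for (y, x), continuous (cmap p \o fst)}.
    by apply: (@continuous_comp _ _ _ fst (cmap p)); [exact: cvg_fst|exact: cmp].
  have f2 : {for (y, x), continuous (cmap q \o snd)}.
    by apply: (@continuous_comp _ _ _ snd (cmap q)); [exact: cvg_snd|exact: cmq].
  exact: (cvg_pair f1 f2).
have c2 := @continuous_comp _ _ _ f (fun z : V * V => k (cinv p z.1) (cinv q z.2)) (y, x) cf c1.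
rewrite /prop_for /continuous_at.
have -> : k (y, x).1 (y, x).2 = ((fun z : V * V => k (cinv p z.1) (cinv q z.2)) \o f) (y, x).
  by rewrite /= Kp// Kq.
apply: cvg_trans c2; apply: near_eq_cvg.
exists (cdom p, cdom q); first by split; apply: open_nbhs_nbhs.
by move=> [a b] /= [pa qb]; rewrite /= Kp// Kq.
Qed.

Section Subsolution.
Variables (k : M -> M -> R) (u : M -> R).
Hypothesis gk : good_cost k.
Hypothesis su : sub k u.

(** The bound of [k] at distance at most [1] controls [u] over one step, and [d_split] chains the
    steps. *)
Lemma sub_growth : exists2 a, 0 <= a & forall x y, u y - u x <= a * (d x y + 1).
Proof.
have [a0 ha0] := good_bounded gk 1; pose a := `|a0|.
have ha x y : d x y <= 1 -> u y - u x <= a.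
  by move=> /ha0 h; have := su x y; have := ler_norm a0; rewrite /a; lra.
(* Distances are counted in halves while steps have length [1]; the difference provides the strict
   inequality of [d_split]. *)
have steps m x y : d x y <= m%:R / 2 -> u y - u x <= (m%:R + 1) * a.
  elim: m x y => [|m IH] x y.
    by rewrite mul0r add0r mul1r => h; apply: ha; apply: le_trans h ler01.
  rewrite -natr1 => h; have [||z [xz zy]] := @d_split x y 1 (m%:R / 2) ler01.
  - by rewrite divr_ge0.
  - by lra.
  have := IH z y zy; have := ha x z xz; lra.
exists (4 * a) => [|x y]; first by rewrite mulr_ge0// normr_ge0.
have dn : 0 <= 2 * d x y by rewrite mulr_ge0.
have trm : (Num.trunc (2 * d x y)).+1%:R <= 2 * d x y + 1.
  by rewrite -natr1 lerD2r; have := truncn_le (2 * d x y); rewrite dn.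
have := @steps (Num.trunc (2 * d x y)).+1 x y.
have -> : d x y <= (Num.trunc (2 * d x y)).+1%:R / 2.
  have := truncnS_gt (2 * d x y); lra.
move=> /(_ isT)/le_trans; apply.
have a0' : 0 <= a by exact: normr_ge0.
have := d_ge0 x y; nra.
Qed.

Lemma lax_coercive (x0 : M) : exists2 K, compact K &
  \forall x \near x0, forall y, ~ K y -> lax k u x + 1 <= u y + k y x.
Proof.
have [a a0 ha] := sub_growth; have a10 : 0 <= a + 1 by lra.
have [C hC] := good_superlinear gk a10; have [b hb] := good_bounded gk 0.
(* Slope [a + 1] in the super-linearity beats the growth rate [a] of [u]: beyond distance [rho] from
   [x] the candidate exceeds [u x + b], hence [lax k u x], by [1]. Replacing [x] by the fixed centre
   [x0] costs one more unit of radius. *)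
pose rho := a + C + b + 1.
have [K cK hK] := d_compact x0 (rho + 1).
exists K => //; apply: filterS (d_near x0 ltr01) => x xx y nK.
have dx : rho + 1 < d x0 y by rewrite ltNge; apply/negP => /hK.
have := d_tri x0 x y; have := hC y x; have := ha y x.
have kxx : k x x <= b by apply: hb; rewrite d_refl.
have := lax_le x x su; rewrite [d x y]d_sym /rho in dx *; lra.
Qed.

Lemma sub_locally_bounded (x0 : M) : exists B, \forall x \near x0, `|u x| <= B.
Proof.
have [b hb] := good_bounded gk 1; exists (`|u x0| + `|b|).
apply: filterS (d_near x0 ltr01) => x xx.
have k1 : k x0 x <= b by apply: hb; exact: ltW.
have k2 : k x x0 <= b by apply: hb; rewrite d_sym ltW.
have := su x0 x; have := su x x0; have := ler_norm b; have := ler_norm (u x0).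
have := ler_norm (- u x0); rewrite normrN ler_norml; lra.
Qed.

Lemma lax_mscc (x0 : M) : mscc_at A (lax k u) x0.
Proof.
move=> q Aq qx; have cq := atlas_chart sA Aq.
have [K cK hK] := lax_coercive x0; have [B hB] := sub_locally_bounded x0.
have [b hb] := good_bounded gk 0.
have [e1 e10 he1] := chart_ball cq qx (filterI hK hB).
pose w0 := cmap q x0.
pose P (N : nat) y := forall w h, `|w + h - w0| * N.+1%:R <= 1 -> `|w - h - w0| * N.+1%:R <= 1 ->
  k y (cinv q (w + h)) + k y (cinv q (w - h)) - 2 * k y (cinv q w) <= N%:R * `|h| ^+ 2.
have [||N hN] := @compact_uniform_nat _ K P cK.
- move=> N N' y NN PN w h h1 h2.
  have S (z : V) : `|z| * N'.+1%:R <= 1 -> `|z| * N.+1%:R <= 1 :> R.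
    by apply: le_trans; rewrite ler_wpM2l// ler_nat ltnS.
  apply: le_trans (PN w h (S _ h1) (S _ h2)) _.
  by rewrite ler_wpM2r ?exprn_ge0// ler_nat.
- move=> y Ky; have [p Ap py] := atlas_cover sA y; have cp := atlas_chart sA Ap.
  have [_ _ Kp _ _] := cp.
  have [C [e [C0 e0 _ _ sd]]] := good_scc gk Ap Aq py qx.
  have [N CN small] := exists_nat_small C0 e0; exists N.
  have nb : nbhs (cmap p y) [set w | `|w - cmap p y| < e].
    by apply/nbhs_ballP; exists e => // w; rewrite -ball_normE/= distrC.
  apply: filterS (chart_nbhs cp py nb) => z [pz /= ze] w h /small h1 /small h2.
  have := sd (cmap p z, w) (0, h); rewrite !prod_normE/= addr0 subr0 !gt_max ze h1 h2 Kp//.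
  move=> /(_ isT isT) /le_trans; apply; rewrite normr0 max_r//.
  by rewrite ler_wpM2r ?exprn_ge0.
pose e := Num.min e1 N.+1%:R^-1.
have N0 : 0 < N.+1%:R :> R by rewrite ltr0n.
have e0 : 0 < e by rewrite lt_min e10 invr_gt0.
have eN (z : V) : `|z| < e -> `|z| * N.+1%:R <= 1 :> R.
  by rewrite lt_min => /andP[_ /ltW h]; rewrite -ler_pdivlMr// mul1r.
have ee1 (z : V) : `|z| < e -> `|z| < e1 :> R by rewrite lt_min => /andP[].
pose D := Num.max N%:R (`|B| + `|b|).
apply: (@sccI _ _ D e) => //.
  move=> w /ee1/he1[_ [_ hu]]; rewrite /D le_max; apply/orP; right.
  set x := cinv q w in hu *; have := lax_ge x su; have := lax_le x x su.
  have kxx : k x x <= b by apply: hb; rewrite d_refl.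
  have := ler_norm B; have := ler_norm b; move: hu; rewrite /= -/x !ler_norml.
  by have := normr_ge0 b; lra.
move=> w h hp hm; have w0' := midpoint_norm hp hm.
apply: le_trans (_ : N%:R * `|h| ^+ 2 <= _); last first.
  by rewrite ler_wpM2r ?exprn_ge0// le_max lexx.
apply/ler_addgt0Pr => eps eps0 /=.
(* The bound [1] forces the near-minimizer [y] at [w] into [K]; its error counts twice, hence
   [eps / 2]. The same [y] is a competitor at [w + h] and [w - h]. *)
pose eps' := Num.min 1 (eps / 2); have eps'0 : 0 < eps' by rewrite lt_min ltr01 divr_gt0.
have [y hy] := lax_near (cinv q w) eps'0 su.
have e1' : eps' <= 1 by rewrite /eps' ge_min lexx.
have e2' : eps' <= eps / 2 by rewrite /eps' ge_min lexx orbT.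
have Ky : K y.
  apply: contrapT => nK; have [_ [/(_ y nK) + _]] := he1 w (ee1 _ w0').
  by move: hy; lra.
have := hN y Ky w h (eN _ hp) (eN _ hm).
by have := lax_le (cinv q (w + h)) y su; have := lax_le (cinv q (w - h)) y su; lra.
Qed.

Lemma lax_attained x : continuous (u : M -> R^o) -> exists y, lax k u x = u y + k y x.
Proof.
move=> cu; have [K cK hK] := lax_coercive x; have {}hK := nbhs_singleton hK.
pose f y := u y + k y x.
have cf : continuous (f : M -> R^o).
  move=> y; apply: cvgD; first exact: cu.
  have := mscc_at_continuous sA (@good_partial (swap k) x y (good_swap gk)); exact.
have inK y : f y < lax k u x + 1 -> K y.
  by move=> fy; apply: contrapT => /hK; rewrite leNgt fy.
have K0 : K !=set0 by have [y /inK Ky] := lax_near x ltr01 su; exists y.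
have [y Ky ymin] := compact_EVT_min K0 cK (continuous_subspaceT cf).
exists y; apply/eqP; rewrite eq_le lax_le//=; apply/ler_addgt0Pr => e e0.
have e'0 : 0 < Num.min 1 e by rewrite lt_min ltr01.
have [z hz] := lax_near x e'0 su.
have Kz : K z.
  by apply: inK; apply: lt_le_trans hz _; rewrite lerD2l ge_min lexx.
have := ymin z; rewrite inE => /(_ Kz); rewrite /f => h.
apply: le_trans h _; apply: le_trans (ltW hz) _.
by rewrite lerD2l ge_min lexx orbT.
Qed.

End Subsolution.

Lemma lax_continuous k u : good_cost k -> sub k u -> continuous (lax k u : M -> R^o).
Proof. by move=> gk su x; exact: (mscc_at_continuous sA (@lax_mscc k u gk su x)). Qed.

Lemma lax_plus_mscc k u x : good_cost k -> sub k u ->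
  mscc_at A (fun z => - lax_plus k u z) x.
Proof.
move=> /good_swap gk /sub_swap su; apply: mscc_at_ext (@lax_mscc _ _ gk su x) => z.
by rewrite /lax_plus opprK.
Qed.

Lemma lax_plus_continuous k u : good_cost k -> sub k u ->
  continuous (lax_plus k u : M -> R^o).
Proof.
move=> /good_swap gk /sub_swap su x.
by apply: (@continuousN _ _ _ (lax (swap k) (fun y => - u y) : M -> R^o)); exact: lax_continuous.
Qed.

Lemma lax_plus_attained k u x : good_cost k -> sub k u -> continuous (u : M -> R^o) ->
  exists y, lax_plus k u x = u y - k x y.
Proof.
move=> /good_swap gk /sub_swap su cu.
have [|y hy] := lax_attained gk su x.
  by move=> z; apply: (@continuousN _ _ _ (u : M -> R^o)); exact: cu.
by exists y; rewrite /lax_plus hy /swap opprD opprK.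
Qed.

Lemma separating_bump (x y : M) : x <> y -> exists b : M -> R,
  [/\ forall z, b z <= 1, b x = 1, b y = 0 & continuous (b : M -> R^o)].
Proof.
move=> xy; have oN : open (~` [set y]).
  by apply: closed_openC; apply: accessible_closed_set1; exact: hausdorff_accessible.
have nN : nbhs x (~` [set y]) by exact: open_nbhs_nbhs.
have [p [r [b [Ap r0 hN b0 [b01 bx bt]]]]] := manifold_bump mA nN.
exists b; split.
- by move=> z; case/andP: (b01 z).
- exact: nbhs_singleton bx.
- have [_ _ Kp _ _] := atlas_chart sA Ap.
  have [py|py] := pselect (cdom p y); last by apply: b0; left.
  apply: b0; right; rewrite ltNge; apply/negP => /hN[_]; rewrite /= Kp//; exact.
- by move=> z; have [s _] := bt z; exact: (mscc_at_continuous sA s).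
Qed.

(* Raising [u] to [lax k u] away from [y] makes it continuous off [y] and keeps
   the pair strict; [lax_plus] of the result bounds the continuous competitor
   from below. *)
Lemma strict_continuous k u x y : good_cost k -> sub k u -> u y - u x < k x y ->
  exists v, [/\ sub k v, continuous (v : M -> R^o) & v y - v x < k x y].
Proof.
move=> gk su uxy; have [xy|xy] := pselect (x = y).
  exists (lax k u); split; [exact: sub_lax|exact: lax_continuous|].
  by move: uxy; rewrite xy !subrr.
pose u1 := lax k u; pose uh z := if `[< z = y >] then u y else u1 z.
have u1u z : u z <= u1 z by exact: lax_ge.
have uhE z : u z <= uh z <= u1 z.
  by rewrite /uh; case: asboolP => [->|_]; rewrite ?u1u lexx.
have suh : sub k uh by exact: sub_between su uhE.
have [b [b1 bx b_y cb]] := separating_bump xy.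
pose Nc := u1 y - u y; have Nc0 : 0 <= Nc by rewrite subr_ge0.
pose w z := u1 z - Nc * (1 - b z).
pose v z := Num.max (lax_plus k uh z) (w z).
have vuh z : lax_plus k uh z <= v z <= uh z.
  rewrite /v le_max lexx ge_max lax_plus_le//= /w /uh; case: asboolP => [->|_].
    by rewrite b_y /Nc; lra.
  by rewrite gerBl mulr_ge0// subr_ge0.
exists v; split.
- exact: sub_between_plus suh vuh.
- move=> z; apply: (@continuous_max R M); first exact: lax_plus_continuous.
  apply: cvgB; first exact: lax_continuous.
  apply: cvgM; first exact: cvg_cst.
  by apply: cvgB; [exact: cvg_cst|exact: cb].
- have : v y <= u y by have /andP[_] := vuh y; rewrite /uh asboolT.
  have : u1 x <= v x by rewrite /v le_max /w bx subrr mulr0 subr0 lexx orbT.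
  by have := u1u x; lra.
Qed.

Lemma le_exp2_le0 (a C : R) : (forall m, a <= C * (2 ^+ m)^-1) -> a <= 0.
Proof.
move=> h; rewrite leNgt; apply/negP => a0.
suff a00 : a = 0 by move: a0; rewrite a00 ltxx.
by apply: (@le_exp2_eq0 _ _ C 0%N) => m _; rewrite gtr0_norm.
Qed.

(** The series of the [F i / 2^(i+1)], obtained as a supremum of partial sums lowered by the bound
    on their tails. *)
Lemma dyadic_average (F : nat -> M -> R) (B : M -> R) :
  (forall i z, `|F i z| <= B z) -> exists f : M -> R,
  forall m z, `|f z - \sum_(i < m) (2 ^+ i.+1)^-1 * F i z| <= B z * (2 ^+ m)^-1.
Proof.
move=> FB; pose p m : R := 2 ^+ m.
have p0 m : 0 < p m by rewrite exprn_gt0.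
have pS m : p m.+1 = 2 * p m by rewrite /p exprS.
pose S m z := \sum_(i < m) (p i.+1)^-1 * F i z.
have half m z : B z * (p m)^-1 = 2 * (B z * (p m.+1)^-1).
  by rewrite pS; field; rewrite gt_eqF.
have step m z : `|S m.+1 z - S m z| <= B z * (p m.+1)^-1.
  rewrite /S big_ord_recr/= addrAC subrr add0r normrM gtr0_norm ?invr_gt0//.
  by rewrite mulrC ler_wpM2r ?invr_ge0// ltW.
have mono i j z : (i <= j)%N ->
    S i z - B z * (p i)^-1 <= S j z - B z * (p j)^-1 /\
    S j z + B z * (p j)^-1 <= S i z + B z * (p i)^-1.
  move=> /subnKC <-; elim: (j - i)%N => [|m [IH1 IH2]]; first by rewrite addn0.
  rewrite addnS; have := step (i + m)%N z; rewrite ler_norml.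
  by have := half (i + m)%N z; split; lra.
have B0 z : 0 <= B z by apply: le_trans (FB 0%N z).
have BB m z : 0 <= B z * (p m)^-1 by rewrite mulr_ge0// invr_ge0 ltW.
have cross i j z : S i z - B z * (p i)^-1 <= S j z + B z * (p j)^-1.
  have [ij|/ltnW ij] := leqP i j; have := mono _ _ z ij; have := BB i z; have := BB j z; lra.
exists (fun z => sup [set S m z - B z * (p m)^-1 | m in [set: nat]]) => m z.
rewrite -/(S m z) -/(p m); set E := [set _ | _ in _].
have h1 : sup E <= S m z + B z * (p m)^-1.
  apply: ge_sup => [|_ [i _ <-]]; last exact: cross.
  by exists (S 0%N z - B z * (p 0%N)^-1), 0%N.
have h2 : S m z - B z * (p m)^-1 <= sup E.
  apply: ub_le_sup; last by exists m.
  by exists (S 0%N z + B z * (p 0%N)^-1) => _ [i _ <-]; exact: cross.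
rewrite ler_norml; lra.
Qed.

Lemma dyadic_sum m : \sum_(i < m) (2 ^+ i.+1)^-1 = 1 - (2 ^+ m)^-1 :> R.
Proof.
elim: m => [|m IH]; first by rewrite big_ord0 expr0 invr1 subrr.
rewrite big_ord_recr/= IH exprS; have : 2 ^+ m != 0 :> R by rewrite expf_neq0.
by move=> h; field.
Qed.

Lemma maximally_strict k u (x0 : M) : good_cost k -> sub k u -> exists u0 : M -> R,
  [/\ sub k u0, continuous (u0 : M -> R^o) & forall x y,
    (exists2 v, sub k v & v y - v x < k x y) -> u0 y - u0 x < k x y].
Proof.
move=> gk su; pose S := [set z : M * M | exists2 v, sub k v & v z.2 - v z.1 < k z.1 z.2].
have [[z0 Sz0]|S0] := pselect (S !=set0); last first.
  exists (lax k u); split; [exact: sub_lax|exact: lax_continuous|].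
  by move=> x y h; case: S0; exists (x, y).
have [V hV] : {V : M * M -> M -> R & forall z, S z -> [/\ sub k (V z),
    continuous (V z : M -> R^o) & V z z.2 - V z z.1 < k z.1 z.2]}.
  apply: (@choice _ _ (fun z v => S z -> [/\ sub k v,
    continuous (v : M -> R^o) & v z.2 - v z.1 < k z.1 z.2])) => -[x y].
  have [[v sv vxy]|nS] := pselect (S (x, y)); last by exists u.
  by have [w hw] := strict_continuous gk sv vxy; exists w.
pose O z := [set ab : M * M | V z ab.2 - V z ab.1 < k ab.1 ab.2].
have hO z : S z -> nbhs z (O z).
  move=> /hV[_ cv lt]; pose D (ab : M * M) := k ab.1 ab.2 - (V z ab.2 - V z ab.1).
  have cD : {for z, continuous (D : M * M -> R^o)}.
    apply: cvgB; first exact: good_continuous gk.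
    apply: cvgB.
      by apply: (@continuous_comp _ _ _ snd (V z)); [exact: cvg_snd|exact: cv].
    by apply: (@continuous_comp _ _ _ fst (V z)); [exact: cvg_fst|exact: cv].
  have D0 : 0 < D z by rewrite subr_gt0.
  have nD : nbhs z (D @^-1` [set t : R | 0 < t]) by apply: cD; exact: lt_nbhsr.
  by apply: filterS nD => ab; rewrite /= /D subr_gt0.
have [U bU] := second_countable_base (manifold_second_countable mA).
have [U2 bU2] := countable_base_prod bU.
have [s [Ss hs]] := lindelof bU2 Sz0 hO.
have sV i : sub k (V (s i)) by have [] := hV _ (Ss i).
have cV i : continuous (V (s i) : M -> R^o) by have [] := hV _ (Ss i).
(* Normalizing at [x0] leaves differences unchanged and subjects all the functions to one bound
   [B]. *)
pose F i z := V (s i) z - V (s i) x0; pose B z := `|k x0 z| + `|k z x0|.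
have FB i z : `|F i z| <= B z.
  have := sV i x0 z; have := sV i z x0; rewrite /F /B ler_norml.
  have := ler_norm (k x0 z); have := ler_norm (k z x0).
  by have := normr_ge0 (k x0 z); have := normr_ge0 (k z x0); lra.
have [f hf] := dyadic_average FB.
(* No term exceeds its share of [k x y], so the average keeps the fraction [1 / 2^(i+1)] of the
   slack of [V (s i)]. *)
have key i x y : f y - f x <= k x y - (2 ^+ i.+1)^-1 * (k x y - (V (s i) y - V (s i) x)).
  pose D j := V (s j) y - V (s j) x.
  have Dk j : 0 <= k x y - D j by rewrite subr_ge0; exact: sV.
  have w0 j : 0 < (2 ^+ j)^-1 :> R by rewrite invr_gt0 exprn_gt0.
  rewrite -subr_le0; apply: (@le_exp2_le0 _ (B x + B y + `|k x y|)) => m'.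
  pose m := (i.+1 + m')%N; have im : (i < m)%N by rewrite /m leq_addr.
  have wm : (2 ^+ m)^-1 <= (2 ^+ m')^-1 :> R.
    by rewrite lef_pV2 ?posrE ?exprn_gt0// ler_weXn2l ?ler1n// leq_addl.
  have Sm : \sum_(j < m) (2 ^+ j.+1)^-1 * F j y - \sum_(j < m) (2 ^+ j.+1)^-1 * F j x <=
      (1 - (2 ^+ m)^-1) * k x y - (2 ^+ i.+1)^-1 * (k x y - D i).
    rewrite -sumrB -dyadic_sum mulr_suml lerBrDr -lerBrDl -sumrB.
    rewrite (bigD1 (Ordinal im))//= -[leLHS]addr0; apply: lerD.
      by rewrite le_eqVlt; apply/orP; left; apply/eqP; rewrite /F /D; ring.
    apply: sumr_ge0 => j _; rewrite [leRHS](_ : _ = (2 ^+ j.+1)^-1 * (k x y - D j)).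
      by rewrite mulr_ge0// ltW.
    by rewrite /F /D; ring.
  have := hf m x; have := hf m y; rewrite !ler_norml.
  set Sx := \sum_(j < m) _ * F j x in Sm *; set Sy := \sum_(j < m) _ * F j y in Sm *.
  have := w0 m; set e := (2 ^+ m)^-1 in wm Sm *; set e' := (2 ^+ m')^-1 in wm *.
  rewrite -/(D i); set q := (2 ^+ i.+1)^-1 * _ in Sm *.
  have B0 z : 0 <= B z by rewrite addr_ge0.
  have p1 : B x * e <= B x * e' by rewrite ler_wpM2l.
  have p2 : B y * e <= B y * e' by rewrite ler_wpM2l.
  have p3 : `|k x y| * e <= `|k x y| * e' by rewrite ler_wpM2l.
  move=> e0; have p4 : - (e * k x y) <= `|k x y| * e.
    by rewrite mulrC -mulNr ler_wpM2r ?(ltW e0)// -normrN ler_norm.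
  lra.
exists f; split.
- move=> x y; apply: le_trans (key 0%N x y) _; rewrite gerBl mulr_ge0 ?invr_ge0 ?exprn_ge0//.
  by rewrite subr_ge0; exact: sV.
(* Continuity of [B] makes the tails uniformly small near [z], and the partial sums are
   continuous. *)
- have cB z : {for z, continuous (B : M -> R^o)}.
    have c1 : {for z, continuous (k x0 : M -> R^o)}.
      exact: (mscc_at_continuous sA (@good_partial k x0 z gk)).
    have c2 : {for z, continuous (swap k x0 : M -> R^o)}.
      exact: (mscc_at_continuous sA (@good_partial (swap k) x0 z (good_swap gk))).
    exact: (cvgD (cvg_norm c1) (cvg_norm c2)).
  have cF i z : {for z, continuous (F i : M -> R^o)}.
    by apply: cvgB; [exact: cV|exact: cvg_cst].
  move=> z; apply/cvgrPdist_lt => eps eps0.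
  have B0 y : 0 <= B y by rewrite addr_ge0.
  have [m hm] := exists_exp2_lt (4 * (B z + 1)) eps0.
  have p0 : 0 < 2 ^+ m :> R by rewrite exprn_gt0.
  pose Sm y : R := \sum_(j < m) (2 ^+ j.+1)^-1 * F j y.
  have cS : {for z, continuous (Sm : M -> R^o)}.
    apply: (@continuous_sum R M m (fun (j : 'I_m) y => (2 ^+ j.+1)^-1 * F j y)) => j.
    by apply: cvgM; [exact: cvg_cst|exact: cF].
  have e20 : 0 < eps / 2 by rewrite divr_gt0.
  have nB : nbhs z (B @^-1` [set t | t < B z + 1]).
    by apply: cB; apply: lt_nbhsl; rewrite ltrDl.
  have /cvgrPdist_lt /(_ _ e20) nS := cS.
  apply: filterS2 nB nS => y /= By Sy.
  have := hf m z; have := hf m y; rewrite -/(Sm z) -/(Sm y).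
  have h1 : B y * (2 ^+ m)^-1 < eps / 4.
    by rewrite ltr_pdivrMr//; lra.
  have h2 : B z * (2 ^+ m)^-1 < eps / 4.
    by rewrite ltr_pdivrMr//; lra.
  by move: Sy; rewrite !ltr_norml !ler_norml; lra.
- move=> x y [v sv vxy]; have [i] := hs (x, y) (ex_intro2 _ _ v sv vxy).
  rewrite /O/= => lt; apply: le_lt_trans (key i x y) _.
  by rewrite gtrBl mulr_gt0 ?invr_gt0 ?exprn_gt0// subr_gt0.
Qed.

Lemma regular_strict (c : M * M -> R) (a : R) u (x0 : M) :
  let k := fun x y => c (x, y) + a in
  left_twist A c -> good_cost k -> sub k u -> exists u1 : M -> R,
  [/\ C11 A u1, sub k u1 & forall x y,
    (exists2 v, sub k v & v y - v x < k x y) -> u1 y - u1 x < k x y].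
Proof.
move=> k tw gk su; have [u0 [su0 cu0 st0]] := maximally_strict x0 gk su.
have tight_all x y v : tight k u0 x y -> sub k v -> tight k v x y.
  move=> t sv; apply/eqP; rewrite eq_le sv leNgt; apply/negP => lt.
  have := st0 x y (ex_intro2 _ _ v sv lt); rewrite -t; lra.
pose f := lax_plus k u0; have sf : sub k f by exact: sub_lax_plus.
have mf x : mscc_at A (fun z => - f z) x by exact: lax_plus_mscc.
have mc x y : mscc_at A (fun z => c (x, z)) y.
  apply: (@mscc_at_ext _ _ _ A _ (fun z => k x z + - a)); first by move=> z; rewrite /k addrK.
  by apply: mscc_at_add; [exact: good_partial|exact: mscc_at_cst].
have tight_diff x y : tight k f x y -> mdifferentiable A (fun z => c (x, z)) y /\
    forall p : charts_at A y, mdiff (fun z => - f z) p = (fun h => - mdiff (fun z => c (x, z)) p h).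
  move=> t; have [|h1 _ h2] := @mscc_touch R n M A sA (fun z => c (x, z)) (fun z => - f z) y (@mc x y) (@mf y);
    last by split.
  by apply: nearW => z; have := sf x z; move: t; rewrite /tight /k; lra.
have tight_f x y : tight k f x y -> tight k u0 x y.
  (* Calibration of [f] on [(x, y)] forces [f y = u0 y]; a maximizer [z] in the definition of [f y]
     then calibrates [u0] on [(y, z)]. *)
  move=> t; have [fy fx] := tight_lax_plus su0 t.
  have [z fz] := lax_plus_attained y gk su0 cu0.
  have tyz : tight k u0 y z by move: fz; rewrite fy /tight; lra.
  (* The subsolution [lax k u0] is calibrated on [(y, z)] as well, which forces [lax k u0 y = u0 y];
     a minimizer [x'] is the calibrated predecessor of [y]. *)
  have [ly _] := tight_lax su0 (tight_all _ _ _ tyz (sub_lax su0)).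
  have [x' lx'] := lax_attained gk su0 y cu0.
  have tx' : tight k u0 x' y by move: lx'; rewrite ly /tight; lra.
  have [d1 e1] := tight_diff _ _ t; have [d2 e2] := tight_diff _ _ (tight_all _ _ _ tx' sf).
  suff -> : x = x' by [].
  (* In every chart around [y] the differential of [- f] is the opposite of both differentials; this
     is their equality as covectors. *)
  apply: (tw y); rewrite ?inE//; apply: functional_extensionality_dep => p.
  apply/funext => h; apply/eqP; rewrite -eqr_opp; apply/eqP.
  exact: (congr1 (fun F => F h) (etrans (esym (e1 p)) (e2 p))).
have [v [vb vs vt]] := insertion_manifold mA (fun z => lax_ge z sf) mf (fun z => lax_mscc gk sf (x0 := z)).
exists v; split.
- by apply: (mscc_C11 sA) => z; have [] := vt z.
- exact: sub_between sf vb.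
- move=> x y [w sw wxy]; rewrite ltNge; apply/negP => tv.
  have /andP[v1 v2] := vb y; have /andP[v3 v4] := vb x.
  have ly := lax_le y x sf.
  (* If [v] is not strict, equality holds throughout [v y <= lax k f y <= f x + k x y <= v x + k x
     y]. Then [f y < lax k f y] would contradict the strict insertion, so [f] itself is calibrated
     on [(x, y)]. *)
  have fy : f y = lax k f y.
    apply/eqP; rewrite eq_le lax_ge//= leNgt; apply/negP => /vs/andP[_]; lra.
  have : tight k f x y by rewrite /tight; lra.
  by move=> /tight_f/tight_all/(_ sw); rewrite /tight => tw'; move: wxy; rewrite tw' ltxx.
Qed.

End GoodCost.
Theorem theorem0p1 (R : realType) (n : nat) (M : topologicalType)
    (A : set (chart M 'rV[R]_n))
    (g : chart M 'rV[R]_n -> M -> 'rV[R]_n -> 'rV[R]_n -> R)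
    (c : M * M -> R)
    (M_manifold : smooth_manifold A)
    (g_metric : riemannian_metric A g)
    (M_connected : connected [set: M])
    (M_complete : complete_dist (rdist A g))
    (c_semiconcave : locally_semiconcave (prod_atlas A) c)
    (c_superlinear : uniformly_superlinear (rdist A g) c)
    (c_bounded : uniformly_bounded (rdist A g) c)
    (c_left_twist : left_twist A c)
    (c_right_twist : right_twist A c) :
  exists u1 : M -> R,
    [/\ C11 A u1,
        subsolution c (critical_constant c) u1 &
        forall x y : M,
          (exists u : M -> R, subsolution c (critical_constant c) u /\
             u y - u x < c (x, y) + critical_constant c) ->
          u1 y - u1 x < c (x, y) + critical_constant c].
Proof.
(* The base point [x0] starts the chains and normalizes the averages; on the empty manifold any
   function will do. *)
have [[x0 _]|M0] := pselect ([set: M] !=set0); last first.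
  have noM (x : M) : False by apply: M0; exists x.
  exists (fun=> 0); split=> [p Ap|x|x]; [|by case: (noM x)|by case: (noM x)].
  split; last by move=> w [x]; case: (noM x).
  by split=> [w [x]|v]; [case: (noM x)|split=> [w [x]|]; [|split=> // w [x]]; case: (noM x)].
have sA := manifold_structure M_manifold; have hM := manifold_hausdorff M_manifold.
pose a := critical_constant c.
(* Slope [0] in the super-linearity bounds [c] below, and radius [0] in the boundedness bounds it on
   the diagonal; these two bounds confine the critical constant. *)
have [C0 hC0] := c_superlinear 0 (lexx 0).
have [b0 hb0] := c_bounded 0.
have dr := rdist_refl M_manifold g_metric.
have [||u su] := @critical_subsolution R M c x0 C0 b0.
- by move=> [x y]; have := hC0 x y; rewrite mul0r; lra.
- by move=> x; apply: hb0; rewrite dr.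
have ds := rdist_sym M_manifold g_metric M_connected.
have dt := rdist_triangle M_manifold g_metric M_connected.
have dn := rdist_near M_manifold g_metric.
have dsp := rdist_split M_manifold g_metric M_connected.
have dsm := rdist_small_ball M_manifold g_metric M_connected.
have dc := hopf_rinow dr ds dt dn dsp dsm M_complete.
have gk : good_cost A (rdist A g) (fun x y => c (x, y) + a).
  split.
  - move=> p q y x Ap Aq py qx.
    exact: scc_add (semiconcave_prod_chart sA c_semiconcave Ap Aq py qx) (scc_cst a _).
  - move=> k k0; have [C hC] := c_superlinear k k0; exists (C - a) => x y.
    by have := hC x y; lra.
  - by move=> r; have [b hb] := c_bounded r; exists (b + a) => x y /hb; rewrite lerD2r.
have [u1 [c1 s1 h1]] := regular_strict M_manifold (rdist_ge0 M_manifold g_metric)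
  dr ds dt dn dsp dc x0 c_left_twist gk su.
exists u1; split=> // x y [v [sv vxy]].
by apply: h1; exists v.
Qed.
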